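(* Let $k=\mathbb{F}_q$ with $q$ a power of $2$. There are $q^6-q^5+q^4-3q^3+5q^2-6q+7$ $\mathbb{F}_q$-isomorphism classes of ordinary non-hyperelliptic curves of genus three defined over $\mathbb{F}_q$. According to the minimum field of definition of their bitangents they are distributed as follows: $|\mathcal{C}_1|=\frac{1}{168}(q^6-7q^5+42q^4-140q^3+343q^2-462q+328)$, $|\mathcal{C}_2|=\frac18(q^6-3q^5+6q^4-12q^3+15q^2-6q)$, $|\mathcal{C}_3|=\frac13(q^6-q^5-2q^3+4q^2-6q+7)$, $|\mathcal{C}_4|=\frac14(q^6-q^5-q^2-2q+4)$, $|\mathcal{C}_{7,0}|=|\mathcal{C}_{7,1}|=\frac17(q^6+6)$.
   Context: Non-hyperelliptic genus-3 curves are the non-singular plane quartics; such a curve is ordinary if its Jacobian has $2$-rank $3$, equivalently it has exactly seven bitangents. Let $\sigma$ be the $q$-Frobenius acting on coefficients; for $C$ defined over $k$, $\sigma$ permutes the seven bitangents. For $d\in\{1,2,3,4\}$, $\mathcal{C}_d$ is the set of $k$-isomorphism classes of ordinary non-singular quartics over $k$ for which the smallest extension $K$ of $k$ over which all seven bitangents are defined has $[K:k]=d$. When $[K:k]=7$, $\sigma$ permutes the seven bitangents cyclically; $\mathcal{C}_{7,0}$ (resp. $\mathcal{C}_{7,1}$) is the set of $k$-isomorphism classes of such curves for which, for a bitangent $\ell$, the three lines $\ell,\sigma(\ell),\sigma^3(\ell)$ (resp. $\ell,\sigma^2(\ell),\sigma^3(\ell)$) are concurrent. (The degree $[K:k]$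 always lies in $\{1,2,3,4,7\}$, and in degree $7$ exactly one of the two concurrency conditions holds.) *)

(* Defs.v *)
From HB Require Import structures.
From mathcomp Require Import all_boot all_order all_algebra.
From mathcomp Require Import mpoly.
Set Implicit Arguments. Unset Strict Implicit. Unset Printing Implicit Defensive.
Import Order.TTheory GRing.Theory.
Local Open Scope ring_scope.

(* Exponent pairs (i,j) with i + j <= 4; they index the monomials
   X^i Y^j Z^(4-i-j) of a ternary quartic form. *)
Definition mon := {m : 'I_5 * 'I_5 | (m.1 + m.2 <= 4)%N}.

Definition quartic (F : fieldType) := {ffun mon -> F}.

Definition qpoly (F : fieldType) (f : quartic F) : {mpoly F[3]} :=
  \sum_(m : mon) f m *: ('X_0 ^+ (val m).1 * 'X_1 ^+ (val m).2
                          * 'X_2 ^+ (4 - (val m).1 - (val m).2)).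

Definition qsubst (F : fieldType) (A : 'M[F]_3) (p : {mpoly F[3]}) : {mpoly F[3]} :=
  p \mPo [tuple \sum_(j < 3) A i j *: 'X_j | i < 3].

(* k-isomorphism of (non-singular, hence canonically embedded) plane quartics:
   projective linear equivalence over k. *)
Definition iso (F : fieldType) (f g : quartic F) : Prop :=
  exists (A : 'M[F]_3) (l : F),
    A \in unitmx /\ l != 0 /\ qpoly g = l *: qsubst A (qpoly f).

Definition qL (F : fieldType) (L : fieldType) (iota : {rmorphism F -> L})
  (f : quartic F) : {mpoly L[3]} := map_mpoly iota (qpoly f).

Definition nonzero3 (L : fieldType) (v : 'I_3 -> L) := exists i, v i != 0.

Definition nonsingular (F L : fieldType) (iota : {rmorphism F -> L}) (f : quartic F) :=
  forall v : 'I_3 -> L, nonzero3 v ->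
    (qL iota f).@[v] = 0 -> exists i : 'I_3, (mderiv i (qL iota f)).@[v] != 0.

Definition linform (L : fieldType) (v : 'I_3 -> L) : {mpoly L[3]} :=
  \sum_(j < 3) v j *: 'X_j.

(* Bitangent: the restriction of the quartic to the line is a square of a
   binary quadratic form, i.e. f = g^2 + l*h with g a quadratic form. *)
Definition bitangent (F L : fieldType) (iota : {rmorphism F -> L}) (f : quartic F)
  (v : 'I_3 -> L) : Prop :=
  nonzero3 v /\
  exists g h : {mpoly L[3]}, g \is 2.-homog /\ qL iota f = g ^+ 2 + linform v * h.

Definition proportional (L : fieldType) (u v : 'I_3 -> L) :=
  exists c : L, c != 0 /\ forall i, u i = c * v i.

Definition seven_bitangents (F L : fieldType) (iota : {rmorphism F -> L})
  (f : quartic F) :=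
  exists s : 7.-tuple ('I_3 -> L),
    (forall i, bitangent iota f (tnth s i)) /\
    (forall i j, i != j -> ~ proportional (tnth s i) (tnth s j)) /\
    (forall v, bitangent iota f v -> exists i, proportional v (tnth s i)).

(* Ordinary non-singular quartic (2-rank 3 <=> exactly seven bitangents). *)
Definition ord_quartic (F L : fieldType) (iota : {rmorphism F -> L}) (f : quartic F) :=
  nonsingular iota f /\ seven_bitangents iota f.

(* A line is defined over F_{q^d} (= {x in L | x^(q^d) = x}) if it has a
   representative with coordinates there. *)
Definition line_defined_over (L : fieldType) (q d : nat) (v : 'I_3 -> L) :=
  exists w : 'I_3 -> L, proportional v w /\ forall i, w i ^+ (q ^ d) = w i.

Definition all_bitangents_over (F L : fieldType) (iota : {rmorphism F -> L})
  (q : nat) (f : quartic F) (d : nat) :=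
  forall v, bitangent iota f v -> line_defined_over q d v.

Definition bitangent_degree (F L : fieldType) (iota : {rmorphism F -> L})
  (q : nat) (f : quartic F) (d : nat) :=
  (0 < d)%N /\ all_bitangents_over iota q f d /\
  forall e, (0 < e < d)%N -> ~ all_bitangents_over iota q f e.

Definition frob (L : fieldType) (q n : nat) (v : 'I_3 -> L) : 'I_3 -> L :=
  fun i => v i ^+ (q ^ n).

Definition concurrent (L : fieldType) (u v w : 'I_3 -> L) :=
  \det (\matrix_(i < 3, j < 3) nth u [:: u; v; w] i j) = 0.

Definition Cd (F L : fieldType) (iota : {rmorphism F -> L}) (q d : nat) (f : quartic F) :=
  ord_quartic iota f /\ bitangent_degree iota q f d.

Definition C70 (F L : fieldType) (iota : {rmorphism F -> L}) (q : nat) (f : quartic F) :=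
  ord_quartic iota f /\ bitangent_degree iota q f 7 /\
  exists v, bitangent iota f v /\ concurrent v (frob q 1 v) (frob q 3 v).

Definition C71 (F L : fieldType) (iota : {rmorphism F -> L}) (q : nat) (f : quartic F) :=
  ord_quartic iota f /\ bitangent_degree iota q f 7 /\
  exists v, bitangent iota f v /\ concurrent v (frob q 2 v) (frob q 3 v).

Definition nclasses (F : fieldType) (P : quartic F -> Prop) (N : nat) :=
  exists s : N.-tuple (quartic F),
    (forall i, P (tnth s i)) /\
    (forall i j, i != j -> ~ iso (tnth s i) (tnth s j)) /\
    (forall g, P g -> exists i, iso (tnth s i) g).

(* Main.v *)
(* A plane quartic over a field of characteristic 2 reads
     f = sum_i x_i^2 (N c)_i + (quadratic form in the x_i^2),  c = (yz, zx, xy),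
   and a line v is a bitangent iff N v is proportional to the vector v^(2) of
   squares.  So f is ordinary iff N is invertible, and then, by Lang's theorem,
   a linear change of variables R over L brings N to a scalar matrix: the
   bitangents become the lines of the Fano plane, f becomes
   Q^2 + xyz(x+y+z) up to a scalar, and R is unique up to GL_3(F_2).
   The only possible singular points are the seven points p of P^2(F_2); the
   values t_p = f(p) determine Q, are subject only to sum_p t_p = 1, and f is
   non-singular iff all t_p are nonzero.
   If f is defined over F_q, then R = g R^(q) for some g in GL_3(F_2), unique
   up to conjugation, which describes the Frobenius action on the bitangents.
   The classes attached to g are the orbits of the centralizer C(g) on
     X_g = { t : t_p <> 0, sum_p t_p = 1, t_(gp) = t_p^q },
   which are counted by Burnside's lemma: the points of X_g fixed by h in C(g)
   correspond to tuples (s_i) of nonzero s_i in F_(q^(n_i)), one for each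
   <g,h>-orbit, such that the traces of the s_i coming from the odd orbits add
   up to 1. *)
Require Import Defs.
From HB Require Import structures.
From mathcomp Require Import all_boot all_order all_algebra all_field.
From mathcomp Require Import mpoly ring.
(* Imported again because mathcomp's own qpoly shadows that of Defs. *)
Require Import Defs.
Set Implicit Arguments. Unset Strict Implicit. Unset Printing Implicit Defensive.
Import Order.TTheory GRing.Theory.
Local Open Scope ring_scope.

(** * Quartics in characteristic 2 *)

(** A quartic is handled through its values on L^3: L is infinite, so these determine the form, and
    a change of coordinates is a substitution into the function [qf B N]. The split into [B] and [N]
    pays off because squares have zero derivative and because the [N] of a transform does not depend
    on the old [B]. So the gradient, and with it the bitangents, only sees [N], while [B] stays free
    and carries the values t_p. That an ordinary quartic has [N] invertible is a count. A kernel of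
    dimension at least 2 would contain more than seven bitangents. If the kernel is a line, the
    other bitangents rescale to nonzero vectors of an F_2-space of dimension at most 2, so there are
    at most four bitangents in all. Two Frobenius maps are at work: squaring produces the Fano
    structure (Lang with exponent 2), the q-th power produces g, and since they commute, g is fixed
    by squaring, hence has entries in F_2. All facts about GL_3(F_2) and its orbits on the Fano
    plane are evaluated. Only the number of tuples with a prescribed sum of traces depends on q, and
    it is computed as a polynomial in q. *)

Notation o0 := (@Ordinal 3 0 isT).
Notation o1 := (@Ordinal 3 1 isT).
Notation o2 := (@Ordinal 3 2 isT).

Lemma ord3_ind (P : 'I_3 -> Prop) : P o0 -> P o1 -> P o2 -> forall i, P i.
Proof.
move=> P0 P1 P2 [[|[|[|//]]] Hi].
- by rewrite (_ : Ordinal Hi = o0) //; apply: val_inj.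
- by rewrite (_ : Ordinal Hi = o1) //; apply: val_inj.
- by rewrite (_ : Ordinal Hi = o2) //; apply: val_inj.
Qed.

Lemma sum3E (V : nmodType) (f : 'I_3 -> V) :
  \sum_(i < 3) f i = f o0 + f o1 + f o2.
Proof.
rewrite 3!big_ord_recl big_ord0 addr0 addrA.
by congr (f _ + f _ + f _); apply: val_inj.
Qed.

Lemma col3P (T : Type) (x y : 'cV[T]_3) :
  x o0 0 = y o0 0 -> x o1 0 = y o1 0 -> x o2 0 = y o2 0 -> x = y.
Proof.
by move=> h0 h1 h2; apply/matrixP=> i j; rewrite (ord1 j); elim/ord3_ind: i.
Qed.

Lemma det2E (R : comNzRingType) (A : 'M[R]_2) : \det A = A 0 0 * A 1 1 - A 0 1 * A 1 0.
Proof.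
rewrite (expand_det_row _ 0) !big_ord_recl big_ord0 /cofactor !det_mx11 !mxE /= !addn0 /=.
rewrite expr0 expr1 mul1r mulN1r mulrN addr0.
by congr (A _ _ * A _ _ - A _ _ * A _ _); apply: val_inj.
Qed.
Lemma det3E (R : comNzRingType) (A : 'M[R]_3) : \det A =
  A o0 o0 * (A o1 o1 * A o2 o2 - A o1 o2 * A o2 o1)
  - A o0 o1 * (A o1 o0 * A o2 o2 - A o1 o2 * A o2 o0)
  + A o0 o2 * (A o1 o0 * A o2 o1 - A o1 o1 * A o2 o0).
Proof.
rewrite (expand_det_row _ o0) !big_ord_recl big_ord0 /cofactor !det2E !mxE /=.
rewrite expr0 expr1 sqrrN expr1n mul1r mulN1r mulrN addr0 mul1r addrA.
by congr (A _ _ * (A _ _ * A _ _ - A _ _ * A _ _) - A _ _ * (A _ _ * A _ _ - A _ _ * A _ _) + A _ _ * (A _ _ * A _ _ - A _ _ * A _ _)); apply: val_inj.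
Qed.

Definition nx (i : 'I_3) : 'I_3 := nth o0 [:: o1; o2; o0] i.

Section Forms.
Variable R : comNzRingType.
Implicit Types (x : 'cV[R]_3) (A B N : 'M[R]_3).

Definition sqm m n (A : 'M[R]_(m, n)) := map_mx (fun z => z ^+ 2) A.

Definition crs x : 'cV[R]_3 := \col_i (x (nx i) 0 * x (nx (nx i)) 0).

(* Every ternary quartic form is [qf B N]: its monomials are the [(x_i x_j)^2]
   and the products of [x_i^2] with an entry of [crs x].  The matrix [N]
   governs the bitangents. *)
Definition qf B N x : R :=
  ((sqm x)^T *m B *m sqm x + (sqm x)^T *m N *m crs x) 0 0.

(* The matrix of 2x2 permanents; in characteristic 2 these are the minors. *)
Definition cofp A : 'M[R]_3 := \matrix_(i, j)
  (A (nx i) (nx j) * A (nx (nx i)) (nx (nx j))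
   + A (nx i) (nx (nx j)) * A (nx (nx i)) (nx j)).

Definition dprod A : 'M[R]_3 := \matrix_(i, j) (A (nx i) j * A (nx (nx i)) j).

Lemma crs_mulmx A x : crs (A *m x) = dprod A *m sqm x + cofp A *m crs x.
Proof.
by apply: col3P; rewrite !mxE !sum3E !mxE /=; ring.
Qed.

Lemma qfE B N x : qf B N x =
  \sum_i \sum_j (B i j * (x i 0 ^+ 2 * x j 0 ^+ 2))
  + \sum_i \sum_j (N i j * (x i 0 ^+ 2 * (x (nx j) 0 * x (nx (nx j)) 0))).
Proof.
by rewrite /qf !mxE !sum3E !mxE !sum3E !mxE; ring.
Qed.

Hypothesis char2 : 2%N \in [pchar R].

Let add2 (z : R) : z + z = 0. Proof. exact: addrr_pchar2. Qed.

Lemma sqrD2 (a b : R) : (a + b) ^+ 2 = a ^+ 2 + b ^+ 2.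
Proof. by rewrite sqrrD mulr2n add2 addr0. Qed.

Lemma sqm_mulmx m n p (A : 'M[R]_(m, n)) (C : 'M_(n, p)) :
  sqm (A *m C) = sqm A *m sqm C.
Proof.
apply/matrixP=> i j; rewrite !mxE.
rewrite (big_morph (fun z => z ^+ 2) sqrD2 (expr0n _ _)).
by apply: eq_bigr => k _; rewrite !mxE exprMn.
Qed.

(** In characteristic 2 permanents are determinants, so this is the adjugate identity. *)
Lemma cofp_tr A : A^T *m cofp A = (\det A)%:M.
Proof.
(* An entry off the diagonal is the permanent of a matrix with column i repeated; a cyclic shift of
   the rows shows that its two halves are both [z i k]. *)
pose z i k := \sum_r A r i * (A (nx r) i * A (nx (nx r)) k).
have zz i k : z i k + z i k = 0 by [].
apply/matrixP; elim/ord3_ind; elim/ord3_ind;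
  rewrite mxE sum3E [RHS]mxE ?mulr1n ?mulr0n ?det3E ?(oppr_pchar2 char2) !mxE /=.
- ring.
- by rewrite -(zz o0 o2) /z !sum3E /=; ring.
- by rewrite -(zz o0 o1) /z !sum3E /=; ring.
- by rewrite -(zz o1 o2) /z !sum3E /=; ring.
- ring.
- by rewrite -(zz o1 o0) /z !sum3E /=; ring.
- by rewrite -(zz o2 o1) /z !sum3E /=; ring.
- by rewrite -(zz o2 o0) /z !sum3E /=; ring.
- ring.
Qed.

(** Squares of linear forms are linear in the squares, and products of two linear forms contribute
    squares through [dprod] and mixed products through [cofp]. The new [N] therefore depends on [N]
    and [A] alone. *)
Lemma qf_mulmx B N A x : qf B N (A *m x) =
  qf ((sqm A)^T *m (B *m sqm A + N *m dprod A)) ((sqm A)^T *m N *m cofp A) x.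
Proof.
rewrite /qf crs_mulmx sqm_mulmx !trmx_mul; congr (_ 0 0).
by rewrite !(mulmxDr, mulmxDl) !mulmxA addrA.
Qed.

Lemma qfZ B N c x : qf B N (c *: x) = c ^+ 4 * qf B N x.
Proof. by rewrite !qfE !sum3E !mxE; ring. Qed.

End Forms.

Definition mn (i j : nat) (hi : (i < 5)%N) (hj : (j < 5)%N) (h : (i + j <= 4)%N) : mon :=
  exist (fun m : 'I_5 * 'I_5 => (m.1 + m.2 <= 4)%N) (Ordinal hi, Ordinal hj) h.

Definition mons : seq mon :=
  [:: @mn 4 0 isT isT isT; @mn 0 4 isT isT isT; @mn 0 0 isT isT isT;
      @mn 2 2 isT isT isT; @mn 2 0 isT isT isT; @mn 0 2 isT isT isT;
      @mn 2 1 isT isT isT; @mn 3 0 isT isT isT; @mn 3 1 isT isT isT;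
      @mn 0 3 isT isT isT; @mn 1 2 isT isT isT; @mn 1 3 isT isT isT;
      @mn 0 1 isT isT isT; @mn 1 0 isT isT isT; @mn 1 1 isT isT isT].

Lemma mem_mons m : m \in mons.
Proof.
case: m => [[[i hi] [j hj]] h]; rewrite /mons !inE -!val_eqE /= !xpair_eqE -!val_eqE /=.
by move: i j hi hj h => [|[|[|[|[|//]]]]] [|[|[|[|[|//]]]]].
Qed.

Lemma sum_mons (V : nmodType) (G : mon -> V) :
  \sum_(m : mon) G m = \sum_(m <- mons) G m.
Proof.
apply: perm_big; apply: uniq_perm; first exact: index_enum_uniq.
  by [].
by move=> m; rewrite mem_mons mem_index_enum.
Qed.

(** [B] enters [qf] only through its diagonal and the sums B_ij + B_ji. This representative turns
    equality of forms into equality of matrices. *)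
Definition utri (R : comNzRingType) (B : 'M[R]_3) : 'M[R]_3 := \matrix_(i, j)
  if i == j then B i i else if (i < j)%N then B i j + B j i else 0.

Lemma qf_utri (R : comNzRingType) (B N : 'M[R]_3) x : qf (utri B) N x = qf B N x.
Proof. by rewrite !qfE !sum3E !mxE /=; ring. Qed.

Section QuarticMatrices.
Variable K : fieldType.

Definition Bm (f : quartic K) : 'M[K]_3 := \matrix_(i, j)
  nth 0 (nth [::] [:: [:: f (@mn 4 0 isT isT isT); f (@mn 2 2 isT isT isT); f (@mn 2 0 isT isT isT)];
                      [:: 0; f (@mn 0 4 isT isT isT); f (@mn 0 2 isT isT isT)];
                      [:: 0; 0; f (@mn 0 0 isT isT isT)]] i) j.

Definition Nm (f : quartic K) : 'M[K]_3 := \matrix_(i, j)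
  nth 0 (nth [::] [:: [:: f (@mn 2 1 isT isT isT); f (@mn 3 0 isT isT isT); f (@mn 3 1 isT isT isT)];
                      [:: f (@mn 0 3 isT isT isT); f (@mn 1 2 isT isT isT); f (@mn 1 3 isT isT isT)];
                      [:: f (@mn 0 1 isT isT isT); f (@mn 1 0 isT isT isT); f (@mn 1 1 isT isT isT)]] i) j.

Definition mkq (B N : 'M[K]_3) : quartic K := [ffun m : mon =>
  nth 0 (nth [::]
   [:: [:: B o2 o2; N o2 o0; B o1 o2 + B o2 o1; N o1 o0; B o1 o1];
       [:: N o2 o1; N o2 o2; N o1 o1; N o1 o2];
       [:: B o0 o2 + B o2 o0; N o0 o0; B o0 o1 + B o1 o0];
       [:: N o0 o1; N o0 o2];
       [:: B o0 o0]] (val m).1) (val m).2].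

Lemma Bm_mkq B N : Bm (mkq B N) = utri B.
Proof.
by apply/matrixP; elim/ord3_ind; elim/ord3_ind; rewrite !mxE /= ?ffunE.
Qed.

Lemma Nm_mkq B N : Nm (mkq B N) = N.
Proof.
by apply/matrixP; elim/ord3_ind; elim/ord3_ind; rewrite !mxE /= ?ffunE.
Qed.

Lemma quartic_eq (f g : quartic K) : Bm f = Bm g -> Nm f = Nm g -> f = g.
Proof.
move=> /matrixP eB /matrixP eN; apply/ffunP=> m.
have := eB o0 o0; have := eB o0 o1; have := eB o0 o2; have := eB o1 o1.
have := eB o1 o2; have := eB o2 o2; have := eN o0 o0; have := eN o0 o1.
have := eN o0 o2; have := eN o1 o0; have := eN o1 o1; have := eN o1 o2.
have := eN o2 o0; have := eN o2 o1; have := eN o2 o2; rewrite !mxE /=.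
move=> ? ? ? ? ? ? ? ? ? ? ? ? ? ? ?.
by have := mem_mons m; rewrite !inE; do ![case/orP]; move=> /eqP->.
Qed.

Definition Xv : 'cV[{mpoly K[3]}]_3 := \col_i 'X_i.

Definition Cm m n (A : 'M[K]_(m, n)) := map_mx (@mpolyC 3 K) A.

Lemma qpoly_qf (f : quartic K) : qpoly f = qf (Cm (Bm f)) (Cm (Nm f)) Xv.
Proof.
rewrite /qpoly sum_mons /mons !big_cons big_nil qfE !sum3E !mxE /=.
rewrite -!mul_mpolyC mpolyC0 /= !subn0.
rewrite (_ : 1 = o1) 1?(_ : 0 = o0) 1?(_ : 2%:R = o2); try exact: val_inj.
ring.
Qed.
End QuarticMatrices.

Section MapForms.
Variables (R S : comNzRingType) (phi : {rmorphism R -> S}).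

Lemma map_sqm m n (A : 'M[R]_(m, n)) : map_mx phi (sqm A) = sqm (map_mx phi A).
Proof. by apply/matrixP=> i j; rewrite !mxE rmorphXn. Qed.

Lemma map_crs x : map_mx phi (crs x) = crs (map_mx phi x).
Proof. by apply/matrixP=> i j; rewrite !mxE rmorphM. Qed.

Lemma map_cofp A : map_mx phi (cofp A) = cofp (map_mx phi A).
Proof. by apply/matrixP=> i j; rewrite !mxE rmorphD !rmorphM. Qed.

Lemma map_dprod A : map_mx phi (dprod A) = dprod (map_mx phi A).
Proof. by apply/matrixP=> i j; rewrite !mxE rmorphM. Qed.

Lemma qf_map B N x :
  phi (qf B N x) = qf (map_mx phi B) (map_mx phi N) (map_mx phi x).
Proof.
by rewrite /qf -map_crs -!map_sqm !map_trmx -!map_mxM -map_mxD [RHS]mxE.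
Qed.

Lemma qf_mulmx_map (char2 : 2%N \in [pchar S]) B N A x :
  qf (map_mx phi B) (map_mx phi N) (map_mx phi A *m x) =
  qf (map_mx phi ((sqm A)^T *m (B *m sqm A + N *m dprod A)))
     (map_mx phi ((sqm A)^T *m N *m cofp A)) x.
Proof.
by rewrite (qf_mulmx char2) !(map_mxM, map_mxD, map_trmx, map_sqm, map_cofp, map_dprod).
Qed.
End MapForms.

Lemma qL_qf (F L : fieldType) (iota : {rmorphism F -> L}) (f : quartic F) :
  qL iota f = qf (Cm (map_mx iota (Bm f))) (Cm (map_mx iota (Nm f))) (Xv L).
Proof.
rewrite /qL qpoly_qf qf_map -!map_mx_comp.
rewrite (_ : map_mx _ (Bm f) = Cm (map_mx iota (Bm f))); last first.
  by apply/matrixP=> i j; rewrite !mxE /= map_mpolyC.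
rewrite (_ : map_mx _ (Nm f) = Cm (map_mx iota (Nm f))); last first.
  by apply/matrixP=> i j; rewrite !mxE /= map_mpolyC.
rewrite (_ : map_mx _ (Xv F) = Xv L) //.
by apply/matrixP=> i j; rewrite !mxE /= map_mpolyX.
Qed.

Lemma meval_qf (L : fieldType) (B N : 'M[L]_3) (v : 'I_3 -> L) :
  (qf (Cm B) (Cm N) (Xv L)).@[v] = qf B N (\col_i v i).
Proof.
rewrite qf_map -!map_mx_comp.
rewrite (_ : map_mx _ B = B); last first.
  by apply/matrixP=> i j; rewrite !mxE /= mevalC.
rewrite (_ : map_mx _ N = N); last first.
  by apply/matrixP=> i j; rewrite !mxE /= mevalC.
rewrite (_ : map_mx _ (Xv L) = \col_i v i) //.
by apply/matrixP=> i j; rewrite !mxE /= mevalXU.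
Qed.

Lemma qL_eval (F L : fieldType) (iota : {rmorphism F -> L}) (f : quartic F) v :
  (qL iota f).@[v] = qf (map_mx iota (Bm f)) (map_mx iota (Nm f)) (\col_i v i).
Proof. by rewrite qL_qf meval_qf. Qed.

Lemma qpoly_mkq (K : fieldType) (B N : 'M[K]_3) :
  qpoly (mkq B N) = qf (Cm B) (Cm N) (Xv K).
Proof.
rewrite qpoly_qf Bm_mkq Nm_mkq -[RHS]qf_utri.
rewrite (_ : Cm (utri B) = utri (Cm B)) //.
by apply/matrixP; elim/ord3_ind; elim/ord3_ind; rewrite !mxE /= ?mpolyCD ?mpolyC0.
Qed.

Lemma qsubst_qf (F : fieldType) (char2 : 2%N \in [pchar F]) (A : 'M[F]_3) (f : quartic F) :
  qsubst A (qpoly f) =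
  qpoly (mkq ((sqm A)^T *m (Bm f *m sqm A + Nm f *m dprod A))
             ((sqm A)^T *m Nm f *m cofp A)).
Proof.
have c2 : 2%N \in [pchar {mpoly F[3]}] := rmorph_pchar (@mpolyC 3 F) char2.
rewrite qpoly_mkq qpoly_qf /qsubst qf_map -!map_mx_comp.
have -> : map_mx (comp_mpoly [tuple \sum_(j < 3) A i j *: 'X_j | i < 3]) (Xv F)
          = Cm A *m Xv F.
  apply/matrixP=> i j; rewrite !mxE comp_mpolyXU -tnth_nth tnth_mktuple.
  by apply: eq_bigr => k _; rewrite !mxE mul_mpolyC.
rewrite (_ : map_mx _ (Bm f) = Cm (Bm f)); last first.
  by apply/matrixP=> i j; rewrite !mxE /= comp_mpolyC.
rewrite (_ : map_mx _ (Nm f) = Cm (Nm f)); last first.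
  by apply/matrixP=> i j; rewrite !mxE /= comp_mpolyC.
exact: (@qf_mulmx_map F _ (@mpolyC 3 F) c2).
Qed.

(** * Forms are determined by their values over an algebraically closed field *)

Lemma closed_poly_eq0 (L : closedFieldType) (p : {poly L}) :
  (forall a, p.[a] = 0) -> p = 0.
Proof.
move=> p0; apply/eqP; apply: contraT => /closed_nonrootP[x].
by rewrite /root p0 eqxx.
Qed.

Lemma quartic_poly_eq0 (L : closedFieldType) (c0 c1 c2 c3 c4 : L) :
  (forall a, c0 + c1 * a + c2 * a ^+ 2 + c3 * a ^+ 3 + c4 * a ^+ 4 = 0) ->
  [/\ c0 = 0, c1 = 0, c2 = 0, c3 = 0 & c4 = 0].
Proof.
move=> c_eq0; pose p := Poly [:: c0; c1; c2; c3; c4].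
have p0 : p = 0.
  by apply: closed_poly_eq0 => a; rewrite horner_Poly -(c_eq0 a) /horner_rec; ring.
have pE i : nth 0 [:: c0; c1; c2; c3; c4] i = 0 by rewrite -coef_Poly -/p p0 coef0.
by split; [have := pE 0%N | have := pE 1%N | have := pE 2%N | have := pE 3%N | have := pE 4%N].
Qed.

Definition vec3 (R : Type) (x y z : R) : 'cV[R]_3 :=
  \col_i nth x [:: x; y; z] i.

Section Uniqueness.
Variable L : closedFieldType.
Implicit Types B N : 'M[L]_3.

Lemma qf_eq0 B N : (forall x, qf B N x = 0) ->
  N = 0 /\ (forall i j, i != j -> B i j + B j i = 0) /\ (forall i, B i i = 0).
Proof.
move=> q0.
have [] := @quartic_poly_eq0 L (B o1 o1) (N o1 o2) (B o0 o1 + B o1 o0) (N o0 o2) (B o0 o0).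
  by move=> a; rewrite -(q0 (vec3 a 1 0)) qfE !sum3E !mxE /=; ring.
move=> B11 N12 B01 N02 B00.
have [] := @quartic_poly_eq0 L (B o2 o2) (N o2 o1) (B o0 o2 + B o2 o0) (N o0 o1) (B o0 o0).
  by move=> a; rewrite -(q0 (vec3 a 0 1)) qfE !sum3E !mxE /=; ring.
move=> B22 N21 B02 N01 _.
have [] := @quartic_poly_eq0 L (B o2 o2) (N o2 o0) (B o1 o2 + B o2 o1) (N o1 o0) (B o1 o1).
  by move=> a; rewrite -(q0 (vec3 0 a 1)) qfE !sum3E !mxE /=; ring.
move=> _ N20 B12 N10 _.
(* The three coordinate lines have killed every monomial except x^2yz, xy^2z and xyz^2; these are
   detected on the lines (1, 1, a) and (1, a, 1). *)
have qN x y z : x * y * z * (N o0 o0 * x + N o1 o1 * y + N o2 o2 * z) = 0.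
  rewrite -(q0 (vec3 x y z)) qfE !sum3E !mxE /=.
  rewrite B00 B11 B22 N12 N02 N21 N01 N20 N10.
  transitivity (x * y * z * (N o0 o0 * x + N o1 o1 * y + N o2 o2 * z)
    + (B o0 o1 + B o1 o0) * (x ^+ 2 * y ^+ 2) + (B o0 o2 + B o2 o0) * (x ^+ 2 * z ^+ 2)
    + (B o1 o2 + B o2 o1) * (y ^+ 2 * z ^+ 2)).
    by rewrite B01 B02 B12; ring.
  ring.
have [] := @quartic_poly_eq0 L 0 (N o0 o0 + N o1 o1) (N o2 o2) 0 0.
  by move=> a; rewrite -[RHS](qN 1 1 a); ring.
move=> _ _ N22 _ _.
have [] := @quartic_poly_eq0 L 0 (N o0 o0 + N o2 o2) (N o1 o1) 0 0.
  by move=> a; rewrite -[RHS](qN 1 a 1); ring.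
move=> _ N0022 N11 _ _.
have N00 : N o0 o0 = 0 by rewrite N22 addr0 in N0022.
split; first by apply/matrixP; elim/ord3_ind; elim/ord3_ind; rewrite mxE.
split; last by elim/ord3_ind.
by elim/ord3_ind; elim/ord3_ind => //= _; rewrite 1?addrC.
Qed.

Lemma qf_inj B N B' N' : (forall x, qf B N x = qf B' N' x) ->
  N = N' /\ utri B = utri B'.
Proof.
move=> qq; have [|N0 [Bo Bd]] := @qf_eq0 (B - B') (N - N').
  move=> x; apply/eqP; rewrite (_ : qf _ _ _ = qf B N x - qf B' N' x).
    by rewrite qq subrr.
  by rewrite !qfE !sum3E !mxE; ring.
split; first by apply/eqP; rewrite -subr_eq0 N0.
apply/matrixP=> i j; rewrite !mxE; case: eqVneq => [_|ij].
  by apply/eqP; rewrite -subr_eq0; have := Bd i; rewrite !mxE => ->.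
case: ifP => // _; apply/eqP; rewrite -subr_eq0.
by have := Bo _ _ ij; rewrite !mxE addrACA -opprD => ->.
Qed.
End Uniqueness.

Section QuarticFunctions.
Variables (F : fieldType) (L : closedFieldType) (iota : {rmorphism F -> L}).
Hypothesis char2 : 2%N \in [pchar F].
Implicit Types f g : quartic F.

Definition qev f (x : 'cV[L]_3) : L := qf (map_mx iota (Bm f)) (map_mx iota (Nm f)) x.

Lemma qevE f x : qev f x = qf (map_mx iota (Bm f)) (map_mx iota (Nm f)) x.
Proof. by []. Qed.

Let char2L : 2%N \in [pchar L] := rmorph_pchar iota char2.

Lemma map_utri (B : 'M[F]_3) : map_mx iota (utri B) = utri (map_mx iota B).
Proof.
by apply/matrixP=> i j; rewrite !mxE; do ![case: ifP => _]; rewrite ?rmorphD ?rmorph0.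
Qed.

Lemma qev_mkq B N x : qev (mkq B N) x = qf (map_mx iota B) (map_mx iota N) x.
Proof. by rewrite /qev Bm_mkq Nm_mkq map_utri qf_utri. Qed.

Lemma utri_Bm f : utri (Bm f) = Bm f.
Proof.
by apply/matrixP; elim/ord3_ind; elim/ord3_ind; rewrite !mxE /= ?addr0.
Qed.

Lemma qev_inj f g : (forall x, qev f x = qev g x) -> f = g.
Proof.
move=> /qf_inj[eN]; rewrite -!map_utri !utri_Bm => eB.
by apply: quartic_eq; apply: (map_mx_inj (f := iota)).
Qed.

Definition isoF f g := exists (A : 'M[F]_3) (l : F), [/\ A \in unitmx, l != 0 &
  forall x, qev g x = iota l * qev f (map_mx iota A *m x)].

Lemma qsubst_quartic f (A : 'M[F]_3) l : exists g, l *: qsubst A (qpoly f) = qpoly g /\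
  forall x, qev g x = iota l * qev f (map_mx iota A *m x).
Proof.
have qevZ c B N x : iota c * qf (map_mx iota B) (map_mx iota N) x =
    qf (map_mx iota (c *: B)) (map_mx iota (c *: N)) x.
  by rewrite !qfE !sum3E !mxE !rmorphM; ring.
rewrite qsubst_qf //; set B' := _ *m _; set N' := (X in mkq _ X).
exists (mkq (l *: B') (l *: N')); split.
  rewrite !qpoly_mkq /Cm !qfE !sum3E !mxE -!mul_mpolyC !mpolyCM; ring.
by move=> x; rewrite qev_mkq -qevZ /qev (qf_mulmx_map iota char2L).
Qed.

Lemma iso_isoF f g : iso f g <-> isoF f g.
Proof.
have qpoly_inj g1 g2 : qpoly g1 = qpoly g2 -> g1 = g2.
  move=> e; apply: qev_inj => x.
  have := congr1 (fun p => (map_mpoly iota p).@[fun i => x i 0]) e.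
  rewrite -![map_mpoly _ _]/(qL _ _) !qL_eval /qev.
  by rewrite (_ : \col_i _ = x) //; apply/matrixP=> i j; rewrite mxE (ord1 j).
split=> [[A [l [uA [l0 e]]]] | [A [l [uA l0 e]]]]; have [g' [eg' evg']] := qsubst_quartic f A l.
  by exists A, l; split=> // x; rewrite -evg'; congr qev; apply: qpoly_inj; rewrite e.
exists A, l; split=> //; split=> //; rewrite eg'; congr qpoly.
by apply: qev_inj => x; rewrite e evg'.
Qed.

Lemma isoF_sym f g : isoF f g -> isoF g f.
Proof.
move=> [A [l [uA l0 e]]]; exists (invmx A), l^-1.
split; rewrite ?unitmx_inv ?invr_eq0 //.
by move=> x; rewrite e mulmxA -map_mxM mulmxV // map_mx1 mul1mx mulrA -rmorphM mulVf // rmorph1 mul1r.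
Qed.

Lemma isoF_trans f g h : isoF f g -> isoF g h -> isoF f h.
Proof.
move=> [A [l [uA l0 e]]] [A' [l' [uA' l0' e']]]; exists (A *m A'), (l' * l).
split; rewrite ?unitmx_mul ?uA ?mulf_neq0 //.
by move=> x; rewrite e' e map_mxM mulmxA rmorphM mulrA.
Qed.

End QuarticFunctions.

(** * Bitangents *)

(** The cross product, with signs dropped in view of characteristic 2. *)
Definition crossp (R : comNzRingType) (w x : 'cV[R]_3) : 'cV[R]_3 :=
  \col_i (w (nx i) 0 * x (nx (nx i)) 0 + w (nx (nx i)) 0 * x (nx i) 0).

Lemma sqm_tr (R : comNzRingType) m n (A : 'M[R]_(m, n)) : (sqm A)^T = sqm A^T.
Proof. exact: map_trmx. Qed.

Section CrsLine.
Variable R : comNzRingType.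
Hypothesis char2 : 2%N \in [pchar R].

(** Eliminating x_i through v^T x, with w = 1/v_i, turns x_i x_k into a multiple of the product of
    the other two coordinates plus the square term w v_k x_k^2; this matrix collects the square
    terms. *)
Definition lineS (v : 'cV[R]_3) (i : 'I_3) (w : R) : 'M[R]_3 := \matrix_(k, j)
  if (k == nx i) && (j == nx (nx i)) || (k == nx (nx i)) && (j == nx i)
  then w * v j 0 else 0.

(* On the line [v^T x = 0] the three products in [crs x] become proportional
   to [v], up to squares; the pivot [i] is a coordinate with [v_i] invertible. *)
Lemma crs_line (v x : 'cV[R]_3) (i : 'I_3) (w : R) : w * v i 0 = 1 ->
  crs x = (w * (x (nx i) 0 * x (nx (nx i)) 0)) *: v
        + ((v^T *m x) 0 0 * w) *: (\col_k if k == nx i then x (nx (nx i)) 0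
                                    else if k == nx (nx i) then x (nx i) 0 else 0)
        + lineS v i w
          *m sqm x.
Proof.
have add2 (z : R) : z + z = 0 by exact: addrr_pchar2.
move=> wv.
(* [ring] does not know that 2 = 0, so the doubled terms that make both sides agree are inserted by
   hand. The same device recurs in later computations. *)
have lem (a b c p : R) : w * c = 1 -> p = w * c * p + (a + a) + (b + b).
  by move=> e; rewrite e !add2 mul1r !addr0.
move: wv; elim/ord3_ind: i => wv; apply: col3P; rewrite !mxE !sum3E !mxE /=.
- by rewrite [LHS](lem 0 0 _ _ wv); ring.
- rewrite [LHS](lem (w * (x o1 0 * x o2 0) * v o1 0) (w * v o2 0 * x o2 0 ^+ 2) _ _ wv); ring.
- rewrite [LHS](lem (w * (x o2 0 * x o1 0) * v o2 0) (w * v o1 0 * x o1 0 ^+ 2) _ _ wv); ring.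
- rewrite [LHS](lem (w * (x o0 0 * x o2 0) * v o0 0) (w * v o2 0 * x o2 0 ^+ 2) _ _ wv); ring.
- by rewrite [LHS](lem 0 0 _ _ wv); ring.
- rewrite [LHS](lem (w * (x o2 0 * x o0 0) * v o2 0) (w * v o0 0 * x o0 0 ^+ 2) _ _ wv); ring.
- rewrite [LHS](lem (w * (x o0 0 * x o1 0) * v o0 0) (w * v o1 0 * x o1 0 ^+ 2) _ _ wv); ring.
- rewrite [LHS](lem (w * (x o1 0 * x o0 0) * v o1 0) (w * v o0 0 * x o0 0 ^+ 2) _ _ wv); ring.
- by rewrite [LHS](lem 0 0 _ _ wv); ring.
Qed.

(** Modulo v^T x, [crs x] is a multiple of v plus square terms. [N] sends v to a multiple of v^(2),
    whose pairing with x^(2) is (v^T x)^2, so that only a quadratic form in the squares survives on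
    the line. *)
Lemma qf_line (B N : 'M[R]_3) (v x : 'cV[R]_3) (i : 'I_3) (w lam : R) :
  w * v i 0 = 1 -> N *m v = lam *: sqm v ->
  exists h : R, qf B N x =
    ((sqm x)^T *m (B + N *m lineS v i w) *m sqm x) 0 0 + (v^T *m x) 0 0 * h.
Proof.
move=> wv Nv; rewrite /qf (crs_line x wv).
set e := \col_k _; set S := lineS v i w; set m0 := w * _.
exists (m0 * lam * (v^T *m x) 0 0 + w * ((sqm x)^T *m N *m e) 0 0).
rewrite 2!mulmxDr -!scalemxAr -[_ *m N *m v]mulmxA Nv -scalemxAr.
have -> : (sqm x)^T *m sqm v = (((v^T *m x) 0 0) ^+ 2)%:M.
  rewrite sqm_tr -sqm_mulmx // -[v]trmxK -trmx_mul trmxK.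
  by apply/matrixP=> a b; rewrite (ord1 a) (ord1 b) !mxE eqxx mulr1n.
rewrite mulmxDr mulmxDl !mulmxA.
set T1 := _ *m e; set T2 := _ *m S *m _; set T3 := _ *m B *m _.
set l := (_ *m x) 0 0.
by rewrite !mxE eqxx mulr1n; ring.
Qed.
End CrsLine.

Section Bitangent.
Variable L : closedFieldType.
Hypothesis char2 : 2%N \in [pchar L].
Implicit Types (B N : 'M[L]_3) (v : 'I_3 -> L).

Let add2 (z : L) : z + z = 0. Proof. exact: addrr_pchar2. Qed.

Lemma mderiv_sqr i (p : {mpoly L[3]}) : mderiv i (p ^+ 2) = 0.
Proof.
have char2P : 2%N \in [pchar {mpoly L[3]}] := rmorph_pchar (@mpolyC 3 L) char2.
by rewrite expr2 mderivM mulrC addrr_pchar2.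
Qed.

Lemma mderiv_var i j : mderiv i ('X_j : {mpoly L[3]}) = ((i == j)%:R)%:MP.
Proof.
rewrite mderivX mnm1E eq_sym; case: eqVneq => [->|_]; last by rewrite scale0r mpolyC0.
rewrite scale1r (_ : (U_(j) - U_(j))%MM = 0%MM) ?mpolyX0 ?mpolyC1 //.
by apply/mnmP=> k; rewrite mnmBE mnm0E subnn.
Qed.

(** Squares have zero derivative, so x^(2) behaves as a constant, and the gradient of the pairing of
    a constant w with [crs x] is w cross x. *)
Lemma mderiv_qf B N v k :
  (mderiv k (qf (Cm B) (Cm N) (Xv L))).@[v] =
  crossp (N^T *m sqm (\col_j v j)) (\col_j v j) k 0.
Proof.
have d1 i c (p : {mpoly L[3]}) :
    mderiv k (c%:MP * ('X_i ^+ 2 * p)) = c%:MP * ('X_i ^+ 2 * mderiv k p).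
  by rewrite mderiv_mulC mderivM mderiv_sqr mul0r add0r.
have dv i j : (mderiv k ('X_i * 'X_j : {mpoly L[3]})).@[v] =
    (k == i)%:R * v j + v i * (k == j)%:R.
  by rewrite mderivM !mderiv_var mevalD !mevalM !mevalC !mevalXU.
have -> : qf (Cm B) (Cm N) (Xv L) =
    (\sum_i \sum_j (B i j)%:MP * ('X_i ^+ 2 * 'X_j ^+ 2))
    + \sum_i \sum_j (N i j)%:MP * ('X_i ^+ 2 * ('X_(nx j) * 'X_(nx (nx j)))).
  rewrite qfE; congr (_ + _); apply: eq_bigr => i _; apply: eq_bigr => j _;
  by rewrite !mxE.
rewrite mderivD mevalD [X in X.@[_] + _](_ : _ = 0) ?meval0 ?add0r; last first.
  rewrite (raddf_sum (mderiv k)) big1 // => i _; rewrite (raddf_sum (mderiv k)) big1 // => j _.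
  by rewrite /= d1 mderiv_sqr !mulr0.
rewrite (raddf_sum (mderiv k)) (raddf_sum (meval v)) (eq_bigr (fun i => \sum_j N i j * (v i ^+ 2 *
    ((k == nx j)%:R * v (nx (nx j)) + v (nx j) * (k == nx (nx j))%:R)))); last first.
  move=> i _; rewrite (raddf_sum (mderiv k)) (raddf_sum (meval v)); apply: eq_bigr => j _.
  by rewrite /= d1 !mevalM mevalC dv !mevalXU expr2.
by rewrite !sum3E !mxE !sum3E !mxE; move: {d1 dv} k; elim/ord3_ind => /=; ring.
Qed.

(** Pairing w cross x = h v with w gives h (w^T v) = 0. If w^T v were nonzero then h = 0, so w is
    parallel to x, and v^T x = 0 gives a contradiction. *)
Lemma crossp_parallel (w x v : 'cV[L]_3) (h : L) : x != 0 ->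
  (v^T *m x) 0 0 = 0 -> crossp w x = h *: v -> (w^T *m v) 0 0 = 0.
Proof.
move=> x0 vx wx; apply/eqP; apply: contraT => wv0.
have ee i := congr1 (fun m : 'cV[L]_3 => m i 0) wx.
move: (ee o0) (ee o1) (ee o2); rewrite !mxE /= => e0 e1 e2.
have h0 : h = 0.
  apply/eqP; rewrite -(mulIr_eq0 h (mulIf wv0)) !mxE !sum3E !mxE !mulrDr ![h * (_ * _)]mulrCA -e0 -e1 -e2.
  rewrite -[X in _ == X](add2 (w o0 0 * w o1 0 * x o2 0 + w o0 0 * w o2 0 * x o1 0 + w o1 0 * w o2 0 * x o0 0)).
  by apply/eqP; ring.
move: e0 e1 e2; rewrite h0 !mul0r => e0 e1 e2.
have mv (a b : L) : a + b = 0 -> a = b by move/eqP; rewrite addr_eq0 oppr_pchar2 // => /eqP.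
have wx_sym i j : x i 0 * w j 0 = w i 0 * x j 0.
  move: (mv _ _ e0) (mv _ _ e1) (mv _ _ e2) => {e0 e1 e2}.
  by elim/ord3_ind: i; elim/ord3_ind: j => e0 e1 e2; rewrite mulrC // ?e0 ?e1 ?e2 1?mulrC.
case/eqP: x0; apply/matrixP=> i j; rewrite (ord1 j) [RHS]mxE; apply/eqP.
rewrite -(mulIr_eq0 _ (mulIf wv0)) mxE big_distrr /=.
rewrite (eq_bigr (fun j => w i 0 * (v^T 0 j * x j 0))); last first.
  by move=> k _; rewrite !mxE; transitivity (x i 0 * w k 0 * v k 0); [ring | rewrite wx_sym; ring].
by rewrite -big_distrr /=; move: vx; rewrite mxE => ->; rewrite mulr0.
Qed.

End Bitangent.

Section BitangentP.
Variables (F : fieldType) (L : closedFieldType) (iota : {rmorphism F -> L}).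
Hypothesis char2 : 2%N \in [pchar L].
Implicit Types (f : quartic F) (v : 'I_3 -> L).

Let add2 (z : L) : z + z = 0. Proof. exact: addrr_pchar2. Qed.
Let char2P : 2%N \in [pchar {mpoly L[3]}] := rmorph_pchar (@mpolyC 3 L) char2.

Lemma mderiv_linform i v : mderiv i (linform v) = (v i)%:MP.
Proof.
rewrite /linform (raddf_sum (mderiv i)) (bigD1 i) //= big1 => [|j ji].
  by rewrite mderivZ mderiv_var eqxx addr0 mpolyC1 -mul_mpolyC mulr1.
by rewrite mderivZ mderiv_var eq_sym (negbTE ji) mpolyC0 scaler0.
Qed.

Lemma meval_linform v (x : 'cV[L]_3) :
  (linform v).@[fun i => x i 0] = ((\col_i v i)^T *m x) 0 0.
Proof.
rewrite /linform (raddf_sum (meval _)) mxE; apply: eq_bigr => i _.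
by rewrite /= mevalZ mevalXU !mxE.
Qed.

Lemma sqr_quadratic_form (D : 'M[L]_3) : exists2 g : {mpoly L[3]},
  g \is 2.-homog & g ^+ 2 = ((sqm (Xv L))^T *m Cm D *m sqm (Xv L)) 0 0.
Proof.
have sq (ij : 'I_3 * 'I_3) : exists b, b ^+ 2 = D ij.1 ij.2.
  have [b] := @solve_monicpoly L 2 (fun i => if i == 0%N then D ij.1 ij.2 else 0) isT.
  by rewrite !big_ord_recl big_ord0 /= expr0 mulr1 mul0r !addr0 => e; exists b.
have [r rD] := fin_all_exists sq.
exists (\sum_i \sum_j (r (i, j))%:MP * ('X_i * 'X_j)).
  apply: rpred_sum => i _; apply: rpred_sum => j _; rewrite mul_mpolyC.
  have homX k : ('X_k : {mpoly L[3]}) \is 1.-homog by rewrite dhomogX /= mdeg1.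
  by apply: rpredZ; exact: (dhomogM (homX i) (homX j)).
have sqs (a : 'I_3 -> {mpoly L[3]}) : (\sum_i a i) ^+ 2 = \sum_i a i ^+ 2.
  by rewrite (big_morph (fun z => z ^+ 2) (sqrD2 char2P) (expr0n _ _)).
rewrite sqs mxE [RHS](eq_bigr (fun j => \sum_i (D i j)%:MP * ('X_i * 'X_j) ^+ 2)); last first.
  move=> j _; rewrite mxE big_distrl /=; apply: eq_bigr => i _.
  by rewrite !mxE exprMn; ring.
rewrite exchange_big /=; apply: eq_bigr => i _; rewrite sqs; apply: eq_bigr => j _.
by rewrite exprMn -rmorphXn rD.
Qed.

(** If f = g^2 + l h, the gradient of f at a point x of the line l is h(x) v, and [crossp_parallel]
    gives (x^(2))^T N v = 0. Taking for x the points v cross e_k of the line forces N v to be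
    proportional to v^(2). Conversely [qf_line] leaves a quadratic form in the squares, which is a
    square because L has square roots. *)
Lemma bitangentP f v : bitangent iota f v <-> nonzero3 v /\
  exists lam, map_mx iota (Nm f) *m (\col_i v i) = lam *: sqm (\col_i v i).
Proof.
set B := map_mx iota (Bm f); set N := map_mx iota (Nm f); set V := \col_i v i.
split=> [[v0 [g [h [_ ef]]]] | [v0 [lam NV]]]; split=> //.
  have dual k : (((sqm (crossp V (delta_mx k 0)))^T *m N) *m V) 0 0 = 0.
    set x := crossp V _.
    have Vx : (V^T *m x) 0 0 = 0.
      rewrite /x mxE sum3E !mxE /= !andbT.
      rewrite -[RHS](add2 (v o0 * v o1 * (o2 == k)%:R + v o0 * v o2 * (o1 == k)%:R
        + v o1 * v o2 * (o0 == k)%:R)); ring.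
    have [->|x0] := eqVneq x 0.
      rewrite (_ : sqm 0 = 0) ?trmx0 ?mul0mx ?mxE //.
      by apply/matrixP=> a b; rewrite !mxE expr0n.
    rewrite (_ : (sqm x)^T *m N = (N^T *m sqm x)^T); last by rewrite trmx_mul trmxK.
    apply: (crossp_parallel char2 x0 Vx (h := h.@[fun i => x i 0])).
    apply/matrixP=> i j; rewrite (ord1 j) {j}.
    have := mderiv_qf char2 B N (fun i => x i 0) i.
    rewrite (_ : \col_j x j 0 = x) => [<-|]; last by apply/matrixP=> a b; rewrite mxE (ord1 b).
    rewrite -qL_qf ef mderivD mderiv_sqr // add0r mderivM mderiv_linform.
    by rewrite mevalD !mevalM mevalC meval_linform -/V Vx mul0r addr0 !mxE mulrC.
  have [i vi] := v0; exists ((N *m V) i 0 / v i ^+ 2).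
  have mv (a b : L) : a + b = 0 -> a = b by move/eqP; rewrite addr_eq0 oppr_pchar2 // => /eqP.
  have pr a b : (N *m V) a 0 * v b ^+ 2 = (N *m V) b 0 * v a ^+ 2.
    have := dual o0; have := dual o1; have := dual o2.
    rewrite -![_ *m N *m V]mulmxA ![((sqm _)^T *m _) _ _]mxE !sum3E.
    move: (N *m V) => NV; rewrite !mxE /=.
    rewrite !(mulr0, mulr1, add0r, addr0, expr0n, mul0r) /=.
    change (nx (nx o1)) with o0; change (nx (nx o0)) with o2; change (nx o0) with o1.
    move=> /mv e2 /mv e1 /mv e0.
    by elim/ord3_ind: a; elim/ord3_ind: b => //; rewrite ![NV _ 0 * _]mulrC ?e0 ?e1 ?e2.
  apply/matrixP=> a b; rewrite (ord1 b) [RHS]mxE [sqm V _ _]mxE [V a _]mxE.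
  by rewrite mulrAC pr mulfK // expf_neq0.
have [i vi] := v0.
have NV' : Cm N *m Cm V = lam%:MP *: sqm (Cm V).
  rewrite /Cm -map_mxM NV; apply/matrixP=> a b; rewrite !mxE /=.
  by rewrite mpolyCM rmorphXn.
have wv : ((v i)^-1)%:MP * Cm V i 0 = 1 :> {mpoly L[3]}.
  by rewrite !mxE -mpolyCM mulVf.
have [h eq_f] := qf_line char2P (Cm B) (Xv L) wv NV'.
have [g g2 eq_g] := sqr_quadratic_form (B + N *m lineS V i (v i)^-1).
have eD : Cm (B + N *m lineS V i (v i)^-1) = Cm B + Cm N *m lineS (Cm V) i ((v i)^-1)%:MP.
  rewrite /Cm map_mxD map_mxM (_ : map_mx _ (lineS _ _ _) = lineS (Cm V) i ((v i)^-1)%:MP) //.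
  apply/matrixP=> a b; rewrite !mxE; case: ifP => _.
    exact: mpolyCM.
  exact: mpolyC0.
have el : linform v = ((Cm V)^T *m Xv L) 0 0.
  by rewrite mxE; apply: eq_bigr => j _; rewrite !mxE mul_mpolyC.
exists g, h; split; first exact: g2.
by rewrite qL_qf eq_f eq_g eD el.
Qed.
End BitangentP.

(** * Lang's theorem for GL_3 *)

Definition frobm (R : nzRingType) (n : nat) p q (A : 'M[R]_(p, q)) : 'M[R]_(p, q) :=
  map_mx (fun z => z ^+ n) A.

Lemma frobm1 (R : nzRingType) p q (A : 'M[R]_(p, q)) : frobm 1 A = A.
Proof. by apply/matrixP=> i j; rewrite mxE expr1. Qed.

Lemma frobm_comp (R : nzRingType) (m n : nat) p q (A : 'M[R]_(p, q)) :
  frobm m (frobm n A) = frobm (n * m) A.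
Proof. by apply/matrixP=> i j; rewrite !mxE exprM. Qed.

Lemma frobm_map (R S : nzRingType) (phi : {rmorphism R -> S}) n p q (A : 'M[R]_(p, q)) :
  map_mx phi (frobm n A) = frobm n (map_mx phi A).
Proof. by apply/matrixP=> i j; rewrite !mxE rmorphXn. Qed.

Section Frobenius.
Variables (R : comNzRingType) (n : nat).
Hypothesis charn : [pchar R].-nat n.

Let n_gt0 : (0 < n)%N. Proof. by case/andP: charn. Qed.

Lemma expr_sum_pchar (I : Type) (r : seq I) (P : pred I) (a : I -> R) :
  (\sum_(i <- r | P i) a i) ^+ n = \sum_(i <- r | P i) a i ^+ n.
Proof.
apply: (big_morph (fun z => z ^+ n)) => [x y|]; first exact: exprDn_pchar.
by rewrite expr0n gtn_eqF.
Qed.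

Lemma frobm_mulmx p q s (A : 'M[R]_(p, q)) (B : 'M_(q, s)) :
  frobm n (A *m B) = frobm n A *m frobm n B.
Proof.
apply/matrixP=> i j; rewrite !mxE expr_sum_pchar.
by apply: eq_bigr => k _; rewrite !mxE exprMn.
Qed.

Lemma frobm_scalar p (c : R) : frobm n (c%:M : 'M[R]_p) = (c ^+ n)%:M.
Proof.
apply/matrixP=> i j; rewrite !mxE; case: eqVneq => _ //=.
by rewrite !mulr0n expr0n gtn_eqF.
Qed.
End Frobenius.

Lemma frobm_unit (R : fieldType) n p (A : 'M[R]_p) : [pchar R].-nat n ->
  A \in unitmx -> frobm n A \in unitmx.
Proof.
move=> cn uA; have: frobm n (A *m invmx A) = 1%:M.
  by rewrite mulmxV // frobm_scalar // expr1n.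
by rewrite frobm_mulmx // => /mulmx1_unit[].
Qed.

Lemma frobm_invmx (R : fieldType) n p (A : 'M[R]_p) : [pchar R].-nat n ->
  A \in unitmx -> frobm n (invmx A) = invmx (frobm n A).
Proof.
move=> cn uA; have uF := frobm_unit cn uA.
by rewrite -[LHS]mul1mx -(mulVmx uF) -mulmxA -frobm_mulmx // mulmxV // frobm_scalar // expr1n mulmx1.
Qed.

Lemma expr_inj (R : fieldType) n : [pchar R].-nat n -> injective (fun x : R => x ^+ n).
Proof.
move=> cn x y /= /eqP; rewrite -subr_eq0.
have n0 : (0 < n)%N by case/andP: cn.
have eN : (x - y) ^+ n = x ^+ n - y ^+ n.
  by apply/eqP; rewrite eq_sym subr_eq -exprDn_pchar // subrK.
by rewrite -eN expf_eq0 n0 subr_eq0 => /eqP.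
Qed.

Lemma frobm_inj (R : fieldType) n p q : [pchar R].-nat n ->
  injective (@frobm R n p q).
Proof.
move=> cn A B /matrixP eAB; apply/matrixP=> i j.
by have := eAB i j; rewrite !mxE => /(expr_inj cn).
Qed.

Lemma separable_roots (L : closedFieldType) (p : {poly L}) :
  separable_poly p -> exists r : seq L,
  [/\ uniq r, size r = (size p).-1 & forall x, (x \in r) = root p x].
Proof.
move=> sp; have [r pE] := closed_field_poly_normal p; exists r.
have p0 : p != 0.
  exact: separable_poly_neq0.
have c0 : lead_coef p != 0 by rewrite lead_coef_eq0.
split.
- rewrite -separable_prod_XsubC; move: sp; rewrite pE unlock derivZ.
  by rewrite coprimepZl // coprimepZr.
- by rewrite pE size_scale // size_prod_XsubC.
- by move=> x; rewrite pE rootZ // root_prod_XsubC.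
Qed.

Lemma derivXn_pchar (R : nzRingType) n : [pchar R].-nat n -> (1 < n)%N ->
  ('X^n : {poly R})^`() = 0.
Proof.
move=> /andP[n0 /allP pn] n1; rewrite derivXn.
have /pn pch : pdiv n \in primes n by rewrite mem_primes pdiv_prime // n0 pdiv_dvd.
have := pdiv_dvd n => /dvdnP[m {2}->]; rewrite mulrnA -mulr_natr.
have -> : (pdiv n)%:R = 0 :> {poly R} by rewrite -polyC_natr (pcharf0 pch).
by rewrite mulr0.
Qed.

Section Lang.
Variables (F : finFieldType) (L : closedFieldType) (iota : {rmorphism F -> L}).
Variable (Q : nat).
Hypotheses (charQ : [pchar F].-nat Q) (Q_gt1 : (1 < Q)%N).

Let charL : [pchar L].-nat Q.
Proof. by rewrite (eq_pnat _ (fmorph_pchar iota)). Qed.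

Let charLi i : [pchar L].-nat (Q ^ i)%N. Proof. by rewrite pnatX charL. Qed.

(** The subfield of L with Q^n elements, as a list: the derivative of X^(Q^n) - X is -1, so its
    roots are simple. *)
Lemma fixed_field_roots n : (0 < n)%N -> exists r : seq L,
  [/\ uniq r, size r = (Q ^ n)%N & forall x, (x \in r) = (x ^+ (Q ^ n) == x)].
Proof.
move=> n0; have Qn1 : (1 < Q ^ n)%N by rewrite -(exp1n n) ltn_exp2r.
have sz : size ('X^(Q ^ n) - 'X : {poly L}) = (Q ^ n).+1.
  by rewrite size_polyDl ?size_polyXn // size_polyN size_polyX.
have [|r [ur sr mr]] := @separable_roots L ('X^(Q ^ n) - 'X).
  rewrite unlock derivB derivX (derivXn_pchar (charLi n) Qn1) sub0r.
  by rewrite -[X in coprimep _ X]scaleN1r coprimepZr ?coprimep1 ?oppr_eq0 ?oner_eq0.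
exists r; split; rewrite ?sr ?sz // => x.
by rewrite mr /root !hornerE subr_eq0.
Qed.

(* Averaging over the semilinear map [X |-> M^-1 X^(Q)], which has finite
   order on matrices over [F]; independence of the powers of Frobenius makes
   the averages span. *)
Lemma lang (M : 'M[F]_3) : M \in unitmx ->
  exists2 P : 'M[L]_3, P \in unitmx & frobm Q P = map_mx iota M *m P.
Proof.
move=> uM; pose phi (X : 'M[F]_3) := invmx M *m frobm Q X.
have phi_inj : injective phi.
  by move=> X Y /(congr1 (mulmx M)); rewrite !mulKVmx // => /(frobm_inj charQ).
pose n := fingraph.order phi 1%:M; have n0 : (0 < n)%N by apply: order_gt0.
pose Ns i := iter i phi 1%:M; have Nn : Ns n = 1%:M by apply: iter_order.
pose iM (X : 'M[F]_3) := map_mx iota X.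
pose T (c : L) : 'M[L]_3 := \sum_(i < n) c ^+ (Q ^ i) *: iM (Ns i).
have T_fix c : c ^+ (Q ^ n) = c -> iM M *m T c = frobm Q (T c).
  move=> cn.
  have frT : frobm Q (T c) = \sum_(i < n) c ^+ (Q ^ i.+1) *: (iM M *m iM (Ns i.+1)).
    apply/matrixP=> a b; rewrite [LHS]mxE !summxE expr_sum_pchar //; apply: eq_bigr => i _.
    rewrite [in RHS]mxE -map_mxM /= /phi mulKVmx // frobm_map !mxE exprMn -exprM.
    by rewrite expnSr.
  have := @big_ord_recr _ 0 +%R n (fun i : 'I_n.+1 => c ^+ (Q ^ i) *: iM (Ns i)).
  rewrite big_ord_recl /= cn expn0 expr1 -/(Ns n) Nn [in RHS]addrC => /addrI eT.
  rewrite frT -[in LHS]/(T c) /T -eT mulmx_sumr; apply: eq_bigr => i _.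
  by rewrite scalemxAr.
have [r [ur sr mr]] := fixed_field_roots n0.
(* The rows of [S] are the columns of the fixed matrices T(c), for c in the field with Q^n elements;
   three independent ones will be the columns of the solution. *)
pose I : finType := ('I_(size r) * 'I_3)%type.
pose ev (k : 'I_#|{: I}|) : 'I_(size r) * 'I_3 := enum_val k.
pose S : 'M[L]_(#|{: I}|, 3) := \matrix_(k, j) T r`_(ev k).1 j (ev k).2.
have fullS : row_full S.
  rewrite -col_leq_rank -mxrank_tr; suff: row_free S^T by rewrite -row_leq_rank.
  apply: inj_row_free => v vS; apply/matrixP=> a l; rewrite (ord1 a) {a} mxE.
  (* p(c) is entry l of v T(c). Vanishing at Q^n elements while of degree at most Q^(n-1), p is
     zero, and its coefficient of X is v_l because [Ns 0] is the identity. *)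
  pose p : {poly L} := \sum_(i < n) (v *m iM (Ns i)) 0 l *: 'X^(Q ^ i).
  have p_root c : c \in r -> root p c.
    move=> cr; have ir : (index c r < size r)%N by rewrite index_mem.
    have := congr1 (fun m : 'rV_ _ => m 0 (enum_rank ((Ordinal ir, l) : I))) vS.
    rewrite /= !mxE (eq_bigr (fun j => v 0 j * T c j l)); last first.
      by move=> j _; rewrite !mxE /ev enum_rankK /= nth_index.
    move=> vT; rewrite /root /p horner_sum -[X in _ == X]vT; apply/eqP.
    under [RHS]eq_bigr => j _ do rewrite summxE mulr_sumr.
    rewrite exchange_big /=; apply: eq_bigr => i _.
    rewrite hornerZ hornerXn [in LHS]mxE mulr_suml; apply: eq_bigr => j _.
    by rewrite [in RHS]mxE; ring.
  have p0 : p = 0.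
    apply/eqP/negPn/negP => p0.
    have := max_poly_roots p0 (introT allP p_root) ur; apply/negP; rewrite sr -leqNgt.
    apply: leq_trans (size_sum _ _ _) _; apply/bigmax_leqP => i _.
    apply: leq_trans (size_scale_leq _ _) _; rewrite size_polyXn.
    by rewrite ltn_exp2l.
  have := congr1 (fun p : {poly L} => p`_1) p0; rewrite coef0 coef_sum.
  rewrite (bigD1 (Ordinal n0)) //= big1 => [|i i0].
    by rewrite coefZ coefXn expn0 eqxx mulr1 addr0 /iM map_mx1 mulmx1.
  rewrite coefZ coefXn (_ : (1 == Q ^ i)%N = false) ?mulr0 //.
  have i_gt0 : (0 < i)%N by rewrite lt0n; apply: contra i0 => /eqP i0; apply/eqP/val_inj.
  by rewrite ltn_eqF // -(exp1n i) ltn_exp2r.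
have uP := fullrowsub_full fullS; set P' := rowsub _ S in uP.
exists P'^T; first by rewrite unitmx_tr -row_full_unit.
apply/matrixP=> a b; rewrite /P' [LHS]mxE ![in LHS]mxE.
set k := ev _.
have ck : (r`_k.1) ^+ (Q ^ n) = r`_k.1 by apply/eqP; rewrite -mr mem_nth.
have := congr1 (fun m : 'M[L]_3 => m a k.2) (T_fix _ ck); rewrite [RHS]mxE => <-.
by rewrite !mxE; apply: eq_bigr => j _; rewrite !mxE.
Qed.
End Lang.

(** * GL_3(F_2) *)

(* Vectors over F_2 and, as triples of columns, 3x3 matrices over F_2, in a
   form on which [vm_compute] evaluates. *)
Definition bvec := (bool * bool * bool)%type.
Definition bmat := (bvec * bvec * bvec)%type.

Definition bget (p : bvec) (i : 'I_3) : bool := nth false [:: p.1.1; p.1.2; p.2] i.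
Definition bcol (g : bmat) (j : 'I_3) : bvec :=
  nth (false, false, false) [:: g.1.1; g.1.2; g.2] j.

Definition bvec0 : bvec := (false, false, false).
Definition baddv (p r : bvec) : bvec :=
  (p.1.1 (+) r.1.1, p.1.2 (+) r.1.2, p.2 (+) r.2).
Definition bscale (b : bool) (p : bvec) : bvec := if b then p else bvec0.
Definition bdot (p r : bvec) : bool :=
  (p.1.1 && r.1.1) (+) (p.1.2 && r.1.2) (+) (p.2 && r.2).
Definition bapp (g : bmat) (p : bvec) : bvec :=
  baddv (baddv (bscale p.1.1 g.1.1) (bscale p.1.2 g.1.2)) (bscale p.2 g.2).
Definition bmul (g h : bmat) : bmat := (bapp g h.1.1, bapp g h.1.2, bapp g h.2).
Definition brow (p : bvec) (g : bmat) : bvec :=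
  (bdot p g.1.1, bdot p g.1.2, bdot p g.2).
Definition bid : bmat := ((true, false, false), (false, true, false), (false, false, true)).
Definition bexp (g : bmat) (n : nat) : bmat := iter n (bmul g) bid.
Definition bdet (u v w : bvec) : bool :=
  (u.1.1 && ((v.1.2 && w.2) (+) (v.2 && w.1.2)))
  (+) (u.1.2 && ((v.1.1 && w.2) (+) (v.2 && w.1.1)))
  (+) (u.2 && ((v.1.1 && w.1.2) (+) (v.1.2 && w.1.1))).

Definition bvecs : seq bvec :=
  [seq (xy, z) | xy <- [seq (x, y) | x <- [:: false; true], y <- [:: false; true]],
                 z <- [:: false; true]].
Definition bvecs1 : seq bvec := behead bvecs.
Definition GL3 : seq bmat :=
  [seq g <- [seq (uv, w) | uv <- [seq (u, v) | u <- bvecs, v <- bvecs], w <- bvecs]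
     | all (fun p => bapp g p != bvec0) bvecs1].

Lemma mem_bvecs p : p \in bvecs.
Proof. by case: p => [[[] []] []]. Qed.

Lemma mem_bvecs1 p : (p \in bvecs1) = (p != bvec0).
Proof. by case: p => [[[] []] []]. Qed.

Lemma mem_GL3 g : (g \in GL3) = all (fun p => bapp g p != bvec0) bvecs1.
Proof.
rewrite mem_filter andb_idr // => _; case: g => [[u v] w].
by rewrite !allpairs_f ?mem_bvecs.
Qed.

Lemma bid_GL3 : bid \in GL3. Proof. by vm_compute. Qed.

Lemma GL3_inv g : g \in GL3 -> exists2 h, h \in GL3 & bmul g h = bid /\ bmul h g = bid.
Proof.
have: all (fun g => has (fun h => (bmul g h == bid) && (bmul h g == bid)) GL3) GL3.
  by vm_compute.
by move=> /allP H /H /hasP[h Gh /andP[/eqP ? /eqP ?]]; exists h.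
Qed.

Section Embedding.
Variable K : fieldType.
Hypothesis char2 : 2%N \in [pchar K].

Definition cv (p : bvec) : 'cV[K]_3 := \col_i (bget p i)%:R.
Definition cm (g : bmat) : 'M[K]_3 := \matrix_(i, j) (bget (bcol g j) i)%:R.

Lemma natr_addb (a b : bool) : (a (+) b)%:R = a%:R + b%:R :> K.
Proof. by case: a b => [] []; rewrite ?addr0 ?add0r // addrr_pchar2. Qed.

Lemma natr_andb (a b : bool) : (a && b)%:R = a%:R * b%:R :> K.
Proof. by case: a b => [] []; rewrite ?mulr0 ?mul0r ?mulr1. Qed.

Lemma bget_scale b p i : bget (bscale b p) i = b && bget p i.
Proof. by case: b => //; elim/ord3_ind: i. Qed.

Lemma bget_addv p r i : bget (baddv p r) i = bget p i (+) bget r i.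
Proof. by elim/ord3_ind: i. Qed.

Lemma cv_app g p : cv (bapp g p) = cm g *m cv p.
Proof.
apply/matrixP=> i j; rewrite !mxE sum3E !mxE /bapp !bget_addv !bget_scale.
by rewrite !natr_addb !natr_andb /bcol /bget /=; congr (_ + _ + _); rewrite mulrC.
Qed.

Lemma cm_col g j : col j (cm g) = cv (bcol g j).
Proof. by apply/matrixP=> a b; rewrite !mxE. Qed.

Lemma cm_mul g h : cm (bmul g h) = cm g *m cm h.
Proof.
apply/matrixP=> i j; have -> : (cm g *m cm h) i j = (cm g *m col j (cm h)) i 0.
  by rewrite !mxE; apply: eq_bigr => k _; rewrite !mxE.
by rewrite cm_col -cv_app !mxE; elim/ord3_ind: j.
Qed.

Lemma cm_bid : cm bid = 1%:M.
Proof. by apply/matrixP; elim/ord3_ind; elim/ord3_ind; rewrite !mxE. Qed.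

Lemma cv_row p g : (cv p)^T *m cm g = (cv (brow p g))^T.
Proof.
apply/matrixP=> i j; rewrite !mxE sum3E !mxE.
by elim/ord3_ind: j; rewrite /bcol /bget /brow /bdot /= !natr_addb !natr_andb.
Qed.

Lemma natr_bool_inj (a b : bool) : a%:R = b%:R :> K -> a = b.
Proof. by case: a b => [] [] // /eqP; rewrite ?oner_eq0 // eq_sym oner_eq0. Qed.

Lemma cv_inj : injective cv.
Proof.
move=> p r /matrixP e.
have := e o0 0; have := e o1 0; have := e o2 0; rewrite !mxE.
move=> /natr_bool_inj + /natr_bool_inj + /natr_bool_inj.
by case: p r {e} => [[? ?] ?] [[? ?] ?]; rewrite /bget /= => -> -> ->.
Qed.

Lemma cm_inj : injective cm.
Proof.
move=> g h e; have ec j : bcol g j = bcol h j by apply: cv_inj; rewrite -!cm_col e.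
have := ec o0; have := ec o1; have := ec o2; rewrite /bcol /=.
by case: g h {e ec} => [[? ?] ?] [[? ?] ?] /= -> -> ->.
Qed.

Lemma cv0 : cv bvec0 = 0.
Proof. by apply/matrixP; elim/ord3_ind => j; rewrite !mxE. Qed.

Lemma cv_eq0 p : (cv p == 0) = (p == bvec0).
Proof. by rewrite -cv0 (inj_eq cv_inj). Qed.

Lemma cm_unit g : (cm g \in unitmx) = (g \in GL3).
Proof.
apply/idP/idP=> [ug|/GL3_inv[h _ [gh _]]]; last first.
  by have /mulmx1_unit[] : cm g *m cm h = 1%:M by rewrite -cm_mul gh cm_bid.
rewrite mem_GL3; apply/allP=> p; rewrite mem_bvecs1 -cv_eq0 -[bapp g p != _]negbK.
by apply: contra; rewrite negbK -cv_eq0 cv_app => /eqP e; rewrite -(mulKmx ug (cv p)) e mulmx0.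
Qed.

Lemma sqr_fixed (x : K) : x ^+ 2 = x -> exists b : bool, x = b%:R.
Proof.
move=> /eqP; rewrite expr2 -subr_eq0 -{3}[x]mulr1 -mulrBr mulf_eq0 subr_eq0.
by case/orP=> /eqP->; [exists false | exists true].
Qed.

Lemma sqm_fixed_cv (x : 'cV[K]_3) : sqm x = x -> exists p, x = cv p.
Proof.
move=> /matrixP e.
have e' i : x i 0 ^+ 2 = x i 0 by have := e i 0; rewrite mxE.
have [[b0 e0] [b1 e1] [b2 e2]] := And3 (sqr_fixed (e' o0)) (sqr_fixed (e' o1)) (sqr_fixed (e' o2)).
by exists (b0, b1, b2); apply: col3P; rewrite !mxE ?e0 ?e1 ?e2.
Qed.

Lemma sqm_fixed_cm (A : 'M[K]_3) : sqm A = A -> exists g, A = cm g.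
Proof.
move=> e; have ec j : sqm (col j A) = col j A by rewrite -[in RHS]e; apply/matrixP=> a b; rewrite !mxE.
have [[p0 e0] [p1 e1] [p2 e2]] := And3 (sqm_fixed_cv (ec o0)) (sqm_fixed_cv (ec o1)) (sqm_fixed_cv (ec o2)).
exists (p0, p1, p2); apply/matrixP=> i j.
transitivity (col j A i 0); first by rewrite mxE.
by rewrite [RHS]mxE; elim/ord3_ind: j; rewrite ?e0 ?e1 ?e2 mxE.
Qed.

Lemma frobm_cm n g : (0 < n)%N -> frobm n (cm g) = cm g.
Proof.
by move=> n0; apply/matrixP=> i j; rewrite !mxE; case: bget; rewrite ?expr1n ?expr0n ?gtn_eqF.
Qed.

Lemma frobm_cv n p : (0 < n)%N -> frobm n (cv p) = cv p.
Proof.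
by move=> n0; apply/matrixP=> i j; rewrite !mxE; case: bget; rewrite ?expr1n ?expr0n ?gtn_eqF.
Qed.

End Embedding.

(** * Normal forms *)

Lemma closed_sqrt (L : closedFieldType) (a : L) : exists b, b ^+ 2 = a.
Proof.
have [b] := @solve_monicpoly L 2 (fun i => if i == 0%N then a else 0) isT.
by rewrite !big_ord_recl big_ord0 /= expr0 mulr1 mul0r !addr0 => e; exists b.
Qed.

Lemma sqmZ (R : comNzRingType) m n (c : R) (A : 'M[R]_(m, n)) :
  sqm (c *: A) = c ^+ 2 *: sqm A.
Proof. by apply/matrixP=> i j; rewrite !mxE exprMn. Qed.

Definition cfun (K : Type) (x : 'cV[K]_3) : 'I_3 -> K := fun i => x i 0.

Lemma col_cfun (K : Type) (x : 'cV[K]_3) : \col_i cfun x i = x.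
Proof. by apply/matrixP=> i j; rewrite mxE (ord1 j). Qed.

Lemma nonzero3P (K : fieldType) (v : 'I_3 -> K) : nonzero3 v <-> \col_i v i != 0.
Proof.
split=> [[i vi]|]; first by apply: contra vi => /eqP/matrixP/(_ i 0); rewrite !mxE => ->.
move=> v0; suff /existsP[i vi] : [exists i, v i != 0] by exists i.
apply: contraNT v0 => /existsPn h; apply/eqP/matrixP=> i j; rewrite !mxE.
by apply/eqP; rewrite -[_ == _]negbK h.
Qed.

Lemma proportionalP (K : fieldType) (u v : 'I_3 -> K) :
  proportional u v <-> exists2 c, c != 0 & \col_i u i = c *: \col_i v i.
Proof.
split=> [[c [c0 e]]|[c c0 /matrixP e]].
  by exists c => //; apply/matrixP=> i j; rewrite !mxE.
by exists c; split=> // i; have := e i 0; rewrite !mxE.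
Qed.

Section ClosedChar2.
Variable L : closedFieldType.
Hypothesis char2 : 2%N \in [pchar L].
Implicit Types (R B N : 'M[L]_3) (d : L).

Let pn2 : [pchar L].-nat 2. Proof. by rewrite pnatE. Qed.
Let add2 (z : L) : z + z = 0. Proof. exact: addrr_pchar2. Qed.
Let opp2 (z : L) : - z = z. Proof. exact: oppr_pchar2. Qed.
Notation cvL := (cv L).

Lemma cofpE R : R \in unitmx -> cofp R = \det R *: invmx R^T.
Proof.
move=> uR; have uT : R^T \in unitmx by rewrite unitmx_tr.
rewrite -[LHS](mulKmx uT) cofp_tr //.
by rewrite mul_mx_scalar.
Qed.

(** Substituting A = (P^T)^-1 turns [N] into det(A) (P^(2))^-1 N P, which the equation on P makes
    scalar. *)
Lemma nf_exists B N P : P \in unitmx -> sqm P = N *m P ->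
  exists B' d, d != 0 /\ forall x, qf B N x = qf B' d%:M (P^T *m x).
Proof.
move=> uP eP; have uPT : P^T \in unitmx by rewrite unitmx_tr.
pose A := invmx P^T; have uA : A \in unitmx by rewrite unitmx_inv.
exists ((sqm A)^T *m (B *m sqm A + N *m dprod A)), (\det A); split.
  by rewrite -unitfE -unitmxE.
move=> x; have AT : A^T = invmx P by rewrite /A -trmx_inv trmxK.
have -> : (\det A)%:M = (sqm A)^T *m N *m cofp A.
  rewrite cofpE // AT invmxK -scalemxAr -mulmxA -eP sqm_tr AT -sqm_mulmx //.
  rewrite mulVmx // (_ : sqm 1%:M = 1%:M) ?scalemx1 //.
  by apply/matrixP=> i j; rewrite !mxE; case: eqP; rewrite ?expr1n ?expr0n.
by rewrite -qf_mulmx // mulKmx.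
Qed.

Lemma unit_mulmx_eq0 R (x : 'cV[L]_3) : R \in unitmx -> (R *m x == 0) = (x == 0).
Proof.
move=> uR; apply/eqP/eqP=> [e|->]; last by rewrite mulmx0.
by rewrite -(mulKmx uR x) e mulmx0.
Qed.

Lemma unit_mulmx_inj R (x y : 'cV[L]_3) : R \in unitmx -> R *m x = R *m y -> x = y.
Proof. by move=> uR e; rewrite -(mulKmx uR x) e mulKmx. Qed.

Lemma sqm_unit R : R \in unitmx -> sqm R \in unitmx.
Proof. exact: frobm_unit. Qed.

Lemma sqm_cv p : sqm (cvL p) = cvL p.
Proof. exact: frobm_cv. Qed.

(** The multiple (lam / c) y is fixed by squaring, hence lies in F_2^3. This is how the points and
    lines of the Fano plane arise. *)
Lemma sqm_eigen (y : 'cV[L]_3) c lam : y != 0 -> c != 0 ->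
  c *: y = lam *: sqm y -> lam != 0 /\ exists2 p, p != bvec0 & y = (c / lam) *: cvL p.
Proof.
move=> y0 c0 e; have l0 : lam != 0.
  by apply: contra_neq y0 => l0; move/eqP: e; rewrite l0 scale0r scaler_eq0 (negbTE c0) => /eqP.
split=> //; have [|p ep] := @sqm_fixed_cv L ((lam / c) *: y).
  rewrite sqmZ (_ : (lam / c) ^+ 2 = lam / c ^+ 2 * lam); last by field.
  by rewrite -[LHS]scalerA -e scalerA; congr (_ *: _); field.
have yE : y = (c / lam) *: cvL p.
  by rewrite -ep scalerA -[LHS]scale1r; congr (_ *: _); field; rewrite l0 c0.
by exists p => //; apply: contra_neq y0 => p0; rewrite yE p0 cv0 scaler0.
Qed.

Lemma cv_proportional c p r : p != bvec0 -> cvL p = c *: cvL r -> p = r /\ c = 1.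
Proof.
move=> p0 e; suff c1 : c = 1 by split=> //; apply: (@cv_inj L); rewrite e c1 scale1r.
have /nonzero3P[i] : \col_i cfun (cvL p) i != 0 by rewrite col_cfun cv_eq0.
have := congr1 (fun m : 'cV[L]_3 => m i 0) e; rewrite /cfun !mxE.
case: (bget p i); case: (bget r i); rewrite ?mulr1 ?mulr0 ?eqxx //.
by move/eqP; rewrite oner_eq0.
Qed.

Lemma crossp_eq0 (w x : 'cV[L]_3) : x != 0 -> crossp w x = 0 -> exists lam, w = lam *: x.
Proof.
move=> x0 wx; have /nonzero3P[i] : \col_i cfun x i != 0 by rewrite col_cfun.
rewrite /cfun => xi; exists (w i 0 / x i 0).
have mv (a b : L) : a + b = 0 -> a = b by move/eqP; rewrite addr_eq0 opp2 => /eqP.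
have ee i' := congr1 (fun m : 'cV[L]_3 => m i' 0) wx.
move: (ee o0) (ee o1) (ee o2); rewrite !mxE /= => /mv e0 /mv e1 /mv e2.
have wx_sym k j : w k 0 * x j 0 = w j 0 * x k 0.
  by elim/ord3_ind: k; elim/ord3_ind: j; rewrite // ?e0 ?e1 ?e2.
apply/matrixP=> a b; rewrite (ord1 b) mxE mulrAC -wx_sym mulfK //.
Qed.

Lemma crosspZ c (x : 'cV[L]_3) : crossp (c *: x) x = 0.
Proof.
apply/matrixP=> i j; rewrite !mxE.
by rewrite -[RHS](add2 (c * x (nx i) 0 * x (nx (nx i)) 0)); ring.
Qed.

End ClosedChar2.

Section NormalForm.
Variables (F : finFieldType) (L : closedFieldType) (iota : {rmorphism F -> L}).
Hypothesis char2F : 2%N \in [pchar F].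
Implicit Types (f : quartic F) (v : 'I_3 -> L) (R B N : 'M[L]_3) (d : L).

Let char2 : 2%N \in [pchar L] := rmorph_pchar iota char2F.

Notation cvL := (cv L).

Definition nf f R B d := [/\ R \in unitmx, d != 0 &
  forall x, qev iota f x = qf B d%:M (R *m x)].

Lemma nf_Nm f R B d : nf f R B d ->
  map_mx iota (Nm f) = (d * \det R) *: (sqm R^T *m invmx R^T).
Proof.
move=> [uR d0 e]; have [] := @qf_inj L (map_mx iota (Bm f)) (map_mx iota (Nm f))
  ((sqm R)^T *m (B *m sqm R + d%:M *m dprod R)) ((sqm R)^T *m d%:M *m cofp R).
  by move=> x; rewrite -qf_mulmx // -e.
by move=> -> _; rewrite cofpE // mul_mx_scalar -scalemxAl -scalemxAr scalerA sqm_tr.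
Qed.

(** Writing v = R^T y, the condition that N v is proportional to v^(2) becomes d det(R) y = lam
    y^(2), and [sqm_eigen] applies. *)
Lemma nf_bitangent f R B d v : nf f R B d -> bitangent iota f v <->
  exists p c, [/\ p != bvec0, c != 0 & \col_i v i = c *: (R^T *m cvL p)].
Proof.
move=> nfR; have [uR d0 _] := nfR; have uRT : R^T \in unitmx by rewrite unitmx_tr.
have k0 : d * \det R != 0 by rewrite mulf_neq0 // -unitfE -unitmxE.
rewrite bitangentP // (nf_Nm nfR); split=> [[/nonzero3P v0 [lam]]|[p [c [p0 c0 e]]]].
  have [y eV] : exists y, \col_i v i = R^T *m y.
    by exists (invmx R^T *m \col_i v i); rewrite mulKVmx.
  rewrite eV in v0 *; have y0 : y != 0 by rewrite -(unit_mulmx_eq0 _ uRT).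
  rewrite sqm_mulmx // -scalemxAl -mulmxA mulKmx //.
  rewrite [_ *: (_ *m y)]scalemxAr [lam *: _]scalemxAr => /(unit_mulmx_inj (sqm_unit char2 uRT)) e.
  have [l0 [p p0 ->]] := sqm_eigen y0 k0 e.
  exists p, (d * \det R / lam); rewrite scalemxAr; split=> //.
  by rewrite mulf_neq0 ?invr_eq0.
split.
  by apply/nonzero3P; rewrite e scaler_eq0 negb_or c0 unit_mulmx_eq0 // cv_eq0.
exists (d * \det R / c); rewrite e sqmZ sqm_mulmx // -scalemxAl -scalemxAr -mulmxA mulKmx //.
rewrite sqm_cv !scalerA; congr (_ *: _).
by field.
Qed.

Lemma nf_seven f R B d : nf f R B d -> seven_bitangents iota f.
Proof.
move=> nfR; have [uR d0 _] := nfR; have uRT : R^T \in unitmx by rewrite unitmx_tr.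
pose l p := cfun (R^T *m cvL p).
pose s := [tuple of map l (in_tuple bvecs1)].
have sE i : tnth s i = l (tnth (in_tuple bvecs1) i) by rewrite tnth_map.
have p0 i : tnth (in_tuple bvecs1) i != bvec0 by rewrite -mem_bvecs1 mem_tnth.
exists s; split=> [i|].
  by apply/(nf_bitangent _ nfR); exists (tnth (in_tuple bvecs1) i), 1; rewrite sE col_cfun scale1r oner_eq0.
split=> [i j ij|v /(nf_bitangent _ nfR)[p [c [pn0 c0 e]]]].
  move=> /proportionalP[c c0]; rewrite !sE !col_cfun scalemxAr.
  move=> /(unit_mulmx_inj uRT) /(cv_proportional (p0 i))[e _].
  case/eqP: ij; apply/val_inj/eqP => /=; rewrite -(nth_uniq bvec0 _ _ (s := bvecs1)) //.
  by rewrite -!(tnth_nth bvec0 (in_tuple bvecs1)) e.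
have /(nthP bvec0)[i i7 ep] : p \in bvecs1 by rewrite mem_bvecs1.
exists (Ordinal i7); apply/proportionalP; exists c => //.
by rewrite sE col_cfun (tnth_nth bvec0) /= ep.
Qed.

(** The gradient at x is the cross product of N^T x^(2) with x, and N^T x^(2) is a multiple of R^-1
    (R x)^(2). It vanishes exactly when (R x)^(2) is proportional to R x, that is, at the Fano
    points, so only the values of f there matter. *)
Lemma nf_nonsingular f R B d : nf f R B d ->
  nonsingular iota f <-> forall p, p != bvec0 -> qf B d%:M (cvL p) != 0.
Proof.
move=> nfR; have [uR d0 ef] := nfR; have uRT : R^T \in unitmx by rewrite unitmx_tr.
have k0 : d * \det R != 0 by rewrite mulf_neq0 // -unitfE -unitmxE.
have NT x : (map_mx iota (Nm f))^T *m sqm x = (d * \det R) *: (invmx R *m sqm (R *m x)).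
  rewrite (nf_Nm nfR) linearZ /= trmx_mul trmx_inv trmxK -sqm_tr trmxK.
  by rewrite -scalemxAl -mulmxA -sqm_mulmx.
have dE i v : (mderiv i (qL iota f)).@[v] =
    crossp ((map_mx iota (Nm f))^T *m sqm (\col_j v j)) (\col_j v j) i 0.
  by rewrite qL_qf mderiv_qf.
split=> [ns p p0 | tp v /nonzero3P v0].
  pose x := invmx R *m cvL p.
  have x0 : x != 0 by rewrite unit_mulmx_eq0 ?unitmx_inv // cv_eq0.
  have Rx : R *m x = cvL p by rewrite mulKVmx.
  apply/eqP=> fp; have [||i] := ns (cfun x).
  - by apply/nonzero3P; rewrite col_cfun.
  - by rewrite qL_eval col_cfun -[qf _ _ _]/(qev iota f x) ef Rx.
  rewrite dE col_cfun NT Rx sqm_cv -/x (crosspZ char2) mxE eqxx //.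
rewrite qL_eval -[qf _ _ _]/(qev iota f _) ef => f0.
suff /existsP[i di] : [exists i, (mderiv i (qL iota f)).@[v] != 0] by exists i.
apply: contraT => /existsPn dv; move: f0; set x := \col_i v i in v0 dE *.
have [|lam] := @crossp_eq0 L char2 ((map_mx iota (Nm f))^T *m sqm x) x v0.
  by apply/matrixP=> i j; rewrite (ord1 j) -dE mxE; apply/eqP; rewrite -[_ == _]negbK dv.
rewrite NT => e; have y0 : R *m x != 0 by rewrite unit_mulmx_eq0.
have l0 : lam != 0.
  apply/eqP=> l0; move/eqP: e; rewrite l0 scale0r scaler_eq0 (negbTE k0) /=.
  rewrite unit_mulmx_eq0 ?unitmx_inv //; apply/negP; apply: contra y0 => /eqP/matrixP s0.
  by apply/eqP/matrixP=> i j; apply/eqP; have := s0 i j; rewrite !mxE => /eqP; rewrite expf_eq0.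
have e' : lam *: (R *m x) = (d * \det R) *: sqm (R *m x).
  by rewrite scalemxAr -e -scalemxAr mulKVmx.
have [_ [p p0 ->]] := sqm_eigen y0 l0 e'.
rewrite qfZ => /eqP; rewrite mulf_eq0 (negbTE (tp _ p0)) orbF expf_eq0 /=.
by rewrite mulf_eq0 invr_eq0 (negbTE l0) (negbTE k0).
Qed.

End NormalForm.

(** * Seven bitangents force [N] to be invertible *)

Section SevenUnit.
Variables (F : finFieldType) (L : closedFieldType) (iota : {rmorphism F -> L}).
Hypothesis char2F : 2%N \in [pchar F].

Let char2 : 2%N \in [pchar L] := rmorph_pchar iota char2F.
Let opp2 (z : L) : - z = z. Proof. exact: oppr_pchar2. Qed.

Definition indep2 (x y : 'cV[L]_3) := forall a b, a *: x + b *: y = 0 -> a = 0 /\ b = 0.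

Lemma nonproportional_indep2 (x y : 'cV[L]_3) : x != 0 -> y != 0 ->
  (forall c, c != 0 -> x <> c *: y) -> indep2 x y.
Proof.
move=> x0 y0 np a b e.
have a0 : a = 0.
  apply: contra_eq e => a0; apply/eqP => e.
  have xE : x = (- b / a) *: y.
    move/eqP: e; rewrite addr_eq0 -scaleNr => /eqP e.
    by rewrite mulrC -scalerA -e scalerA mulVf // scale1r.
  have [c0|/np] := eqVneq (- b / a) 0; last exact.
  by case/eqP: x0; rewrite xE c0 scale0r.
split=> //; move/eqP: e; rewrite a0 scale0r add0r scaler_eq0 (negbTE y0) orbF.
by move/eqP.
Qed.

Lemma sqm_eq0 (x : 'cV[L]_3) : sqm x = 0 -> x = 0.
Proof.
move=> /matrixP s0; apply/matrixP=> i j; have := s0 i j.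
by rewrite !mxE => /eqP; rewrite expf_eq0 => /eqP.
Qed.

Lemma sqmD (x y : 'cV[L]_3) : sqm (x + y) = sqm x + sqm y.
Proof. by apply/matrixP=> i j; rewrite !mxE sqrD2. Qed.

Lemma indep2_sqm (x y : 'cV[L]_3) : indep2 x y -> indep2 (sqm x) (sqm y).
Proof.
move=> ixy a b; have [c <-] := closed_sqrt a; have [d <-] := closed_sqrt b.
rewrite -!sqmZ -sqmD => /sqm_eq0/ixy[-> ->].
by rewrite expr0n.
Qed.

(* Solutions of [N u = u^(2)] independent over F_2 are independent over [L]. *)
Lemma fixed_triple_unit (N : 'M[L]_3) (x y z : 'cV[L]_3) :
  N *m x = sqm x -> N *m y = sqm y -> N *m z = sqm z ->
  indep2 x y -> z != 0 -> z <> x -> z <> y -> z <> x + y -> N \in unitmx.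
Proof.
move=> Nx Ny Nz ixy z0 zx zy zxy.
pose U : 'M[L]_3 := \matrix_(i, j) nth x [:: x; y; z] j i 0.
have UE (c : 'cV[L]_3) : U *m c = c o0 0 *: x + c o1 0 *: y + c o2 0 *: z.
  by apply/matrixP=> i j; rewrite (ord1 j) !mxE sum3E !mxE /=; ring.
have colU (A : 'M[L]_3) (B : 'M[L]_3) : (forall j, col j A = col j B) -> A = B.
  move=> h; apply/matrixP=> i j; have := congr1 (fun m : 'cV[L]_3 => m i 0) (h j).
  by rewrite !mxE.
have NU : N *m U = sqm U.
  apply: colU => j; transitivity (N *m col j U).
    by apply/matrixP=> a b; rewrite !mxE; apply: eq_bigr => k _; rewrite !mxE.
  have eU : [/\ col o0 U = x, col o1 U = y & col o2 U = z].
    by split; apply/matrixP=> a b; rewrite !mxE (ord1 b).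
  have {eU}[e0 e1 e2] := eU.
  have sE (A : 'M[L]_3) k : col k (sqm A) = sqm (col k A) by apply/matrixP=> a b; rewrite !mxE.
  by rewrite sE; elim/ord3_ind: j; rewrite ?e0 ?e1 ?e2.
suff uU : U \in unitmx.
  have := sqm_unit char2 uU; rewrite -NU unitmx_mul => /andP[] //.
rewrite unitmxE unitfE; apply/negP; rewrite -det_tr => /det0P[c c0 /(congr1 trmx)].
rewrite trmx_mul trmxK trmx0 UE !mxE.
set a := c 0 o0; set b := c 0 o1; set d := c 0 o2 => e.
have d0 : d != 0.
  apply/eqP=> d0; move: e; rewrite d0 scale0r addr0 => /ixy[a0 b0].
  case/eqP: c0; apply/matrixP=> i j; rewrite (ord1 i) mxE.
  by elim/ord3_ind: j.
have zE : z = (a / d) *: x + (b / d) *: y.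
  move/eqP: e; rewrite addr_eq0 -scaleNr opp2 => /eqP e.
  by rewrite ![_ / d]mulrC -!scalerA -scalerDr e scalerA mulVf // scale1r.
move: (a / d) (b / d) zE => {e d0} r s zE.
(* Applying N to z = r x + s y and comparing with z^(2) gives r^2 = r and s^2 = s, so z would be one
   of 0, x, y, x + y. *)
have : (r ^+ 2 - r) *: sqm x + (s ^+ 2 - s) *: sqm y = 0.
  move: Nz; rewrite zE mulmxDr -!scalemxAr Nx Ny sqmD !sqmZ => /eqP.
  rewrite -subr_eq0 => /eqP eN; apply/eqP; rewrite -oppr_eq0 -[X in _ == X]eN.
  by apply/eqP/matrixP=> i j; rewrite !mxE; ring.
move=> /(indep2_sqm ixy)[/eqP + /eqP]; rewrite !subr_eq0 => /eqP/sqr_fixed[r' rE] /eqP/sqr_fixed[s' sE].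
move: zE; rewrite rE sE; case: r' {rE}; case: s' {sE}; rewrite ?scale1r ?scale0r ?addr0 ?add0r // => zE.
by rewrite zE eqxx in z0.
Qed.

(** If N is singular, a kernel vector is one of the bitangents, say i0. No other bitangent lies in
    the kernel ([stepA]), so each of them rescales to a solution of N u = u^(2). By
    [fixed_triple_unit] any third solution is the sum of the first two, which four of the remaining
    six bitangents already contradict. *)
Lemma seven_unit (f : quartic F) : seven_bitangents iota f ->
  map_mx iota (Nm f) \in unitmx.
Proof.
move=> [s [sb [snp sall]]]; set N := map_mx iota (Nm f).
pose V i : 'cV[L]_3 := \col_k tnth s i k.
have bitP v := bitangentP iota char2 f v.
have V0 i : V i != 0 by have /bitP[/nonzero3P] := sb i.
have VP i j c : i != j -> c != 0 -> V i <> c *: V j.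
  by move=> ij c0 e; apply: (snp _ _ ij); apply/proportionalP; exists c.
apply: contraT => nuN.
have [w w0 Nw] : exists2 w : 'cV[L]_3, w != 0 & N *m w = 0.
  move: nuN; rewrite unitmxE unitfE negbK -det_tr => /det0P[c c0 e].
  exists c^T; last by rewrite -[LHS]trmxK trmx_mul trmxK e trmx0.
  by apply: contra c0 => /eqP e'; rewrite -[c]trmxK e' trmx0.
have ker_bit x : x != 0 -> N *m x = 0 -> exists i c, c != 0 /\ x = c *: V i.
  move=> x0 Nx; have [|i /proportionalP[c c0]] := sall (cfun x).
    by apply/bitP; split; [apply/nonzero3P|exists 0]; rewrite col_cfun // Nx scale0r.
  by rewrite col_cfun => e; exists i, c.
have [i0 [c [c0 wE]]] := ker_bit w w0 Nw.
have N0 : N *m V i0 = 0.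
  by move/eqP: Nw; rewrite wE -scalemxAr scaler_eq0 (negbTE c0) => /eqP.
have ind i j : i != j -> indep2 (V i) (V j).
  by move=> ij; apply: nonproportional_indep2 => // e; apply: VP.
have stepA i : i != i0 -> N *m V i != 0.
  move=> ii0; apply/eqP=> Ni.
  have pn2F : [pchar F].-nat 2 by rewrite pnatE.
  (* Eight distinct scalars, one more than there are bitangents: a kernel of dimension 2 would give
     eight distinct bitangents V i0 + r V i. *)
  have [r [ur sr _]] := @fixed_field_roots F L iota 2 pn2F isT 3 isT.
  have i0i : i0 != i by rewrite eq_sym.
  have ph (k : 'I_8) : exists j : 'I_7, exists c, c != 0 /\ V i0 + r`_k *: V i = c *: V j.
    apply: ker_bit; last by rewrite mulmxDr -scalemxAr N0 Ni scaler0 addr0.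
    apply/eqP => e; have [|/eqP] := ind i0 i i0i 1 r`_k; first by rewrite scale1r.
    by rewrite oner_eq0.
  have [phi phiP] := fin_all_exists ph.
  suff /leq_card : injective phi by rewrite !card_ord.
  move=> k k' ekk; have [a [a0 ea]] := phiP k; have [b [b0 eb]] := phiP k'.
  have e : V i0 + r`_k *: V i = (a / b) *: (V i0 + r`_k' *: V i).
    by rewrite eb ea ekk scalerA divfK.
  have [|e1 e2] := ind i0 i i0i (1 - a / b) (r`_k - a / b * r`_k').
    apply/eqP; move/eqP: e; rewrite -subr_eq0; congr (_ == _).
    by apply/matrixP=> x y; rewrite !mxE; ring.
  move/eqP: e1; rewrite subr_eq0 => /eqP e1; move/eqP: e2; rewrite -e1 mul1r subr_eq0.
  by rewrite nth_uniq ?sr // => /eqP/val_inj.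
have hl (i : 'I_7) : exists l, N *m V i = l *: sqm (V i).
  by have /bitP[_ [l e]] := sb i; exists l.
have [lam lamE] := fin_all_exists hl.
have lam0 i : i != i0 -> lam i != 0.
  by move=> /stepA; apply: contra => /eqP l0; rewrite lamE l0 scale0r.
pose U i := lam i *: V i.
have NU i : N *m U i = sqm (U i).
  by rewrite -scalemxAr lamE sqmZ expr2 scalerA.
have indU i j : i != j -> i != i0 -> j != i0 -> indep2 (U i) (U j).
  move=> ij /lam0 li /lam0 lj a b; rewrite !scalerA => /(ind _ _ ij)[/eqP + /eqP].
  by rewrite !mulf_eq0 (negbTE li) (negbTE lj) !orbF => /eqP-> /eqP->.
have U0 i : i != i0 -> U i != 0 by move=> /lam0 li; rewrite scaler_eq0 negb_or li V0.
have neU i j : i != j -> i != i0 -> j != i0 -> U i <> U j.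
  move=> ij ii ji e; have [|_ /eqP] := indU i j ij ii ji 1 (-1).
    by rewrite e scale1r scaleN1r subrr.
  by rewrite oppr_eq0 oner_eq0.
have third i j k : [&& i != j, k != i & k != j] -> [&& i != i0, j != i0 & k != i0] ->
    U k = U i + U j.
  move=> /and3P[ij ki kj] /and3P[ii ji kk]; apply/eqP; apply: contraT => /eqP ne.
  have := fixed_triple_unit (NU i) (NU j) (NU k) (indU _ _ ij ii ji) (U0 k kk).
  by rewrite (negbTE nuN); apply=> //; apply: neU.
have se : size (enum (predC1 i0)) = 6 by rewrite -cardE cardC1 card_ord.
have ue := enum_uniq (predC1 i0).
have me i : i \in enum (predC1 i0) -> i != i0 by rewrite mem_enum.
move: se ue me; case: (enum (predC1 i0)) => [//|i1 [//|i2 [//|i3 [//|i4 l]]]] _ /= ue me.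
have [h1 h2 h3 h4] : [/\ i1 != i0, i2 != i0, i3 != i0 & i4 != i0].
  by split; apply: me; rewrite !inE eqxx ?orbT.
move: ue; rewrite !inE !negb_or => /and4P[/and4P[n12 n13 n14 _] /and3P[n23 n24 _] /andP[n34 _] _].
have e3 : U i3 = U i1 + U i2.
  by apply: third; rewrite ?h1 ?h2 ?h3 // n12 ![_ == i1]eq_sym ![_ == i2]eq_sym n13 n23.
have e4 : U i4 = U i1 + U i2.
  by apply: third; rewrite ?h1 ?h2 ?h4 // n12 ![_ == i1]eq_sym ![_ == i2]eq_sym n14 n24.
by case: (neU i3 i4 n34 h3 h4); rewrite e3 e4.
Qed.

End SevenUnit.

(** * The Frobenius class of an ordinary quartic *)

Lemma invmx_mul (R : comUnitRingType) n (A B : 'M[R]_n) :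
  A \in unitmx -> B \in unitmx -> invmx (A *m B) = invmx B *m invmx A.
Proof.
move=> uA uB; have uAB : A *m B \in unitmx by rewrite unitmx_mul uA.
by rewrite -[RHS](mulmxK uAB) !mulmxA mulmxKV // mulVmx // mul1mx.
Qed.

Section ClosedGL3.
Variable L : closedFieldType.
Hypothesis char2 : 2%N \in [pchar L].
Implicit Types (R B K : 'M[L]_3) (d : L) (g h k : bmat).
Notation cvL := (cv L).
Notation cmL := (cm L).

Lemma det_GL3 h : h \in GL3 -> \det (cmL h) = 1.
Proof.
rewrite -(cm_unit char2) unitmxE unitfE => d0.
have : \det (cmL h) ^+ 2 = \det (cmL h).
  rewrite -[in RHS](@frobm_cm L 2 h isT).
  exact: esym (det_map_mx (pFrobenius_aut char2) (cmL h)).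
by rewrite -[RHS]mulr1 expr2 => /(mulfI d0).
Qed.

(** Since h^(2) = h and det h = 1, the new [N] is d h^T (h^T)^-1 = d. *)
Lemma qf_GL3 B d h : h \in GL3 ->
  exists B', forall x, qf B d%:M (cmL h *m x) = qf B' d%:M x.
Proof.
move=> Gh; exists ((sqm (cmL h))^T *m (B *m sqm (cmL h) + d%:M *m dprod (cmL h))) => x.
have uh : cmL h \in unitmx by rewrite cm_unit.
rewrite qf_mulmx //; congr qf; rewrite cofpE // det_GL3 // scale1r mul_mx_scalar.
rewrite [sqm _](@frobm_cm L 2 h isT) -scalemxAl mulmxV ?unitmx_tr //.
by rewrite scalemx1.
Qed.

Lemma cm_proportional g h c : g \in GL3 -> cmL g = c *: cmL h -> g = h /\ c = 1.
Proof.
move=> Gg e; suff c1 : c = 1 by split=> //; apply: (@cm_inj L); rewrite e c1 scale1r.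
have e' : cvL (bcol g o0) = c *: cvL (bcol h o0).
  by rewrite -!cm_col e; apply/matrixP=> i j; rewrite !mxE.
suff g0 : bcol g o0 != bvec0 by have [] := cv_proportional g0 e'.
rewrite -(cv_eq0 L) -cm_col; apply/eqP=> c0.
have ug : cmL g \in unitmx by rewrite cm_unit.
have /eqP : cmL g *m delta_mx o0 0 = 0 :> 'cV_3 by rewrite -colE.
rewrite unit_mulmx_eq0 // => /eqP/matrixP/(_ o0 0)/eqP.
by rewrite !mxE !eqxx oner_eq0.
Qed.

(** Comparing the two matrices [N] gives K = nu K^(2), so nu K is fixed by squaring. *)
Lemma qf_GL3_uniq B B' d d' K : d != 0 -> d' != 0 -> K \in unitmx ->
  (forall x, qf B d%:M x = qf B' d'%:M (K *m x)) ->
  exists2 h, h \in GL3 & exists2 mu, mu != 0 & K = mu *: cmL h.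
Proof.
move=> d0 d'0 uK e; have uKT : K^T \in unitmx by rewrite unitmx_tr.
have [|eN _] := @qf_inj L B d%:M ((sqm K)^T *m (B' *m sqm K + d'%:M *m dprod K))
                    ((sqm K)^T *m d'%:M *m cofp K).
  by move=> x; rewrite e qf_mulmx.
pose nu := d' * \det K / d.
have nu0 : nu != 0 by rewrite !mulf_neq0 ?invr_eq0 // -unitfE -unitmxE.
have KE : K = nu *: sqm K.
  apply: (can_inj (@trmxK _ _ _)); rewrite linearZ /=.
  have : d *: K^T = (d' * \det K) *: (sqm K)^T.
    rewrite -mul_scalar_mx eN cofpE // mul_mx_scalar -scalemxAr -scalemxAl scalerA.
    by rewrite -scalemxAl mulmxKV // mulrC.
  move=> /(congr1 (fun A => d^-1 *: A)); rewrite !scalerA mulVf // scale1r => ->.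
  by congr (_ *: _); rewrite /nu mulrC.
have [|h hE] := @sqm_fixed_cm L (nu *: K).
  by rewrite sqmZ {2}KE scalerA -expr2.
have uh : cmL h \in unitmx by rewrite -hE unitmxZ ?unitfE.
exists h; first by rewrite -(cm_unit char2).
by exists nu^-1; rewrite ?invr_eq0 // -hE scalerA mulVf // scale1r.
Qed.

End ClosedGL3.

Section FrobeniusType.
Variables (F : finFieldType) (L : closedFieldType) (iota : {rmorphism F -> L}).
Hypothesis char2F : 2%N \in [pchar F].
Variables (m q : nat).
Hypotheses (m_gt0 : (0 < m)%N) (qE : q = (2 ^ m)%N) (cardF : #|F| = q).
Implicit Types (f : quartic F) (R B K : 'M[L]_3) (d : L) (g h k : bmat).

Let char2 : 2%N \in [pchar L] := rmorph_pchar iota char2F.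
Let pn2 : [pchar L].-nat 2. Proof. by rewrite pnatE. Qed.
Notation cmL := (cm L).
Notation nf := (nf iota).

Lemma q_gt1 : (1 < q)%N.
Proof. by rewrite qE -{1}(expn0 2) ltn_exp2l. Qed.

Lemma pchar_q (E : fieldType) (c2 : 2%N \in [pchar E]) : [pchar E].-nat q.
Proof. by rewrite qE pnatX pnatE // c2. Qed.

Let pnq : [pchar L].-nat q := pchar_q char2.
Let pnqn n : [pchar L].-nat (q ^ n)%N. Proof. by rewrite pnatX pnq. Qed.
Let q_gt0 : (0 < q)%N := ltnW q_gt1.
Let qn_gt0 n : (0 < q ^ n)%N. Proof. by rewrite expn_gt0 q_gt0. Qed.

Lemma fixed_iota (x : L) : x ^+ q = x -> exists a, x = iota a.
Proof.
move=> xq; have [r [ur sr mr]] := @fixed_field_roots F L iota q (pchar_q char2F) q_gt1 1 isT.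
have xr : x \in r by rewrite mr expn1 xq.
have um : uniq (map iota (enum F)) by rewrite map_inj_uniq ?enum_uniq //; apply: fmorph_inj.
have sub : {subset map iota (enum F) <= r}.
  by move=> _ /mapP[a _ ->]; rewrite mr expn1 -rmorphXn -cardF expf_card.
have [|_ e] := uniq_min_size um sub; first by rewrite sr size_map -cardE cardF expn1.
by move: xr; rewrite -e => /mapP[a _ ->]; exists a.
Qed.

Lemma frobm_iota s t (A : 'M[F]_(s, t)) : frobm q (map_mx iota A) = map_mx iota A.
Proof. by apply/matrixP=> i j; rewrite !mxE -rmorphXn -cardF expf_card. Qed.

Lemma frobm_fixed (A : 'M[L]_3) : frobm q A = A -> exists A', A = map_mx iota A'.
Proof.
move=> /matrixP e; have h (ij : 'I_3 * 'I_3) : exists a, A ij.1 ij.2 = iota a.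
  by apply: fixed_iota; have := e ij.1 ij.2; rewrite mxE.
have [a aE] := fin_all_exists h.
by exists (\matrix_(i, j) a (i, j)); apply/matrixP=> i j; rewrite !mxE -aE.
Qed.

Definition typ g f := exists R B d, nf f R B d /\ R = cmL g *m frobm q R.

(** Lang's theorem is used here with exponent 2, for the matrix [Nm f] over F. Its solution
    satisfies R^(2) = R N^T, and N is fixed by the q-Frobenius, so the factor N^T cancels in the
    square of R (R^(q))^-1, which is therefore a matrix over F_2. *)
Lemma ord_typ f : ord_quartic iota f -> exists2 g, g \in GL3 & typ g f.
Proof.
move=> [_ /(seven_unit char2F) uN]; set N := map_mx iota (Nm f) in uN.
have uM : Nm f \in unitmx by rewrite -(map_unitmx iota).
have pn2F : [pchar F].-nat 2 by rewrite pnatE.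
have [P uP eP] := lang iota pn2F isT uM.
have [B [d [d0 e]]] := nf_exists char2 (map_mx iota (Bm f)) uP eP.
pose R := P^T; have uR : R \in unitmx by rewrite unitmx_tr.
have uRq : frobm q R \in unitmx by apply: frobm_unit.
have sR : sqm R = R *m N^T by rewrite /R -sqm_tr -[sqm P]/(frobm 2 P) eP trmx_mul.
have uNT : N^T \in unitmx by rewrite unitmx_tr.
have [|g gE] := @sqm_fixed_cm L (R *m invmx (frobm q R)).
  rewrite sqm_mulmx // [sqm (invmx _)]frobm_invmx // frobm_comp mulnC -frobm_comp.
  rewrite -[frobm 2 R]/(sqm R) sR frobm_mulmx // -[frobm q N^T]trmxK.
  rewrite (_ : (frobm q N^T)^T = N); last by rewrite /frobm -map_trmx trmxK; exact: frobm_iota.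
  by rewrite invmx_mul ?mulmxA ?mulmxK //.
have ug : cmL g \in unitmx by rewrite -gE unitmx_mul uR unitmx_inv.
exists g; first by rewrite -(cm_unit char2).
by exists R, B, d; split; [split|rewrite -gE mulmxKV].
Qed.

Lemma typ_conj g h k f : k \in GL3 -> bmul k g = bmul h k -> typ g f -> typ h f.
Proof.
move=> Gk e [R [B [d [[uR d0 ef] eR]]]].
have uk : cmL k \in unitmx by rewrite cm_unit.
have [k' Gk' [kk' k'k]] := GL3_inv Gk.
have [B' eB'] := qf_GL3 char2 B d Gk'.
exists (cmL k *m R), B', d; split; first split=> //; first by rewrite unitmx_mul uk.
  by move=> x; rewrite -eB' !mulmxA -cm_mul // k'k cm_bid mul1mx -ef.
rewrite frobm_mulmx // frobm_cm // {1}eR !mulmxA -!cm_mul // e.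
by [].
Qed.

Lemma typ_iso g f f' : isoF iota f f' -> typ g f -> typ g f'.
Proof.
move=> [A [l [uA l0 e]]] [R [B [d [[uR d0 ef] eR]]]].
exists (R *m map_mx iota A), (iota l *: B), (iota l * d); split.
  split; first by rewrite unitmx_mul uR map_unitmx.
    by rewrite mulf_neq0 // fmorph_eq0.
  move=> x; rewrite e ef mulmxA -scale_scalar_mx /qf.
  by rewrite -!scalemxAr -!scalemxAl -scalerDr [RHS]mxE.
by rewrite {1}eR frobm_mulmx // frobm_iota !mulmxA.
Qed.

(** The two frames differ by mu h with h over F_2. Comparing their Frobenius equations makes h g and
    g' h proportional, and proportional invertible matrices over F_2 are equal. *)
Lemma nf_uniq f R B d R' B' d' g g' :
  nf f R B d -> R = cmL g *m frobm q R -> g \in GL3 ->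
  nf f R' B' d' -> R' = cmL g' *m frobm q R' -> g' \in GL3 ->
  exists h mu, [/\ h \in GL3, mu != 0, R' = mu *: (cmL h *m R) & bmul h g = bmul g' h].
Proof.
move=> [uR d0 ef] eR Gg [uR' d'0 ef'] eR' Gg'.
have uK : R' *m invmx R \in unitmx by rewrite unitmx_mul uR' unitmx_inv.
have [|h Gh [mu mu0 hE]] := qf_GL3_uniq char2 (B := B) (B' := B') d0 d'0 uK.
  by move=> y; rewrite -[in LHS](mulKVmx uR y) -ef ef' mulmxA.
have R'E : R' = mu *: (cmL h *m R).
  by rewrite scalemxAl -hE mulmxKV.
exists h, mu; split=> //.
have uRq : frobm q R \in unitmx by apply: frobm_unit.
have Ghg : bmul h g \in GL3.
  by rewrite -(cm_unit char2) cm_mul // unitmx_mul !cm_unit // Gh.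
have e1 : R' = mu *: (cmL (bmul h g) *m frobm q R).
  by rewrite cm_mul // -mulmxA -eR.
have frZ (A : 'M[L]_3) : frobm q (mu *: A) = mu ^+ q *: frobm q A.
  by apply/matrixP=> i j; rewrite !mxE exprMn.
have e2 : R' = mu ^+ q *: (cmL (bmul g' h) *m frobm q R).
  by rewrite {1}eR' R'E frZ frobm_mulmx // frobm_cm // cm_mul // -scalemxAr mulmxA.
have eM : cmL (bmul h g) *m frobm q R = (mu ^+ q / mu) *: cmL (bmul g' h) *m frobm q R.
  have -> : cmL (bmul h g) *m frobm q R = mu^-1 *: R'.
    by rewrite e1 scalerA mulVf // scale1r.
  by rewrite e2 scalerA mulrC -scalemxAl.
have [|-> //] := @cm_proportional L char2 (bmul h g) (bmul g' h) (mu ^+ q / mu) Ghg.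
by rewrite -[LHS](mulmxK uRq) eM mulmxK.
Qed.

End FrobeniusType.

(** * Fields of definition and concurrency of the bitangents *)

Lemma brow_id g : (forall p, brow p g = p) -> g = bid.
Proof.
move=> h; have := h (true, false, false); have := h (false, true, false).
have := h (false, false, true); move: {h} g.
by move=> [[[[a b] c] [[a' b'] c']] [[x y] z]]; rewrite /brow /bdot /= ?addbF;
  case=> -> -> -> [-> -> ->] [-> -> ->].
Qed.

Lemma brow_bid p : brow p bid = p.
Proof. by case: p => [[[] []] []]. Qed.

Definition conc (i j : nat) (g : bmat) : bool :=
  has (fun p => ~~ bdet p (brow p (bexp g i)) (brow p (bexp g j))) bvecs1.

Definition bdeg (g : bmat) (n : nat) : bool :=
  (bexp g n == bid) && all (fun e => bexp g e != bid) (iota 1 n.-1).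

Section Degree.
Variables (F : finFieldType) (L : closedFieldType) (iota : {rmorphism F -> L}).
Hypothesis char2F : 2%N \in [pchar F].
Variables (m q : nat).
Hypotheses (m_gt0 : (0 < m)%N) (qE : q = (2 ^ m)%N) (cardF : #|F| = q).
Implicit Types (f : quartic F) (R B K : 'M[L]_3) (d : L) (g h k : bmat).

Let char2 : 2%N \in [pchar L] := rmorph_pchar iota char2F.
Notation cvL := (cv L).
Notation cmL := (cm L).
Notation nf := (nf iota).

Let pnq : [pchar L].-nat q := pchar_q qE char2.
Let pnqn n : [pchar L].-nat (q ^ n)%N. Proof. by rewrite pnatX pnq. Qed.
Let qn_gt0 n : (0 < q ^ n)%N. Proof. by rewrite expn_gt0 qE expn_gt0. Qed.

Lemma frobm_pow g R n : R = cmL g *m frobm q R -> R = cmL (bexp g n) *m frobm (q ^ n) R.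
Proof.
move=> eR; elim: n => [|n IHn]; first by rewrite cm_bid mul1mx frobm1.
rewrite {1}eR {1}IHn frobm_mulmx // frobm_cm ?qE ?expn_gt0 // frobm_comp -qE -expnSr.
by rewrite mulmxA -cm_mul.
Qed.

(** The Frobenius acts on lines, seen as row vectors over F_2, through the inverse of g. *)
Lemma line_frob g R n p : R = cmL g *m frobm q R ->
  R^T *m cvL p = frobm (q ^ n) (R^T *m cvL (brow p (bexp g n))).
Proof.
move=> /(frobm_pow n) eR; rewrite frobm_mulmx // frobm_cv // /frobm -map_trmx.
by rewrite -[LHS]trmxK trmx_mul trmxK {1}eR mulmxA cv_row // trmx_mul trmxK.
Qed.

(** The line of p is defined over the field with q^n elements iff its n-th Frobenius image is
    proportional to it, that is, iff p g^n = p. *)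
Lemma nf_all_over f R B d g n : nf f R B d -> R = cmL g *m frobm q R ->
  all_bitangents_over iota q f n <-> bexp g n = bid.
Proof.
move=> nfR eR; have [uR d0 _] := nfR; have uRT : R^T \in unitmx by rewrite unitmx_tr.
split=> [all_over|gn v /(nf_bitangent char2F _ nfR)[p [c [p0 c0 e]]]].
  apply: brow_id => p; have [->|p0] := eqVneq p bvec0.
    by case: (bexp g n) => [[[[? ?] ?] [[? ?] ?]] [[? ?] ?]].
  set l := R^T *m cvL p.
  have /all_over[w [/proportionalP[c c0]]] : bitangent iota f (cfun l).
    by apply/(nf_bitangent char2F _ nfR); exists p, 1; rewrite col_cfun scale1r oner_eq0.
  rewrite col_cfun => lE wq.
  have e : frobm (q ^ n) l = c ^+ (q ^ n) / c *: l.
    rewrite lE scalerA divfK //; apply/matrixP=> i j; rewrite !mxE exprMn wq //.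
  have uF : frobm (q ^ n) R^T \in unitmx by apply: frobm_unit.
  have {}e : frobm (q ^ n) R^T *m cvL p =
      frobm (q ^ n) R^T *m (c ^+ (q ^ n) / c *: cvL (brow p (bexp g n))).
    have fr r : frobm (q ^ n) R^T *m cvL r = frobm (q ^ n) (R^T *m cvL r).
      by rewrite frobm_mulmx // frobm_cv.
    by rewrite -scalemxAr !fr -(line_frob n p eR) -e.
  by have [] := cv_proportional p0 (unit_mulmx_inj uF e).
exists (cfun (R^T *m cvL p)); split; first by apply/proportionalP; exists c; rewrite // col_cfun.
move=> i; have := congr1 (fun x : 'cV[L]_3 => x i 0) (line_frob n p eR).
by rewrite gn brow_bid [in X in _ = X -> _]mxE /cfun => <-.
Qed.

Lemma concurrent_lines R p1 p2 p3 (u v w : 'I_3 -> L) c1 c2 c3 : R \in unitmx ->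
  \col_i u i = c1 *: (R^T *m cvL p1) -> \col_i v i = c2 *: (R^T *m cvL p2) ->
  \col_i w i = c3 *: (R^T *m cvL p3) -> c1 != 0 -> c2 != 0 -> c3 != 0 ->
  concurrent u v w <-> ~~ bdet p1 p2 p3.
Proof.
move=> uR eu ev ew c10 c20 c30; rewrite /concurrent.
pose C : 'M[L]_3 := \matrix_(i, j) (bget (nth p1 [:: p1; p2; p3] i) j)%:R.
have -> : \matrix_(i < 3, j < 3) nth u [:: u; v; w] i j =
    diag_mx (\row_i nth c1 [:: c1; c2; c3] i) *m (C *m R).
  apply/matrixP=> i j; rewrite mul_diag_mx !mxE.
  have eu' : u j = c1 * \sum_k (bget p1 k)%:R * R k j.
    have := congr1 (fun x : 'cV[L]_3 => x j 0) eu; rewrite !mxE => ->; congr (_ * _).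
    by apply: eq_bigr => k _; rewrite !mxE mulrC.
  have ev' : v j = c2 * \sum_k (bget p2 k)%:R * R k j.
    have := congr1 (fun x : 'cV[L]_3 => x j 0) ev; rewrite !mxE => ->; congr (_ * _).
    by apply: eq_bigr => k _; rewrite !mxE mulrC.
  have ew' : w j = c3 * \sum_k (bget p3 k)%:R * R k j.
    have := congr1 (fun x : 'cV[L]_3 => x j 0) ew; rewrite !mxE => ->; congr (_ * _).
    by apply: eq_bigr => k _; rewrite !mxE mulrC.
  by elim/ord3_ind: i => /=; rewrite ?eu' ?ev' ?ew'; congr (_ * _);
    apply: eq_bigr => k _; rewrite !mxE.
have detC : \det C = (bdet p1 p2 p3)%:R.
  rewrite det3E !mxE /= ?(oppr_pchar2 char2) /bdet !(natr_addb char2, natr_andb) /bget /=.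
  by [].
rewrite !det_mulmx det_diag detC !mulrA.
have D0 : \prod_(i < 3) (\row_(i < 3) nth c1 [:: c1; c2; c3] i) 0 i != 0.
  by rewrite !big_ord_recl big_ord0 !mxE /= !mulf_neq0 ?oner_eq0.
have dR : \det R != 0 by rewrite -unitfE -unitmxE.
split=> [/eqP|/negbTE->]; last by rewrite mulr0 mul0r.
rewrite !mulf_eq0 (negbTE dR) orbF (negbTE D0) /=.
by case: bdet; rewrite ?oner_eq0.
Qed.

Lemma bexpD g i j : bmul (bexp g i) (bexp g j) = bexp g (i + j).
Proof.
apply: (@cm_inj L); elim: i => [|i IHi]; first by rewrite cm_mul // cm_bid mul1mx.
by rewrite addSn /= !cm_mul // -mulmxA -cm_mul // IHi.
Qed.

Lemma brow_mul p g h : brow (brow p g) h = brow p (bmul g h).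
Proof.
apply: (@cv_inj L); apply: (can_inj (@trmxK _ _ _)).
by rewrite -!cv_row // cm_mul // mulmxA.
Qed.

(** The a-th Frobenius power sends the line p to p g^(-a), and g^7 = 1 turns the exponent into 7 -
    a. *)
Lemma nf_concurrent f R B d g a b : nf f R B d -> R = cmL g *m frobm q R ->
  bexp g 7 = bid -> (a <= 7)%N -> (b <= 7)%N ->
  (exists v, bitangent iota f v /\ concurrent v (frob q a v) (frob q b v)) <->
  conc (7 - a) (7 - b) g.
Proof.
move=> nfR eR g7 a7 b7; have [uR d0 _] := nfR.
have fr p c n v : (n <= 7)%N -> \col_i v i = c *: (R^T *m cvL p) ->
    \col_i frob q n v i = c ^+ (q ^ n) *: (R^T *m cvL (brow p (bexp g (7 - n)))).
  move=> n7 ev; rewrite (line_frob n _ eR) brow_mul bexpD subnK // g7 brow_bid.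
  have /matrixP e : frobm (q ^ n) (\col_i v i) = frobm (q ^ n) (c *: (R^T *m cvL p)) by rewrite ev.
  apply/matrixP=> i j; have := e i 0; rewrite (ord1 j) {e ev}.
  by move: (R^T *m cvL p) => x; rewrite !mxE /frob => ->; rewrite exprMn.
split=> [[v [/(nf_bitangent char2F _ nfR)[p [c [p0 c0 ev]]] cc]]|/hasP[p pp cp]].
  apply/hasP; exists p; first by rewrite mem_bvecs1.
  by apply/(concurrent_lines uR ev (fr _ _ _ _ a7 ev) (fr _ _ _ _ b7 ev)); rewrite ?expf_neq0.
exists (cfun (R^T *m cvL p)).
have ev : \col_i cfun (R^T *m cvL p) i = 1 *: (R^T *m cvL p) by rewrite col_cfun scale1r.
split; first by apply/(nf_bitangent char2F _ nfR); exists p, 1; rewrite -mem_bvecs1 oner_eq0.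
by apply/(concurrent_lines uR ev (fr _ _ _ _ a7 ev) (fr _ _ _ _ b7 ev)); rewrite ?expf_neq0 ?oner_eq0.
Qed.

End Degree.

(** * Standard forms and their values at the Fano points *)

Lemma qf_sqm (R : comNzRingType) (char2 : 2%N \in [pchar R]) (B N : 'M[R]_3) x :
  qf (sqm B) (sqm N) (sqm x) = (qf B N x) ^+ 2.
Proof. exact: esym (qf_map (pFrobenius_aut char2) B N x). Qed.

Lemma qf_frobm (R : comNzRingType) (char2 : 2%N \in [pchar R]) (B N : 'M[R]_3) x m :
  qf (frobm (2 ^ m) B) (frobm (2 ^ m) N) (frobm (2 ^ m) x) = (qf B N x) ^+ (2 ^ m).
Proof.
elim: m => [|m IHm]; first by rewrite !frobm1 expr1.
by rewrite expnSr -!frobm_comp exprM -IHm -qf_sqm.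
Qed.

Section PointValues.
Variable L : closedFieldType.
Hypothesis char2 : 2%N \in [pchar L].
Implicit Types (B : 'M[L]_3) (d : L).
Let add2 (z : L) : z + z = 0. Proof. exact: addrr_pchar2. Qed.

Definition tval B d (p : bvec) : L := qf B d%:M (cv L p).

Lemma qf_scalarE B d x : qf B d%:M x =
  \sum_i \sum_j (B i j * (x i 0 ^+ 2 * x j 0 ^+ 2))
  + d * (x o0 0 * x o1 0 * x o2 0 * (x o0 0 + x o1 0 + x o2 0)).
Proof. by rewrite qfE !sum3E !mxE /= ?mulr1n ?mulr0n; ring. Qed.

Lemma sum_bvecs (V : nmodType) (t : bvec -> V) : \sum_(p <- bvecs) t p =
  t (false, false, false) + t (false, false, true) + t (false, true, false)
  + t (false, true, true) + t (true, false, false) + t (true, false, true)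
  + t (true, true, false) + t (true, true, true).
Proof. by rewrite /bvecs /= !big_cons big_nil !addrA addr0. Qed.

Lemma tvalE B d p : tval B d p =
  \sum_i \sum_j (B i j * ((bget p i)%:R * (bget p j)%:R))
  + d * ((bget p o0)%:R * (bget p o1)%:R * (bget p o2)%:R
         * ((bget p o0)%:R + (bget p o1)%:R + (bget p o2)%:R)).
Proof.
rewrite /tval qf_scalarE; congr (_ + _); last by rewrite !mxE.
have sqb (b : bool) : b%:R ^+ 2 = b%:R :> L by case: b; rewrite ?expr1n ?expr0n.
by apply: eq_bigr => i _; apply: eq_bigr => j _; rewrite !mxE !sqb.
Qed.

Lemma tval0 B d : tval B d bvec0 = 0.
Proof. by rewrite tvalE !sum3E /bget /=; ring. Qed.

(** On F_2^3 the part in [B] has degree at most 2, so it sums to 0 over the eight points, while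
    xyz(x+y+z) is nonzero only at (1, 1, 1). *)
Lemma tval_sum B d : \sum_(p <- bvecs) tval B d p = d.
Proof.
rewrite sum_bvecs !tvalE !sum3E /bget /=.
set s0 := B o0 o0; set s1 := B o1 o1; set s2 := B o2 o2.
set s3 := B o0 o1; set s4 := B o1 o0; set s5 := B o0 o2.
set s6 := B o2 o0; set s7 := B o1 o2; set s8 := B o2 o1.
rewrite -[RHS]addr0 -(add2 (d + s0 + s0 + s1 + s1 + s2 + s2 + s3 + s4 + s5 + s6 + s7 + s8)).
ring.
Qed.

Definition bunit (i : 'I_3) : bvec := bcol bid i.

(** Interpolation by polarization: a quadratic form is recovered from its values at the unit vectors
    and at their pairwise sums. *)
Definition tmat (t : bvec -> L) : 'M[L]_3 := \matrix_(i, j)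
  if i == j then t (bunit i) else if (i < j)%N then
    t (baddv (bunit i) (bunit j)) - t (bunit i) - t (bunit j) else 0.

Lemma utri_tval B d : utri B = tmat (tval B d).
Proof.
by apply/matrixP; elim/ord3_ind; elim/ord3_ind;
  rewrite !mxE /= ?tvalE ?sum3E /bget /=; ring.
Qed.

Lemma tval_inj B B' d : (forall p, tval B d p = tval B' d p) ->
  forall x, qf B d%:M x = qf B' d%:M x.
Proof.
move=> e x; have eB : utri B = utri B'.
  by rewrite (utri_tval B d) (utri_tval B' d); apply/matrixP=> i j; rewrite !mxE !e.
by rewrite -[LHS]qf_utri eB qf_utri.
Qed.

Lemma tval_tmat (t : bvec -> L) d : t bvec0 = 0 -> \sum_(p <- bvecs) t p = d ->
  forall p, tval (tmat t) d p = t p.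
Proof.
(* The six coefficients match six of the values; the seventh, at (1, 1, 1), is forced by the sum. *)
move=> t0 ts; have tE : t (true, true, true) = d + t (false, false, true)
    + t (false, true, false) + t (false, true, true) + t (true, false, false)
    + t (true, false, true) + t (true, true, false).
  rewrite -ts sum_bvecs; set s := t (true, true, true).
  rewrite [t (false, false, false)]t0.
  set s1 := t (false, false, true); set s2 := t (false, true, false).
  set s3 := t (false, true, true); set s4 := t (true, false, false).
  set s5 := t (true, false, true); set s6 := t (true, true, false).
  rewrite -[LHS]addr0 -[X in s + X](add2 (s1 + s2 + s3 + s4 + s5 + s6)); ring.
case=> [[[] []] []]; rewrite tvalE !sum3E !mxE /bget /= ?t0 ?tE; try ring.
set s1 := t (false, false, true); set s2 := t (false, true, false).
set s3 := t (false, true, true); set s4 := t (true, false, false).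
set s5 := t (true, false, true); set s6 := t (true, true, false).
by rewrite -[RHS]addr0 -[X in _ = _ + X](add2 (d - s1 - s2 - s4)); ring.
Qed.
End PointValues.

Section StandardForm.
Variables (F : finFieldType) (L : closedFieldType) (iota : {rmorphism F -> L}).
Hypothesis char2F : 2%N \in [pchar F].
Variables (m q : nat).
Hypotheses (m_gt0 : (0 < m)%N) (qE : q = (2 ^ m)%N) (cardF : #|F| = q).
Implicit Types (f : quartic F) (R B K : 'M[L]_3) (d : L) (g h k : bmat).

Let char2 : 2%N \in [pchar L] := rmorph_pchar iota char2F.
Notation cvL := (cv L).
Notation cmL := (cm L).
Notation nf := (nf iota).
Notation qev := (qev iota).

Let pnq : [pchar L].-nat q := pchar_q qE char2.
Let q_gt0 : (0 < q)%N. Proof. by rewrite qE expn_gt0. Qed.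

Lemma qf_frobq B N x : qf (frobm q B) (frobm q N) (frobm q x) = (qf B N x) ^+ q.
Proof. by rewrite qE qf_frobm. Qed.

Lemma qev_frob f x : qev f (frobm q x) = qev f x ^+ q.
Proof. by rewrite !qevE -qf_frobq !(frobm_iota iota cardF). Qed.

Lemma frobm_surj (n : nat) (x : 'cV[L]_n) : exists y, frobm q y = x.
Proof.
have h (i : 'I_n) : exists b, b ^+ q = x i 0.
  have [b] := @solve_monicpoly L q (fun j => if j == 0%N then x i 0 else 0) q_gt0.
  rewrite -(prednK q_gt0) big_ord_recl /= expr0 mulr1 big1 ?addr0 => [e|k _]; last by rewrite mul0r.
  by exists b.
have [y yP] := fin_all_exists h.
by exists (\col_i y i); apply/matrixP=> i j; rewrite !mxE (ord1 j).
Qed.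

Definition std R (t : bvec -> L) f := exists B,
  (forall p, tval B 1 p = t p) /\ forall x, qev f x = qf B 1%:M (R *m x).

(** Membership in X_g, with t extended by 0 to the zero vector. *)
Definition admissible g (t : bvec -> L) :=
  [/\ forall p, (t p == 0) = (p == bvec0), \sum_(p <- bvecs) t p = 1
    & forall p, t (bapp g p) = t p ^+ q].

Section FixedFrame.
Variables (R : 'M[L]_3) (g : bmat).
Hypotheses (uR : R \in unitmx) (eR : R = cmL g *m frobm q R) (Gg : g \in GL3).

Lemma std_nf t f : std R t f -> exists2 B, (forall p, tval B 1 p = t p) & nf f R B 1.
Proof. by move=> [B [Bt e]]; exists B => //; split; rewrite ?oner_eq0. Qed.

(** Galois descent: the equivariance of t under g compensates for R = g R^(q), so the form with
    values t, pulled back along R, commutes with the Frobenius and has coefficients in F. *)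
Lemma std_exists t : admissible g t -> exists f, std R t f.
Proof.
move=> [t0 ts tg]; pose B := tmat t.
have Bt p : tval B 1 p = t p by rewrite tval_tmat //; apply/eqP; rewrite t0.
have [B' [N' e]] : exists B' N', forall x, qf B 1%:M (R *m x) = qf B' N' x.
  exists ((sqm R)^T *m (B *m sqm R + 1%:M *m dprod R)), ((sqm R)^T *m 1%:M *m cofp R).
  by move=> x; rewrite qf_mulmx.
have eg y : qf (frobm q B) 1%:M y = qf B 1%:M (cmL g *m y).
  have [B2 eB2] := qf_GL3 char2 B 1 Gg; rewrite eB2; apply: tval_inj => // p.
  rewrite /tval -eB2 -cv_app // -[RHS]/(tval B 1 (bapp g p)) Bt tg -Bt /tval.
  by rewrite -qf_frobq frobm_cv // frobm_scalar ?expr1n.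
(* The function determines [B'] only up to [utri], so the Frobenius invariance is proved for that
   representative. *)
have eqN x : qf (frobm q (utri B')) (frobm q N') x = qf (utri B') N' x.
  have [x0 <-] := frobm_surj x.
  rewrite qf_frobq !qf_utri -!e -qf_frobq frobm_scalar // expr1n eg frobm_mulmx //.
  by rewrite mulmxA -eR.
have [eN eB] := qf_inj eqN.
have eB' : frobm q (utri B') = utri B'.
  have ut (A : 'M[L]_3) : utri (utri A) = utri A.
    by apply/matrixP; elim/ord3_ind; elim/ord3_ind; rewrite !mxE /= ?addr0.
  have uf (A : 'M[L]_3) : utri (frobm q (utri A)) = frobm q (utri A).
    by apply/matrixP; elim/ord3_ind; elim/ord3_ind; rewrite !mxE /= ?expr0n ?gtn_eqF ?addr0.
  by rewrite -uf eB ut.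
have [N0 N0E] := frobm_fixed iota char2F m_gt0 qE cardF eN.
have [B0 B0E] := frobm_fixed iota char2F m_gt0 qE cardF eB'.
exists (mkq B0 N0), B; split=> // x.
by rewrite qev_mkq -B0E -N0E qf_utri -e.
Qed.

Lemma std_admissible t f : std R t f -> (forall p, p != bvec0 -> t p != 0) ->
  admissible g t.
Proof.
move=> [B [Bt e]] tn0; split=> [p||p].
- apply/idP/idP=> [|/eqP->]; last by rewrite -Bt tval0.
  by apply: contraLR => /tn0.
- rewrite -(tval_sum char2 B 1); apply: eq_bigr => p _; rewrite Bt //.
pose x := invmx R *m cvL p.
have Rx : R *m x = cvL p by rewrite mulKVmx.
rewrite -!Bt /tval -Rx -e -qev_frob e; congr (qf _ _ _).
rewrite cv_app // -Rx {2}eR -mulmxA -frobm_mulmx // Rx.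
by rewrite frobm_cv.
Qed.

Lemma std_iso t t' f f' : std R t f -> std R t' f' -> isoF iota f f' ->
  exists h, [/\ h \in GL3, bmul h g = bmul g h & forall p, t' p = t (bapp h p)].
Proof.
move=> [B [Bt e]] [B' [Bt' e']] [A [l [uA l0 eA]]].
have il0 : iota l != 0 by rewrite fmorph_eq0.
have eRA x : qev f' x = iota l * qf B 1%:M (R *m map_mx iota A *m x) by rewrite eA e mulmxA.
have qfZ' c d B1 x : c * qf B1 d%:M x = qf (c *: B1) (c * d)%:M x.
  by rewrite !qf_scalarE !sum3E !mxE; ring.
have nf1 : nf f' (R *m map_mx iota A) (iota l *: B) (iota l * 1).
  split; first by rewrite unitmx_mul uR map_unitmx.
    by rewrite mulr1.
  by move=> x; rewrite eRA qfZ'.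
have nf2 : nf f' R B' 1 by split; rewrite ?oner_eq0.
have eRA2 : R *m map_mx iota A = cmL g *m frobm q (R *m map_mx iota A).
  by rewrite {1}eR frobm_mulmx // (frobm_iota iota cardF) !mulmxA.
have [h [mu [Gh mu0 hE hg]]] := nf_uniq char2F m_gt0 qE nf2 eR Gg nf1 eRA2 Gg.
exists h; split=> //.
have [B2 eB2] := qf_GL3 char2 B 1 Gh.
(* The factor by which the two standard forms differ: l from the isomorphism and mu^4 from the
   homogeneity of a quartic. Both have d = 1, which forces c = 1. *)
pose c := iota l * mu ^+ 4.
have e3 y : qf B' 1%:M y = qf (c *: B2) (c * 1)%:M y.
  rewrite -qfZ' -eB2 -[in LHS](mulKVmx uR y) -e' eRA hE -scalemxAl qfZ -[in LHS]mulmxA mulKVmx //.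
  by rewrite mulrA.
have [/matrixP/(_ o0 o0) + _] := qf_inj e3; rewrite !mxE /= !mulr1n mulr1 => c1.
move=> p; rewrite -Bt' -Bt /tval e3 -c1 scale1r mulr1 cv_app // -eB2 //.
Qed.

(** R^-1 h R is fixed by the Frobenius because h commutes with g, so it is a change of coordinates
    over F. *)
Lemma std_conj t t' f f' h : std R t f -> std R t' f' -> h \in GL3 ->
  bmul h g = bmul g h -> (forall p, t' p = t (bapp h p)) -> isoF iota f f'.
Proof.
move=> [B [Bt e]] [B' [Bt' e']] Gh hg th.
have uh : cmL h \in unitmx by rewrite cm_unit.
have ug : cmL g \in unitmx by rewrite cm_unit.
have uRq : frobm q R \in unitmx by apply: frobm_unit.
have [|A AE] := frobm_fixed iota char2F m_gt0 qE cardF (A := invmx R *m (cmL h *m R)).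
  rewrite !frobm_mulmx // frobm_cm // frobm_invmx // {4}eR {3}eR invmx_mul //.
  rewrite -!mulmxA; congr (_ *m _); rewrite [cmL h *m (cmL g *m _)]mulmxA -cm_mul // hg cm_mul //.
  by rewrite -mulmxA mulKmx.
have uA : A \in unitmx.
  by rewrite -(map_unitmx iota) -AE !unitmx_mul unitmx_inv uR uh.
exists A, 1; split; rewrite ?oner_eq0 // => x.
rewrite rmorph1 mul1r e e' -AE mulmxA mulKVmx // -[in RHS]mulmxA.
have [B2 eB2] := qf_GL3 char2 B 1 Gh; rewrite eB2; apply: tval_inj => // p.
by rewrite Bt' th -Bt /tval cv_app.
Qed.

(** The frame R1 of f and the chosen frame R satisfy the same Frobenius equation, so R1^-1 R is
    defined over F. The scalar d also lies in F, and dividing by it normalises the form. *)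
Lemma std_cover f : nonsingular iota f -> typ iota q g f ->
  exists t f', [/\ std R t f', isoF iota f f' & admissible g t].
Proof.
move=> ns [R1 [B [d [nf1 eR1]]]]; have [uR1 d0 e] := nf1.
have ug : cmL g \in unitmx by rewrite cm_unit.
have uRq : frobm q R1 \in unitmx by apply: frobm_unit.
have [|A AE] := frobm_fixed iota char2F m_gt0 qE cardF (A := invmx R1 *m R).
  rewrite !frobm_mulmx // frobm_invmx // {2}eR1 {2}eR invmx_mul //.
  by rewrite -mulmxA mulKmx.
have uA : A \in unitmx by rewrite -(map_unitmx iota) -AE unitmx_mul unitmx_inv uR1.
have [d' dE] : exists d' : F, d = iota d'.
  apply: (fixed_iota iota char2F m_gt0 qE cardF).
  have [B2 eB2] := qf_GL3 char2 B d Gg.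
  have e2 y : qf (frobm q B) (d ^+ q)%:M y = qf B2 d%:M y.
    have uRR := uRq; rewrite -(mulKVmx uRq y); have [x0 <-] := frobm_surj (invmx (frobm q R1) *m y).
    rewrite -frobm_mulmx // -frobm_scalar // qf_frobq -e -qev_frob e {1}eR1 -mulmxA eB2.
    by rewrite frobm_mulmx.
  by have [/matrixP/(_ o0 o0) + _] := qf_inj e2; rewrite !mxE /= !mulr1n.
have d'0 : d'^-1 != 0 by rewrite invr_eq0 -(fmorph_eq0 iota) -dE.
have [f' [_ ef']] := qsubst_quartic iota char2F f A d'^-1.
have iso1 : isoF iota f f' by exists A, d'^-1.
have ef x : qev f' x = qf (d^-1 *: B) 1%:M (R *m x).
  rewrite ef' e -AE mulmxA mulKVmx // fmorphV -dE !qf_scalarE !sum3E !mxE.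
  by rewrite -[in RHS](mulVf d0); ring.
have st : std R (tval (d^-1 *: B) 1) f' by exists (d^-1 *: B).
exists (tval (d^-1 *: B) 1), f'; split=> //; apply: (std_admissible st) => p p0.
rewrite (_ : tval _ _ _ = d^-1 * tval B d p).
  rewrite mulf_neq0 ?invr_eq0 //.
  by have [tp _] := nf_nonsingular char2F nf1; apply: tp.
by rewrite !tvalE !sum3E !mxE -(mulVf d0); ring.
Qed.

End FixedFrame.
End StandardForm.

(** * Burnside's lemma and orbit data *)

(** Elements of GL_3(F_2) have order at most 7, so eight iterates list the whole <h>-orbit, with
    repetitions. *)
Definition hcoset (h : bmat) (p : bvec) : seq bvec := [seq iter b (bapp h) p | b <- iota 0 8].

(* Least n > 0 for which g^n p lies in the <h>-orbit of p. *)
Definition period (g h : bmat) (p : bvec) : nat :=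
  (find (fun n => iter n (bapp g) p \in hcoset h p) (iota 1 7)).+1.

Definition orbit_points (g h : bmat) (pn : bvec * nat) : seq bvec :=
  flatten [seq [seq iter a (bapp g) r | r <- hcoset h pn.1] | a <- iota 0 pn.2].

Definition orbits (g h : bmat) : seq (bvec * nat) :=
  foldl (fun acc p => if p \in flatten [seq orbit_points g h x | x <- acc] then acc
                      else rcons acc (p, period g h p)) [::] bvecs1.

(* [loc p = (i, a)] when p = g^a h^b r with r the i-th orbit representative. *)
Definition loc (g h : bmat) (d : seq (bvec * nat)) (p : bvec) : nat * nat :=
  head (0, 0)%N [seq ia <- flatten [seq [seq (i, a) | a <- iota 0 (nth (bvec0, 0%N) d i).2] | i <- iota 0 (size d)]
     | has (fun r => iter ia.2 (bapp g) r == p) (hcoset h (nth (bvec0, 0%N) d ia.1).1)].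

Definition locs (g h : bmat) (d : seq (bvec * nat)) := [seq loc g h d p | p <- bvecs].
Definition locl (l : seq (nat * nat)) (p : bvec) := nth (0,0)%N l (index p bvecs).

(** The conjugate s_i^(q^a) is the value of t at every point located at (i, a). In characteristic 2
    only the parity of the number of such points matters, and [orbits_ok] checks that it does not
    depend on a. *)
Definition oparity (l : seq (nat * nat)) (i : nat) : bool :=
  odd (count (fun p => locl l p == (i, 0%N)) bvecs1).

Definition odata (g h : bmat) : seq (nat * bool) :=
  let d := orbits g h in let l := locs g h d in
  [seq ((nth (bvec0, 0%N) d i).2, oparity l i) | i <- iota 0 (size d)].

Definition centralizer (g : bmat) : seq bmat := [seq h <- GL3 | bmul h g == bmul g h].

(** Representatives of the six conjugacy classes, of orders 1, 2, 3, 4, 7, 7. The last two are the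
    companion matrices of x^3 + x^2 + 1 and x^3 + x + 1. *)
Definition g1 : bmat := bid.
Definition g2 : bmat := ((true, false, false), (true, true, false), (false, false, true)).
Definition g3 : bmat := ((false, true, false), (false, false, true), (true, false, false)).
Definition g4 : bmat := ((true, false, false), (true, true, false), (false, true, true)).
Definition g70 : bmat := ((false, true, false), (false, false, true), (true, false, true)).
Definition g71 : bmat := ((false, true, false), (false, false, true), (true, true, false)).


(** A certificate: everything the count uses about the orbits of a pair (g, h), checked by
    evaluation for each pair that occurs. *)
Definition orbits_ok (g h : bmat) : bool :=
  let d := orbits g h in let l := locs g h d in
  let rep i := (nth (bvec0, 0%N) d i).1 in let per i := (nth (bvec0, 0%N) d i).2 in
  all (fun p => let ia := locl l p in
    [&& (ia.1 < size d)%N, (ia.2 < per ia.1)%N,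
        has (fun r => p == iter ia.2 (bapp g) r) (hcoset h (rep ia.1)),
        locl l (bapp h p) == ia &
        locl l (bapp g p) == (ia.1, if ia.2.+1 == per ia.1 then 0%N else ia.2.+1)]) bvecs1
  && all (fun i => [&& rep i != bvec0, locl l (rep i) == (i, 0%N), (0 < per i < 8)%N,
        iter (per i) (bapp g) (rep i) \in hcoset h (rep i) &
        all (fun a => odd (count (fun p => locl l p == (i, a)) bvecs1) == oparity l i)
            (iota 0 (per i))]) (iota 0 (size d)).

Definition reps := [:: g1; g2; g3; g4; g70; g71].

Lemma reps_orbits_ok g h : g \in reps -> h \in centralizer g -> orbits_ok g h.
Proof.
have: all (fun g => all (orbits_ok g) (centralizer g)) reps by vm_compute.
by move=> /allP H /H /allP; apply.
Qed.

Lemma count_sum (A : Type) (a : pred A) s : count a s = (\sum_(y <- s) a y)%N.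
Proof. by elim: s => [|y s IHs]; [rewrite big_nil | rewrite big_cons -IHs]. Qed.

(** Stated for lists because the set acted upon consists of functions with values in the infinite
    field L. The induction peels off the orbit of the first element; the elements of the group that
    fix points of this orbit number size C in all. *)
Lemma burnside (T G : eqType) (C : seq G) (act : G -> T -> T) (mul : G -> G -> G)
    (inv : G -> G) (X : seq T) :
  uniq C -> (forall h k, h \in C -> k \in C -> mul h k \in C) ->
  (forall h, h \in C -> inv h \in C) ->
  {in C, forall k, {in C &, injective (mul^~ k)}} ->
  (forall h k x, act (mul h k) x = act h (act k x)) ->
  (forall h x, h \in C -> act (inv h) (act h x) = x) ->
  (exists2 e, e \in C & forall x, act e x = x) ->
  uniq X -> (forall h x, h \in C -> x \in X -> act h x \in X) ->
  exists s : seq T, [/\ uniq s, {subset s <= X},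
    forall x y h, x \in s -> y \in s -> h \in C -> act h x = y -> x = y,
    forall x, x \in X -> exists2 h, h \in C & act h x \in s &
    (size s * size C = \sum_(h <- C) count (fun x => act h x == x) X)%N].
Proof.
move=> uC mulC invC mul_inj actM actV [e Ce act1].
have [n] := ubnP (size X); elim: n X => // n IHn [|x X0] lt_n uX actX.
  exists [::]; split=> //; by rewrite big1.
pose X := x :: X0; pose O y := has (fun h => act h x == y) C.
pose X' := [seq y <- X | ~~ O y].
have Ox : O x by apply/hasP; exists e; rewrite ?act1.
have inX' y : (y \in X') = ~~ O y && (y \in X) by rewrite mem_filter.
have sX' : (size X' < n)%N.
  have lt : (size X0 < n)%N by [].
  by rewrite /X' /= Ox /=; apply: leq_ltn_trans lt; rewrite size_filter count_size.
have OactE h y : h \in C -> O (act h y) = O y.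
  move=> Ch; apply/hasP/hasP=> [[k Ck /eqP e1]|[k Ck /eqP <-]].
    by exists (mul (inv h) k); rewrite ?mulC ?invC // actM e1 actV.
  by exists (mul h k); rewrite ?mulC // actM.
have [|||s [us sX sinj scov scard]] := IHn X' => //.
- exact: filter_uniq.
- by move=> h y Ch; rewrite !inX' OactE // => /andP[-> /actX->].
exists (x :: s); split.
- by rewrite /= us andbT; apply/negP => /sX; rewrite inX' Ox.
- move=> y; rewrite inE => /orP[/eqP->|/sX]; first exact: mem_head.
  by rewrite inX' => /andP[].
- have nOs y : y \in s -> ~~ O y by move=> /sX; rewrite inX' => /andP[].
  move=> y z h; rewrite !inE => /orP[/eqP->|ys] /orP[/eqP->|zs] Ch ez //.
  + by case/negP: (nOs _ zs); rewrite -ez OactE.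
  + by case/negP: (nOs _ ys); rewrite -(OactE h) // ez.
  + exact: sinj ez.
- move=> y yX; case Oy: (O y).
    have /hasP[h Ch /eqP ey] := Oy.
    by exists (inv h); rewrite ?invC // -ey actV // mem_head.
  have [|h Ch hs] := scov y; first by rewrite inX' Oy.
  by exists h; rewrite // inE hs orbT.
(* If k sends x to y, translation by k matches the stabilizer of y with the elements sending x to
   y. *)
have stab y : O y -> count (fun h => act h y == y) C = count (fun h => act h x == y) C.
  move=> /hasP[k Ck /eqP ey]; transitivity (count (fun h => act (mul h k) x == y) C).
    by apply: eq_count => h; rewrite actM ey.
  transitivity (count (fun h => act h x == y) (map (mul^~ k) C)); first by rewrite count_map.
  have um : uniq (map (mul^~ k) C) by rewrite (map_inj_in_uniq (mul_inj k Ck)).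
  have sub : {subset map (mul^~ k) C <= C} by move=> _ /mapP[h Ch ->]; apply: mulC.
  have [|_ eC] := uniq_min_size um sub; first by rewrite size_map.
  have /seq.permP -> // : perm_eq (map (mul^~ k) C) C.
  by apply: uniq_perm => // z; rewrite eC.
rewrite /= mulSn scard.
have -> : (\sum_(h <- C) count (fun y => act h y == y) X =
    \sum_(h <- C) count (fun y => act h y == y) [seq y <- X | O y]
    + \sum_(h <- C) count (fun y => act h y == y) X')%N.
  rewrite -big_split; apply: eq_bigr => h _.
  have /permPl/seq.permP/(_ (fun y => act h y == y)) := perm_filterC O X; by rewrite count_cat => <-.
congr (_ + _)%N.
transitivity (\sum_(h <- C) 1)%N; first by rewrite sum1_size.
transitivity (\sum_(h <- C) count (fun y => act h x == y) [seq y <- X | O y])%N.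
  apply: eq_big_seq => h Ch; rewrite (eq_count (a2 := pred1 (act h x))).
    rewrite count_uniq_mem ?filter_uniq // mem_filter actX ?mem_head // andbT.
    by have -> : O (act h x) by apply/hasP; exists h.
  by move=> y; rewrite /= eq_sym.
under eq_bigr => h _ do rewrite count_sum.
under [RHS]eq_bigr => h _ do rewrite count_sum.
rewrite exchange_big [RHS]exchange_big; apply: eq_big_seq => y.
by rewrite mem_filter => /andP[Oy _]; rewrite -!count_sum stab.
Qed.

Lemma posz_expn (a n : nat) : (a ^ n)%N%:Z = a%:Z ^+ n.
Proof. by elim: n => // n IHn; rewrite expnS exprS PoszM IHn. Qed.

(** * Tuples with a prescribed sum of traces *)

Section Solutions.
Variables (L : fieldType) (q : nat) (rt : nat -> seq L).

(* Tuples (s_i) with s_i a nonzero element of the field with q^(n_i) elements. *)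
Fixpoint prodl (ns : seq nat) : seq (seq L) :=
  if ns is n :: ns' then [seq s :: r | s <- [seq x <- rt n | x != 0], r <- prodl ns']
  else [:: [::]].

Definition good (n : nat) := uniq (rt n) /\ forall x, (x \in rt n) = (x ^+ (q ^ n) == x).

Lemma prodl_uniq ns : (forall n, n \in ns -> good n) -> uniq (prodl ns).
Proof.
elim: ns => //= n ns IHn gn; apply: allpairs_uniq.
- by rewrite filter_uniq //; have [] := gn n (mem_head _ _).
- by apply: IHn => k kn; apply: gn; rewrite inE kn orbT.
- by move=> [x r] [y r'] _ _ [-> ->].
Qed.

Lemma mem_prodl ns s : (forall n, n \in ns -> good n) -> s \in prodl ns <->
  size s = size ns /\ forall i, (i < size ns)%N ->
    s`_i != 0 /\ s`_i ^+ (q ^ nth 0%N ns i) = s`_i.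
Proof.
elim: ns s => [|n ns IHn] s gn /=.
  by rewrite inE; split=> [/eqP->|[/size0nil->]].
have [_ gm] := gn n (mem_head _ _).
have gns k : k \in ns -> good k by move=> kn; apply: gn; rewrite inE kn orbT.
split=> [/allpairsP[[x r] /= [+ /(IHn _ gns)[sr hr] ->]]|].
  rewrite mem_filter gm => /andP[x0 /eqP xn]; split; first by rewrite /= sr.
  by case.
case: s => [|x s] [] //= [ss] hs; apply: allpairs_f.
  by have [x0 xn] := hs 0%N isT; rewrite mem_filter gm x0 xn eqxx.
by apply/(IHn _ gns); split=> // i; apply: (hs i.+1).
Qed.

Definition tr (n : nat) (x : L) : L := \sum_(a < n) x ^+ (q ^ a).

Fixpoint wsum (d : seq (nat * bool)) (s : seq L) : L :=
  if d is (n, o) :: d' then (if o then tr n (head 0 s) else 0) + wsum d' (behead s) else 0.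

Lemma wsumE d s : wsum d s = \sum_(i < size d)
   if (nth (0%N, false) d i).2 then tr (nth (0%N, false) d i).1 s`_i else 0.
Proof.
elim: d s => [|[n o] d IHd] s /=; first by rewrite big_ord0.
rewrite big_ord_recl /= nth0 IHd; congr (_ + _); apply: eq_bigr => i _.
by rewrite /bump /= nth_behead.
Qed.

(** For c in F_q the number of tuples with [wsum] equal to c is a + e [c = 0], where (a, e) is the
    value at z = q. In an odd factor, a trace c is taken by z^(n-1) - [c = 0] nonzero elements,
    which gives the recursion; an even factor just multiplies by z^n - 1. *)
Fixpoint npts (z : int) (d : seq (nat * bool)) : int * int :=
  if d is (n, o) :: d' then let: (a, e) := npts z d' in
    if o then ((z ^+ n - 1) * a + e * z ^+ n.-1, - e) else ((z ^+ n - 1) * a, (z ^+ n - 1) * e)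
  else (0, 1).

Hypothesis q_gt1 : (1 < q)%N.
Hypothesis pnq : [pchar L].-nat q.

Lemma tr_fixed n x : x ^+ (q ^ n) = x -> tr n x ^+ q = tr n x.
Proof.
move=> xn; rewrite /tr expr_sum_pchar //; case: n xn => [|n] xn; first by rewrite !big_ord0.
rewrite big_ord_recr big_ord_recl /= -exprM -expnSr xn expn0 expr1 addrC; congr (_ + _).
by apply: eq_bigr => i _; rewrite -exprM -expnSr.
Qed.

Hypothesis tr_count : forall n c, (0 < n)%N -> good n -> c ^+ q = c ->
  count (fun x => tr n x == c) (rt n) = (q ^ n.-1)%N.

Lemma card_rt0 n (a : pred L) : (0 < n)%N -> good n ->
  (count a [seq x <- rt n | x != 0])%:Z = (count a (rt n))%:Z - (a 0)%:Z.
Proof.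
move=> n0 [un mn]; have r0 : 0 \in rt n.
  by rewrite mn expr0n expn_eq0 -(prednK n0) /= (gtn_eqF (ltnW q_gt1)) eqxx.
have /seq.permP/(_ a) -> := perm_to_rem r0; rewrite /= rem_filter //.
by rewrite PoszD addrAC subrr add0r.
Qed.

Lemma card_solutions d c : (forall n o, (n, o) \in d -> (0 < n)%N /\ good n) ->
  (forall n, good n -> (0 < n)%N -> size (rt n) = (q ^ n)%N) -> c ^+ q = c ->
  (count (fun s => wsum d s == c) (prodl (unzip1 d)))%:Z =
  (npts q d).1 + (npts q d).2 * (c == 0)%:Z.
Proof.
move=> + szr; elim: d c => [|[n o] d IHd] c gd cq /=.
  by rewrite addn0 add0r mul1r eq_sym.
have [n0 gn] := gd n o (mem_head _ _); have [_ mn] := gn.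
have {}IHd c' : c' ^+ q = c' -> _ := IHd c' (fun k o' h => gd k o' (mem_behead (s := (n, o) :: d) h)).
set A := [seq x <- rt n | x != 0].
have cA (a : pred (seq L)) : (count a [seq s :: r | s <- A, r <- prodl (unzip1 d)])%:Z =
    \sum_(s <- A) (count (fun r => a (s :: r)) (prodl (unzip1 d)))%:Z.
  elim: A => [|x A IHA] /=; first by rewrite big_nil.
  by rewrite count_cat count_map PoszD IHA big_cons.
rewrite cA; case: (npts q d) IHd => a e /= IHd.
have szA : (size A)%:Z = q%:Z ^+ n - 1.
  rewrite -count_predT /A card_rt0 // count_predT szr //.
  by rewrite posz_expn.
case: o {gd} => /=; last first.
  rewrite (eq_bigr (fun=> a + e * (c == 0)%:Z)); last first.
    by move=> x _; rewrite -IHd //; congr (Posz _); apply: eq_count => r; rewrite add0r.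
  by rewrite big_const_seq count_predT iter_addr addr0 -mulr_natl natz szA; ring.
rewrite (eq_big_seq (fun x => a + e * (tr n x == c)%:Z)); last first.
  move=> x; rewrite mem_filter mn => /andP[_ /eqP xn].
  have -> : (tr n x == c) = (c - tr n x == 0) by rewrite subr_eq0 eq_sym.
  rewrite -IHd; last first.
    by apply: (addIr (tr n x)); rewrite -{2}(tr_fixed xn) -exprDn_pchar // !subrK.
  congr (Posz _); apply: eq_count => r /=.
  by rewrite [RHS]eq_sym subr_eq eq_sym addrC.
rewrite big_split /= big_const_seq count_predT iter_addr addr0 -mulr_natl natz szA -mulr_sumr.
have -> : \sum_(x <- A) (tr n x == c)%:Z = q%:Z ^+ n.-1 - (c == 0)%:Z.
  have -> : \sum_(x <- A) (tr n x == c)%:Z = (count (fun x => tr n x == c) A)%:Z.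
    by elim: (A) => [|x A' IHA]; [rewrite big_nil | rewrite big_cons /= IHA PoszD].
  rewrite card_rt0 // tr_count // /tr big1 1?eq_sym => [|i _].
    by rewrite posz_expn.
  by rewrite expr0n expn_eq0 gtn_eqF // ltnW.
ring.
Qed.
End Solutions.

Lemma bapp_id p : bapp bid p = p.
Proof. by case: p => [[[] []] []]. Qed.

Lemma bapp0 g : bapp g bvec0 = bvec0.
Proof. by []. Qed.

Lemma bapp_eq0 g p : g \in GL3 -> (bapp g p == bvec0) = (p == bvec0).
Proof.
rewrite mem_GL3 => /allP Gg; have [->|p0] := eqVneq p bvec0; first by rewrite bapp0 eqxx.
by apply/negbTE/Gg; rewrite mem_bvecs1.
Qed.

Lemma bvecsE : bvecs = bvec0 :: bvecs1. Proof. by []. Qed.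

(** * Fixed points of h on X_g *)

Section FixCount.
#[local] Opaque orbits locs.
Variables (F : finFieldType) (L : closedFieldType) (iota : {rmorphism F -> L}).
Hypothesis char2F : 2%N \in [pchar F].
Variables (m q : nat).
Hypotheses (m_gt0 : (0 < m)%N) (qE : q = (2 ^ m)%N) (cardF : #|F| = q).
Let char2 : 2%N \in [pchar L] := rmorph_pchar iota char2F.
Let pnq : [pchar L].-nat q := pchar_q qE char2.
Let pnqn n : [pchar L].-nat (q ^ n)%N. Proof. by rewrite pnatX pnq. Qed.
Let q1 : (1 < q)%N := q_gt1 m_gt0 qE.
Let q_gt0 : (0 < q)%N := ltnW q1.

(** The polynomial of the trace equation has degree q^(n-1) and derivative 1, so it has that many
    distinct roots in L. *)
Lemma trace_count rt n c : (0 < n)%N -> good q rt n -> c ^+ q = c ->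
  count (fun x : L => tr q n x == c) (rt n) = (q ^ n.-1)%N.
Proof.
case: n => // n _ [un mn] cq /=.
pose p : {poly L} := \sum_(a < n.+1) 'X^(q ^ a) - c%:P.
have szt k : size (\sum_(a < k.+1) 'X^(q ^ a) : {poly L}) = (q ^ k).+1.
  elim: k => [|k IHk]; first by rewrite big_ord1 size_polyXn.
  rewrite big_ord_recr /= addrC size_polyDl size_polyXn // IHk ltnS ltn_exp2l //.
have sz : size p = (q ^ n).+1.
  by rewrite size_polyDl szt // size_polyN (leq_ltn_trans (size_polyC_leq1 _)) // ltnS expn_gt0 q_gt0.
have [|r [ur sr mr]] := @separable_roots L p.
  have dp : p^`() = 1.
    rewrite /p derivB derivC subr0 big_ord_recl /= expr1 derivD derivX.
    rewrite raddf_sum big1 ?addr0 // => i _.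
    by apply: (derivXn_pchar (pnqn _)); rewrite -{1}(expn0 q) ltn_exp2l.
  by rewrite unlock dp coprimep1.
have rootE x : (x \in r) = (tr q n.+1 x == c).
  by rewrite mr /root /p !hornerE horner_sum /tr subr_eq0; under eq_bigr => i _ do rewrite hornerXn.
rewrite -size_filter -[RHS](_ : size r = _); last by rewrite sr sz.
apply: perm_size; apply: uniq_perm => [||x]; rewrite ?filter_uniq // mem_filter rootE.
(* Every root lies in the field with q^n elements: raising tr(x) = c to the power q and cancelling
   common terms leaves x^(q^n) = x. *)
rewrite mn andb_idr // => /eqP tx; apply/eqP.
have := congr1 (fun y => y ^+ q) tx; rewrite cq -tx /tr expr_sum_pchar //.
rewrite big_ord_recr [in RHS]big_ord_recl /= -exprM -expnSr expn0 expr1 [RHS]addrC.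
have -> : \sum_(i < n) x ^+ (q ^ i) ^+ q = \sum_(i < n) x ^+ (q ^ bump 0 i).
  by apply: eq_bigr => i _; rewrite -exprM -expnSr.
by move/addrI.
Qed.

Variable rt : nat -> seq L.
Hypothesis rtP : forall n, (0 < n < 8)%N -> good q rt n.

Lemma size_rt n : good q rt n -> (0 < n)%N -> size (rt n) = (q ^ n)%N.
Proof.
move=> [un mn] n0; have [r [ur sr mr]] := @fixed_field_roots F L iota q (pchar_q qE char2F) q1 n n0.
by rewrite -sr; apply: perm_size; apply: uniq_perm => // x; rewrite mr mn.
Qed.

Definition act (h : bmat) (t : {ffun bvec -> L}) : {ffun bvec -> L} := [ffun p => t (bapp h p)].

Section Pair.
Variables g h : bmat.
Hypotheses (Gg : g \in GL3) (Gh : h \in GL3) (ok : orbits_ok g h).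

Let d := orbits g h.
Let l := locs g h d.
Let rep i := (nth (bvec0, 0%N) d i).1.
Let per i := (nth (bvec0, 0%N) d i).2.
Let od := odata g h.

Let size_od : size od = size d. Proof. by rewrite /od /odata size_map size_iota. Qed.
Let nth_od i : (i < size d)%N -> nth (0%N, false) od i = (per i, oparity l i).
Proof.
move=> i_lt; rewrite /od /odata.
rewrite (nth_map 0%N); last by rewrite size_iota.
by rewrite (nth_iota 0 0 i_lt) add0n.
Qed.
Let nth_ns i : (i < size d)%N -> nth 0%N (unzip1 od) i = per i.
Proof. by move=> i_lt; rewrite (nth_map (0%N, false)) ?size_od // nth_od. Qed.

Let locP p : p != bvec0 -> [/\ ((locl l p).1 < size d)%N, ((locl l p).2 < per (locl l p).1)%N,
  exists2 r, r \in hcoset h (rep (locl l p).1) & p = iter (locl l p).2 (bapp g) r,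
  locl l (bapp h p) = locl l p &
  locl l (bapp g p) = ((locl l p).1, if (locl l p).2.+1 == per (locl l p).1 then 0%N else (locl l p).2.+1)].
Proof.
rewrite -mem_bvecs1 => p1; case/andP: ok => /allP/(_ p p1)/and5P[lt1 lt2 /hasP[r rh /eqP e] /eqP e1 /eqP e2] _.
by split=> //; exists r.
Qed.

Let repP i : (i < size d)%N -> [/\ rep i != bvec0, locl l (rep i) = (i, 0%N), (0 < per i < 8)%N,
  iter (per i) (bapp g) (rep i) \in hcoset h (rep i) &
  forall a, (a < per i)%N -> odd (count (fun p => locl l p == (i, a)) bvecs1) = oparity l i].
Proof.
move=> i_lt; case/andP: ok => _ /allP/(_ i); rewrite mem_iota /= => /(_ i_lt)/and5P[? /eqP ? ? ? /allP h5].
by split=> // a a_lt; apply/eqP/h5; rewrite mem_iota.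
Qed.

Let od_good n o : (n, o) \in od -> (0 < n)%N /\ good q rt n.
Proof.
move=> /(nthP (0%N, false))[i]; rewrite size_od => i_lt; rewrite nth_od // => -[<- _].
by have [_ _ /[dup] hp /rtP ? _ _] := repP i_lt; split=> //; case/andP: hp.
Qed.

Let ns_good n : n \in unzip1 od -> good q rt n.
Proof. by move=> /mapP[[k o] ko ->]; case: (od_good ko). Qed.

(** The value s_i^(q^a) at g^a h^b r_i is forced by equivariance under g and invariance under h. *)
Definition build (s : seq L) : {ffun bvec -> L} :=
  [ffun p => if p == bvec0 then 0 else s`_(locl l p).1 ^+ (q ^ (locl l p).2)].

Definition solutions : seq {ffun bvec -> L} :=
  [seq build s | s <- [seq s <- prodl rt (unzip1 od) | wsum q od s == 1]].

Let mulr2odd (x : L) n : x *+ n = x *+ odd n.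
Proof. by rewrite -{1}(odd_double_half n) mulrnDr -mul2n mulrnA mulr2n (addrr_pchar2 char2) mul0rn addr0. Qed.

(** Grouping the points by location, each conjugate of s_i occurs with a multiplicity that reduces
    to [oparity], so an orbit contributes its trace or 0. *)
Lemma build_sum s : \sum_(p <- bvecs) build s p = wsum q od s.
Proof.
pose G i a := s`_i ^+ (q ^ a).
rewrite bvecsE big_cons ffunE eqxx add0r wsumE size_od.
have e1 p : p \in bvecs1 -> build s p =
    \sum_(i < size d) \sum_(a < per i) G i a *+ (locl l p == (i : nat, a : nat)).
  rewrite mem_bvecs1 => p0; rewrite ffunE (negbTE p0).
  have [lt1 lt2 _ _ _] := locP p0; rewrite (bigD1 (Ordinal lt1)) //= (bigD1 (Ordinal lt2)) //=.
  rewrite -surjective_pairing eqxx mulr1n !big1 ?addr0 // => [i ne|a ne].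
    rewrite big1 // => a _; case: eqP => // e; case/eqP: ne; apply/val_inj.
    by rewrite /= e.
  case: eqP => // e; case/eqP: ne; apply/val_inj.
  exact: esym (congr1 snd e).
rewrite (eq_big_seq _ e1) exchange_big /=; apply: eq_bigr => i _.
have [_ _ _ _ odd_i] := repP (ltn_ord i).
rewrite exchange_big nth_od //= /tr; transitivity (\sum_(a < per i) G i a *+ oparity l i).
  apply: eq_bigr => a _; rewrite -(odd_i a) // -mulr2odd count_sum.
  by rewrite -sumrMnr.
by case: oparity => /=; [|rewrite big1].
Qed.

Lemma mem_solutions t : t \in solutions <->
  admissible q g t /\ forall p, t (bapp h p) = t p.
Proof.
split=> [/mapP[s]|[[t0 ts tg] th]].
  rewrite mem_filter => /andP[/eqP ws /(mem_prodl _ ns_good)[ss sP]] ->.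
  have {}sP i : (i < size d)%N -> s`_i != 0 /\ s`_i ^+ (q ^ per i) = s`_i.
    by move=> i_lt; rewrite -nth_ns //; apply: sP; rewrite size_map size_od.
  split; first split=> [p||p].
  - rewrite ffunE; case: (eqVneq p bvec0) => [_|p0]; first by rewrite eqxx.
    have [lt1 _ _ _ _] := locP p0; have [s0 _] := sP _ lt1.
    by apply/negbTE; rewrite expf_neq0.
  - by rewrite build_sum.
  - rewrite !ffunE bapp_eq0 //; case: eqP => [_|/eqP p0]; first by rewrite expr0n gtn_eqF.
    have [lt1 lt2 _ _ ->] := locP p0; have [_ sn] := sP _ lt1.
    rewrite -exprM -expnSr /=; by case: eqP => // ->; rewrite sn expn0 expr1.
  - move=> p; rewrite !ffunE bapp_eq0 //; case: eqP => // /eqP p0.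
    by have [_ _ _ -> _] := locP p0.
have titer n p : t (iter n (bapp g) p) = t p ^+ (q ^ n).
  by elim: n => [|n IHn] /=; rewrite ?expn0 ?expr1 // tg IHn -exprM -expnSr.
have thc r p : r \in hcoset h p -> t r = t p.
  by move=> /mapP[b _ ->]; elim: b => //= b IHb; rewrite th.
pose s := [seq t (rep i) | i <- seq.iota 0 (size d)].
have sE i : (i < size d)%N -> s`_i = t (rep i).
  by move=> i_lt; rewrite (nth_map 0%N) ?size_iota // nth_iota.
have tE : t = build s.
  apply/ffunP=> p; rewrite ffunE; case: eqP => [->|/eqP p0]; first by apply/eqP; rewrite t0.
  have [lt1 lt2 [r rh e] _ _] := locP p0.
  by rewrite {1}e titer (thc _ _ rh) sE.
apply/mapP; exists s => //; rewrite mem_filter -build_sum -tE ts eqxx /=.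
apply/(mem_prodl _ ns_good); split; first by rewrite !size_map size_iota.
move=> i; rewrite size_map size_od => i_lt; rewrite sE // nth_ns //.
have [r0 _ _ rp _] := repP i_lt; split; first by rewrite t0.
by rewrite -titer (thc _ _ rp).
Qed.

Lemma solutions_uniq : uniq solutions.
Proof.
rewrite map_inj_in_uniq ?filter_uniq ?(prodl_uniq ns_good) // => s s'.
rewrite !mem_filter => /andP[_ /(mem_prodl _ ns_good)[ss _]] /andP[_ /(mem_prodl _ ns_good)[ss' _]].
move=> /ffunP e; apply: (@eq_from_nth _ 0); rewrite ss ?ss' // size_map size_od => i i_lt.
have [r0 rl _ _ _] := repP i_lt; have := e (rep i).
by rewrite !ffunE (negbTE r0) rl /= expn0 !expr1.
Qed.

Lemma size_solutions : (size solutions)%:Z = (npts q od).1.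
Proof.
rewrite size_map size_filter.
rewrite (card_solutions q1 pnq (fun n c h1 h2 h3 => trace_count h1 h2 h3) od_good size_rt) ?expr1n //.
by rewrite oner_eq0 mulr0 addr0.
Qed.
End Pair.

End FixCount.

(** * Counting classes *)

Lemma nclasses_ext (F : fieldType) (P Q : quartic F -> Prop) N :
  (forall f, P f <-> Q f) -> nclasses P N -> nclasses Q N.
Proof.
move=> PQ [s [sP [sn sc]]]; exists s; split=> [i|]; first by apply/PQ.
by split=> // f /PQ; apply: sc.
Qed.

Lemma nclasses_or (F : fieldType) (P Q : quartic F -> Prop) M N :
  (forall f g, P f -> Q g -> ~ iso f g /\ ~ iso g f) ->
  nclasses P M -> nclasses Q N -> nclasses (fun f => P f \/ Q f) (M + N).
Proof.
move=> PQ [s [sP [sn sc]]] [s' [sP' [sn' sc']]]; exists [tuple of s ++ s'].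
have e1 i : tnth [tuple of s ++ s'] (lshift N i) = tnth s i by rewrite tnth_lshift.
have e2 i : tnth [tuple of s ++ s'] (rshift M i) = tnth s' i by rewrite tnth_rshift.
split; first by move=> i; case: (split_ordP i) => j ->; rewrite ?e1 ?e2; [left|right].
split=> [i j|g [/sc[i]|/sc'[i]]]; last 2 first.
- by exists (lshift N i); rewrite e1.
- by exists (rshift M i); rewrite e2.
case: (split_ordP i) => i' ->; case: (split_ordP j) => j' ->; rewrite ?e1 ?e2 => ij.
- by apply: sn; apply: contra ij => /eqP->.
- by case: (PQ _ _ (sP i') (sP' j')).
- by case: (PQ _ _ (sP j') (sP' i')).
- by apply: sn'; apply: contra ij => /eqP->.
Qed.

Lemma nclasses0 (F : fieldType) (P : quartic F -> Prop) : (forall f, ~ P f) -> nclasses P 0.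
Proof. by move=> P0; exists [tuple]; split=> [[]|] //; split=> [[]|f /P0] //. Qed.

(** The element orders 1, 2, 3, 4, 7 divide 84, so h^83 is the inverse of h. *)
Definition binv (h : bmat) : bmat := bexp h 83.

Lemma binvP h : h \in GL3 -> [/\ binv h \in GL3, bmul (binv h) h = bid & bmul h (binv h) = bid].
Proof.
have: all (fun h => [&& binv h \in GL3, bmul (binv h) h == bid & bmul h (binv h) == bid]) GL3.
  by vm_compute.
by move=> /allP H /H /and3P[? /eqP ? /eqP ?].
Qed.

Definition bconj (g h : bmat) : bool := has (fun k => bmul k g == bmul h k) GL3.

Lemma GL3_uniq : uniq GL3. Proof. by vm_compute. Qed.

Lemma reps_GL3 : {subset reps <= GL3}.
Proof.
have /allP H : all (mem GL3) reps by vm_compute.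
exact: H.
Qed.

Section Assembly.
Variables (F : finFieldType) (L : closedFieldType) (iota : {rmorphism F -> L}).
Hypothesis char2F : 2%N \in [pchar F].
Variables (m q : nat).
Hypotheses (m_gt0 : (0 < m)%N) (qE : q = (2 ^ m)%N) (cardF : #|F| = q).
Let char2 : 2%N \in [pchar L] := rmorph_pchar iota char2F.
Let pnq : [pchar L].-nat q := pchar_q qE char2.
Let q1 : (1 < q)%N := q_gt1 m_gt0 qE.

Lemma bmulA g h k : bmul g (bmul h k) = bmul (bmul g h) k.
Proof. by apply: (@cm_inj L); rewrite !cm_mul // mulmxA. Qed.

Lemma bmul1 g : bmul g bid = g.
Proof. by apply: (@cm_inj L); rewrite cm_mul // cm_bid mulmx1. Qed.

Lemma mul1b g : bmul bid g = g.
Proof. by apply: (@cm_inj L); rewrite cm_mul // cm_bid mul1mx. Qed.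

Lemma bmul_GL3 g h : g \in GL3 -> h \in GL3 -> bmul g h \in GL3.
Proof. by rewrite -!(cm_unit char2) cm_mul // unitmx_mul => -> ->. Qed.

Lemma bapp_mul g h p : bapp (bmul g h) p = bapp g (bapp h p).
Proof. by apply: (@cv_inj L); rewrite !cv_app // cm_mul // mulmxA. Qed.

Lemma mem_centralizer g h : (h \in centralizer g) = (bmul h g == bmul g h) && (h \in GL3).
Proof. by rewrite mem_filter. Qed.

Lemma centralizer_mul g h k : h \in centralizer g -> k \in centralizer g ->
  bmul k h \in centralizer g.
Proof.
rewrite !mem_centralizer => /andP[/eqP hg Gh] /andP[/eqP kg Gk].
by rewrite bmul_GL3 // andbT -bmulA hg !bmulA kg.
Qed.

Lemma centralizer_inv g h : h \in centralizer g -> binv h \in centralizer g.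
Proof.
rewrite !mem_centralizer => /andP[/eqP hg Gh]; have [Gi ih hi] := binvP Gh.
rewrite Gi andbT; apply/eqP; move: (binv h) ih hi => k kh hk.
transitivity (bmul (bmul k (bmul g h)) k).
  by rewrite -!bmulA hk bmul1.
by rewrite -hg !bmulA kh mul1b.
Qed.

Lemma perm_bapp h : h \in GL3 -> perm_eq (map (bapp h) bvecs) bvecs.
Proof.
move=> Gh; have [_ ih _] := binvP Gh; apply: uniq_perm => //.
  by rewrite map_inj_uniq //; apply: (can_inj (g := bapp (binv h))) => p; rewrite -bapp_mul ih bapp_id.
move=> p; rewrite mem_bvecs; apply/mapP; exists (bapp (binv h) p); rewrite ?mem_bvecs //.
by rewrite -bapp_mul; have [_ _ ->] := binvP Gh; rewrite bapp_id.
Qed.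

Lemma admissible_act g h (t : {ffun bvec -> L}) : h \in centralizer g ->
  admissible q g t -> admissible q g (act h t).
Proof.
rewrite mem_centralizer => /andP[/eqP hg Gh] [t0 ts tg]; split=> [p||p].
- by rewrite ffunE t0 bapp_eq0.
- rewrite -ts -[RHS](perm_big _ (perm_bapp Gh)) big_map.
  by apply: eq_bigr => p _; rewrite ffunE.
- by rewrite !ffunE -bapp_mul hg bapp_mul tg.
Qed.

Lemma good_roots : exists rt : nat -> seq L, forall n, (0 < n < 8)%N -> good q rt n.
Proof.
have h (n : 'I_8) : exists r : seq L, (0 < n)%N ->
    uniq r /\ forall x, (x \in r) = (x ^+ (q ^ n) == x).
  case: (posnP n) => [->|n0]; first by exists [::].
  have [r [ur _ mr]] := @fixed_field_roots F L iota q (pchar_q qE char2F) q1 n n0.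
  by exists r.
have [rt rtP] := fin_all_exists h; exists (fun n => rt (inord n)) => n /andP[n0 n8].
by have := rtP (inord n); rewrite inordK //; apply.
Qed.

(** Lang's theorem again, now with exponent q and matrix g^-1. *)
Lemma frame_exists g : g \in GL3 ->
  exists2 R : 'M[L]_3, R \in unitmx & R = cm L g *m frobm q R.
Proof.
move=> Gg; have [Gi ig gi] := binvP Gg.
have ui : cm F (binv g) \in unitmx by rewrite cm_unit.
have [R uR eR] := lang iota (pchar_q qE char2F) q1 ui; exists R => //.
rewrite eR (_ : map_mx iota _ = cm L (binv g)).
  by rewrite mulmxA -cm_mul // gi cm_bid mul1mx.
by apply/matrixP=> i j; rewrite !mxE rmorph_nat.
Qed.

Definition otyp g (f : quartic F) := ord_quartic iota f /\ typ iota q g f.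

(** In one fixed frame for g, quartics of type g correspond up to isomorphism to admissible t, and
    isomorphisms to elements of the centralizer; Burnside's lemma then counts the orbits. *)
Lemma class_count g : g \in reps -> exists N, nclasses (otyp g) N /\
  N%:Z * (size (centralizer g))%:Z = \sum_(h <- centralizer g) (npts q (odata g h)).1.
Proof.
move=> rg; have Gg := reps_GL3 rg.
have [rt rtP] := good_roots; have [R uR eR] := frame_exists Gg.
have Cid : bid \in centralizer g by rewrite mem_centralizer bid_GL3 bmul1 mul1b eqxx.
have CG h : h \in centralizer g -> h \in GL3 by rewrite mem_centralizer => /andP[].
have ok h : h \in centralizer g -> orbits_ok g h by apply: reps_orbits_ok.
pose sol h := solutions q rt g h.
have memS h (t : {ffun bvec -> L}) : h \in centralizer g ->
    t \in sol h <-> admissible q g t /\ forall p, t (bapp h p) = t p.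
  by move=> Ch; apply: (mem_solutions iota char2F m_gt0 qE rtP Gg (CG h Ch) (ok h Ch)).
(* For h = 1 the solutions are all of X_g, which exhibits this set as a finite list. *)
have memX t : t \in sol bid <-> admissible q g t.
  by rewrite memS //; split=> [[]|ta] //; split=> // p; rewrite bapp_id.
have uS h : h \in centralizer g -> uniq (sol h).
  by move=> Ch; apply: solutions_uniq => //; apply: ok.
(* The product is reversed because [act] composes contravariantly. *)
have [|||||||||s [us sX sinj scov scard]] :=
  burnside (C := centralizer g) (act := @act L) (mul := fun h k => bmul k h) (inv := binv)
    (X := sol bid).
- by rewrite filter_uniq // GL3_uniq.
- by move=> h k Ch Ck; apply: centralizer_mul.
- by move=> h; apply: centralizer_inv.
- move=> k Ck h h' _ _ /= e; have [_ ik _] := binvP (CG k Ck).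
  by rewrite -(mul1b h) -ik -bmulA e bmulA ik mul1b.
- by move=> h k t; apply/ffunP=> p; rewrite !ffunE bapp_mul.
- by move=> h t Ch; apply/ffunP=> p; rewrite !ffunE -bapp_mul; have [_ _ ->] := binvP (CG h Ch); rewrite bapp_id.
- by exists bid => // t; apply/ffunP=> p; rewrite ffunE bapp_id.
- exact: uS.
- by move=> h t Ch /memX ta; apply/memX/admissible_act.
have sadm (i : 'I_(size s)) : admissible q g (nth [ffun=> 0] s i) by apply/memX/sX/mem_nth.
have [fq fqP] := fin_all_exists (fun i : 'I_(size s) => std_exists iota char2F m_gt0 qE cardF eR Gg (sadm i)).
exists (size s); split; last first.
  rewrite -PoszM scard (big_morph Posz PoszD (erefl _)); apply: eq_big_seq => h Ch.
  rewrite -(size_solutions iota char2F m_gt0 qE rtP (ok h Ch)) -size_filter; congr Posz.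
  apply: perm_size; apply: uniq_perm; rewrite ?filter_uniq ?uS // => t.
  rewrite mem_filter; apply/idP/idP => [/andP[/eqP e /memX ta]|/(memS _ _ Ch)[ta th]].
    by apply/memS => //; split=> // p; rewrite -[in RHS]e ffunE.
  by apply/andP; split; [apply/eqP/ffunP=> p; rewrite ffunE th | apply/memX].
exists [tuple fq i | i < size s]; split=> [i|].
  rewrite tnth_mktuple; have [B Bt nfB] := std_nf uR (fqP i).
  split; last by exists R, B, 1.
  split; last exact: (nf_seven char2F nfB).
  apply/(nf_nonsingular char2F nfB) => p p0; rewrite -[qf _ _ _]/(tval B 1 p) Bt.
  by have [-> _ _] := sadm i.
split=> [i j ij|f [[ns _] ty]].
  rewrite !tnth_mktuple => /(iso_isoF iota char2F) iso_ij.
  have [h [Gh hg th]] := std_iso char2F m_gt0 qE cardF uR eR Gg (fqP i) (fqP j) iso_ij.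
  have Ch : h \in centralizer g by rewrite mem_centralizer hg eqxx.
  have e : act h (nth [ffun=> 0] s i) = nth [ffun=> 0] s j.
    by apply/ffunP=> p; rewrite ffunE th.
  have /eqP := sinj _ _ h (mem_nth _ (ltn_ord i)) (mem_nth _ (ltn_ord j)) Ch e.
  by rewrite nth_uniq // => /eqP/val_inj/eqP; apply/negP.
have [t [f' [st iso1 ta]]] := std_cover char2F m_gt0 qE cardF uR eR Gg ns ty.
pose t' := finfun t.
have ta' : admissible q g t'.
  case: ta => t0 ts tg; split=> [p||p]; rewrite ?ffunE //.
  by rewrite -ts; apply: eq_bigr => p _; rewrite ffunE.
have [h Ch hs] := scov t' ((memX t').2 ta').
have i_lt : (index (act h t') s < size s)%N by rewrite index_mem.
exists (Ordinal i_lt); rewrite tnth_mktuple; apply/(iso_isoF iota char2F)/isoF_sym.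
apply: isoF_trans iso1 _; apply: (std_conj char2F m_gt0 qE cardF uR eR Gg st (fqP (Ordinal i_lt)) (CG h Ch)).
  by move: Ch; rewrite mem_centralizer => /andP[/eqP].
by move=> p; rewrite /= nth_index // !ffunE.
Qed.
End Assembly.

(** * Evaluation of the Burnside sums *)

Definition tally (g : bmat) : seq (seq (nat * bool) * nat) :=
  let s := [seq odata g h | h <- centralizer g] in [seq (x, count_mem x s) | x <- undup s].

(** Grouping the centralizer by orbit data leaves a few terms with multiplicities, so [ring] can
    treat the sum as a polynomial identity in z. *)
Lemma sum_tally (f : seq (nat * bool) -> int) g :
  \sum_(h <- centralizer g) f (odata g h) = \sum_(x <- tally g) f x.1 *+ x.2.
Proof.
rewrite /tally big_map -(big_map (odata g) predT f) big_undup_iterop_count.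
by apply: eq_bigr.
Qed.

Ltac tally_rewrite g :=
  rewrite (sum_tally (fun d => (npts _ d).1));
  let t := eval vm_compute in (tally g) in
  (have -> : tally g = t by vm_compute);
  rewrite !big_cons big_nil /=; ring.

Lemma burnside_sum1 (z : int) : \sum_(h <- centralizer g1) (npts z (odata g1 h)).1 =
  z ^+ 6 - 7 * z ^+ 5 + 42 * z ^+ 4 - 140 * z ^+ 3 + 343 * z ^+ 2 - 462 * z + 328.
Proof. tally_rewrite g1. Qed.

Lemma burnside_sum2 (z : int) : \sum_(h <- centralizer g2) (npts z (odata g2 h)).1 =
  z ^+ 6 - 3 * z ^+ 5 + 6 * z ^+ 4 - 12 * z ^+ 3 + 15 * z ^+ 2 - 6 * z.
Proof. tally_rewrite g2. Qed.

Lemma burnside_sum3 (z : int) : \sum_(h <- centralizer g3) (npts z (odata g3 h)).1 =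
  z ^+ 6 - z ^+ 5 - 2 * z ^+ 3 + 4 * z ^+ 2 - 6 * z + 7.
Proof. tally_rewrite g3. Qed.

Lemma burnside_sum4 (z : int) : \sum_(h <- centralizer g4) (npts z (odata g4 h)).1 =
  z ^+ 6 - z ^+ 5 - z ^+ 2 - 2 * z + 4.
Proof. tally_rewrite g4. Qed.

Lemma burnside_sum70 (z : int) :
  \sum_(h <- centralizer g70) (npts z (odata g70 h)).1 = z ^+ 6 + 6.
Proof. tally_rewrite g70. Qed.

Lemma burnside_sum71 (z : int) :
  \sum_(h <- centralizer g71) (npts z (odata g71 h)).1 = z ^+ 6 + 6.
Proof. tally_rewrite g71. Qed.

Lemma GL3_reps g : g \in GL3 -> exists2 h, h \in reps & exists2 k, k \in GL3 & bmul k g = bmul h k.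
Proof.
have: all (fun g => has (bconj g) reps) GL3 by vm_compute.
move=> /allP H /H /hasP[h rh /hasP[k Gk /eqP e]].
by exists h => //; exists k.
Qed.

(* Each class below is characterised inside GL3(F_2) by a conjugation-invariant
   test on its elements, which [sel] stands for. *)
Definition selects (sel : bmat -> bool) (g0 : bmat) : bool :=
  sel g0 && all (fun g => sel g ==> bconj g g0) GL3.

(** * From Frobenius classes to the sets in the theorem *)

Section Final.
Variables (F : finFieldType) (L : closedFieldType) (iota : {rmorphism F -> L}).
Hypothesis char2F : 2%N \in [pchar F].
Variables (m q : nat).
Hypotheses (m_gt0 : (0 < m)%N) (qE : q = (2 ^ m)%N) (cardF : #|F| = q).
Notation otyp := (otyp iota q).

Lemma otyp_selected (sel : bmat -> bool) g0 (P : quartic F -> Prop) :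
  selects sel g0 ->
  (forall f g, ord_quartic iota f -> typ iota q g f -> P f <-> sel g) ->
  forall f, otyp g0 f <-> ord_quartic iota f /\ P f.
Proof.
move=> /andP[sg0 /allP hsel] Psel f; split=> [[ordf tf]|[ordf Pf]].
  by split=> //; apply/(Psel _ _ ordf tf).
split=> //; have [g Gg tf] := ord_typ char2F qE cardF ordf.
have /implyP/(_ ((Psel _ _ ordf tf).1 Pf))/hasP[k Gk /eqP e] := hsel g Gg.
exact: (typ_conj char2F m_gt0 qE Gk e tf).
Qed.

Lemma bitangent_degree_bdeg f g n : (0 < n)%N -> typ iota q g f ->
  bitangent_degree iota q f n <-> bdeg g n.
Proof.
move=> n0 [R [B [d [nfR eR]]]].
have AO e : all_bitangents_over iota q f e <-> bexp g e = bid.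
  exact: (nf_all_over char2F qE e nfR eR).
split=> [[_ [/AO gn ne]]|/andP[/eqP gn /allP ne]].
  rewrite /bdeg gn eqxx /=; apply/allP => e; rewrite mem_iota => e_lt.
  apply/eqP => /AO; apply: ne; move: e_lt; rewrite add1n prednK //.
split=> //; split=> [|e /andP[e0 en] /AO ge]; first exact/AO.
have := ne e; rewrite mem_iota add1n prednK // e0 en ge eqxx.
by move=> /(_ isT).
Qed.

Lemma Cd_otyp n g0 : (0 < n)%N -> selects (bdeg^~ n) g0 ->
  forall f, otyp g0 f <-> Cd iota q n f.
Proof.
move=> n0 sel; apply: otyp_selected sel _ => f g _ tf.
exact: bitangent_degree_bdeg.
Qed.

Lemma C7_otyp a b g0 : (a <= 7)%N -> (b <= 7)%N ->
  selects (fun g => bdeg g 7 && conc (7 - a) (7 - b) g) g0 ->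
  forall f, otyp g0 f <-> ord_quartic iota f /\ bitangent_degree iota q f 7 /\
    exists v, bitangent iota f v /\ concurrent v (frob q a v) (frob q b v).
Proof.
move=> a7 b7 sel; apply: otyp_selected sel _ => f g ordf tf.
have deg := bitangent_degree_bdeg (n := 7) isT tf.
have [R [B [d [nfR eR]]]] := tf.
split=> [[/deg dg cc]|/andP[dg cc]].
  rewrite dg /=; have /andP[/eqP g7 _] := dg.
  exact/(nf_concurrent char2F qE nfR eR g7 a7 b7).
have /andP[/eqP g7 _] := dg.
by split; [apply/deg | apply/(nf_concurrent char2F qE nfR eR g7 a7 b7)].
Qed.

Lemma otyp_not_iso g h f f' : g \in GL3 -> h \in GL3 -> ~~ bconj g h ->
  otyp g f -> otyp h f' -> ~ iso f f'.
Proof.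
move=> Gg Gh nc [_ tf] [_ [R' [B' [d' [nf' eR']]]]] /(iso_isoF iota char2F) ff'.
have [R [B [d [nfR eR]]]] := typ_iso char2F qE cardF ff' tf.
have [k [mu [Gk _ _ e]]] := nf_uniq char2F m_gt0 qE nfR eR Gg nf' eR' Gh.
by case/negP: nc; apply/hasP; exists k => //; apply/eqP.
Qed.

Lemma nclasses_union (rs : seq bmat) (N : bmat -> nat) :
  {subset rs <= GL3} -> pairwise (fun g h => ~~ bconj g h && ~~ bconj h g) rs ->
  (forall g, g \in rs -> nclasses (otyp g) (N g)) ->
  nclasses (fun f => exists2 g, g \in rs & otyp g f) (\sum_(g <- rs) N g)%N.
Proof.
elim: rs => [|g rs IHrs] sG /=; first by rewrite big_nil => *; apply: nclasses0 => f [].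
move=> /andP[/allP pg prs] ncl; rewrite big_cons.
apply: (@nclasses_ext _ (fun f => otyp g f \/ exists2 h, h \in rs & otyp h f)).
  move=> f; split=> [[tf|[h hr tf]]|[h]].
  - by exists g; rewrite ?mem_head.
  - by exists h; rewrite // inE hr orbT.
  - by rewrite inE => /orP[/eqP->|hr] tf; [left | right; exists h].
have sG' : {subset rs <= GL3} by move=> h hr; apply: sG; rewrite inE hr orbT.
apply: nclasses_or; last 2 first.
- by apply: ncl; rewrite mem_head.
- by apply: IHrs => // h hr; apply: ncl; rewrite inE hr orbT.
move=> f f' tf [h hr tf']; have /andP[n1 n2] := pg h hr.
have Gg : g \in GL3 by apply: sG; rewrite mem_head.
by split; [apply: (otyp_not_iso Gg (sG' h hr) n1) | apply: (otyp_not_iso (sG' h hr) Gg n2)].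
Qed.

End Final.

Theorem theorem1p8 (m : nat) (F : finFieldType) (L : closedFieldType)
    (iota : {rmorphism F -> L}) :
  (0 < m)%N -> #|F| = (2 ^ m)%N ->
  let q : int := (2 ^ m)%N%:Z in
  (exists N : nat, nclasses (ord_quartic iota) N /\
     N%:Z = q ^+ 6 - q ^+ 5 + q ^+ 4 - 3 * q ^+ 3 + 5 * q ^+ 2 - 6 * q + 7) /\
  (exists N : nat, nclasses (Cd iota (2 ^ m) 1) N /\
     168 * N%:Z = q ^+ 6 - 7 * q ^+ 5 + 42 * q ^+ 4 - 140 * q ^+ 3
                  + 343 * q ^+ 2 - 462 * q + 328) /\
  (exists N : nat, nclasses (Cd iota (2 ^ m) 2) N /\
     8 * N%:Z = q ^+ 6 - 3 * q ^+ 5 + 6 * q ^+ 4 - 12 * q ^+ 3 + 15 * q ^+ 2 - 6 * q) /\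
  (exists N : nat, nclasses (Cd iota (2 ^ m) 3) N /\
     3 * N%:Z = q ^+ 6 - q ^+ 5 - 2 * q ^+ 3 + 4 * q ^+ 2 - 6 * q + 7) /\
  (exists N : nat, nclasses (Cd iota (2 ^ m) 4) N /\
     4 * N%:Z = q ^+ 6 - q ^+ 5 - q ^+ 2 - 2 * q + 4) /\
  (exists N : nat, nclasses (C70 iota (2 ^ m)) N /\ 7 * N%:Z = q ^+ 6 + 6) /\
  (exists N : nat, nclasses (C71 iota (2 ^ m)) N /\ 7 * N%:Z = q ^+ 6 + 6).
Proof.
move=> m_gt0 cardF q.
have char2F : 2%N \in [pchar F] by apply: card_finPcharP cardF _.
have cnt g : g \in reps -> exists N, nclasses (otyp iota (2 ^ m) g) N /\
    (size (centralizer g))%:Z * N%:Z = \sum_(h <- centralizer g) (npts q (odata g h)).1.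
  move=> rg; have [N [ncl e]] := class_count iota char2F m_gt0 (erefl _) cardF rg.
  by exists N; rewrite mulrC.
have sz1 : size (centralizer g1) = 168%N by vm_compute.
have sz2 : size (centralizer g2) = 8%N by vm_compute.
have sz3 : size (centralizer g3) = 3%N by vm_compute.
have sz4 : size (centralizer g4) = 4%N by vm_compute.
have sz70 : size (centralizer g70) = 7%N by vm_compute.
have sz71 : size (centralizer g71) = 7%N by vm_compute.
have [N1 [c1 e1]] := cnt g1 isT; rewrite sz1 burnside_sum1 in e1.
have [N2 [c2 e2]] := cnt g2 isT; rewrite sz2 burnside_sum2 in e2.
have [N3 [c3 e3]] := cnt g3 isT; rewrite sz3 burnside_sum3 in e3.
have [N4 [c4 e4]] := cnt g4 isT; rewrite sz4 burnside_sum4 in e4.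
have [N70 [c70 e70]] := cnt g70 isT; rewrite sz70 burnside_sum70 in e70.
have [N71 [c71 e71]] := cnt g71 isT; rewrite sz71 burnside_sum71 in e71.
have CdE n g : (0 < n)%N -> selects (bdeg^~ n) g -> forall N,
    nclasses (otyp iota (2 ^ m) g) N -> nclasses (Cd iota (2 ^ m) n) N.
  move=> n0 sel N; apply: nclasses_ext.
  exact: (Cd_otyp iota char2F m_gt0 (erefl _) cardF n0 sel).
split; last split; last split; last split; last split; last split.
- exists (\sum_(g <- reps) (nth 0 [:: N1; N2; N3; N4; N70; N71] (index g reps)))%N; split.
    apply: (@nclasses_ext _ (fun f => exists2 g, g \in reps & otyp iota (2 ^ m) g f)).
      move=> f; split=> [[g _ []] //|ordf].
      have [g Gg tf] := ord_typ char2F (erefl _) cardF ordf.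
      have [h rh [k Gk e]] := GL3_reps Gg.
      by exists h => //; split=> //; apply: (typ_conj char2F m_gt0 (erefl _) Gk e tf).
    apply: (nclasses_union char2F m_gt0 (erefl _) cardF).
    + exact: reps_GL3.
    + by vm_compute.
    + by move=> g; rewrite !inE; do ![case/orP]; move/eqP->;
        [exact: c1|exact: c2|exact: c3|exact: c4|exact: c70|exact: c71].
  rewrite !big_cons big_nil /=.
  (* The common denominator is the order of GL_3(F_2); the weights 1, 21, 56, 42, 24, 24 are the
     sizes of its conjugacy classes. *)
  apply: (@mulfI _ 168) => //; rewrite !PoszD.
  transitivity (168%:Z * N1%:Z + 21 * (8%:Z * N2%:Z) + 56 * (3%:Z * N3%:Z) + 42 * (4%:Z * N4%:Z)
     + 24 * (7%:Z * N70%:Z) + 24 * (7%:Z * N71%:Z)).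
    ring.
  by rewrite e1 e2 e3 e4 e70 e71; ring.
- by exists N1; split; [apply: CdE c1; vm_compute | exact: e1].
- by exists N2; split; [apply: CdE c2; vm_compute | exact: e2].
- by exists N3; split; [apply: CdE c3; vm_compute | exact: e3].
- by exists N4; split; [apply: CdE c4; vm_compute | exact: e4].
- exists N70; split; last exact: e70; apply: nclasses_ext c70.
  by apply: (@C7_otyp _ _ iota char2F m _ m_gt0 (erefl _) cardF 1 3) => //; vm_compute.
- exists N71; split; last exact: e71; apply: nclasses_ext c71.
  by apply: (@C7_otyp _ _ iota char2F m _ m_gt0 (erefl _) cardF 2 3) => //; vm_compute.
Qed.
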